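(* Let $k_1,k_2\ge 0$, $\beta\in[0,1/2)$, $\nu\in(-1,0]$. Let $A:\mathbb{R}_{>0}\times\mathbb{R}_{>0}\to[0,\infty)$ be measurable and symmetric, $S:\mathbb{R}_{>0}\to[0,\infty)$ measurable, and let $b(y|z)=(\nu+2)\frac{y^{\nu}}{z^{1+\nu}}$ for $0<y<z$, $b(y|z)=0$ for $y\ge z$. Assume: (1) $A(y,z)\le k_1\frac{1+y+z}{(yz)^{\beta}}$ for all $y,z>0$; (2) there is a constant $c_1>2$ (depending on $\nu$ and $\beta$) with $\int_0^z y^{-2\beta}b(y|z)\,dy\le c_1z^{-2\beta}$ for all $z>0$; (3) $S(y)\le k_2y^{1+\nu}$ for all $y>0$, and there exists $\gamma\in(1,2)$ with $\gamma(\nu-\beta)+1>0$; (4) $g^{in}\ge 0$ a.e. and $g^{in}\in L^1_{-2\beta,1}(\mathbb{R}_{>0})$. Fix $\zeta\in\{0,1\}$ and, for each integer $n\ge 1$, let $g_n$ be the solution of the truncated problem with parameter $\zeta$ (see context), extended by zero to $y\ge n$. Then there exist a subsequence $(g_{n_k})$ of $(g_n)$ and a nonnegative function $g$ such that $$g_{n_k}\to g\quad\text{in } \mathcal{C}([0,T]_w;L^1_{-\beta,1}(\mathbb{R}_{>0}))\quad\text{for each } T>0,$$ and $g$ is a mass-conserving weak solution of the coagulation and multiple fragmentation equation with initial datum $g^{in}$, i.e. $$\int_0^\infty y\,g(t,y)\,dy=\int_0^\infty y\,g^{in}(y)\,dy\quad\text{for all } t\ge 0,$$ and, for every $T>0$,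 every $t\in[0,T]$ and every $\omega\in L^\infty(\mathbb{R}_{>0})$, $$\int_0^\infty[g(t,y)-g^{in}(y)]\omega(y)\,dy=\frac12\int_0^t\int_0^\infty\int_0^\infty\tilde\omega(y,z)A(y,z)g(s,y)g(s,z)\,dz\,dy\,ds-\int_0^t\int_0^\infty\eta(y)S(y)g(s,y)\,dy\,ds,$$ where $\tilde\omega(y,z):=\omega(y+z)-\omega(y)-\omega(z)$ and $\eta(y):=\omega(y)-\int_0^y b(z|y)\omega(z)\,dz$.
   Context: Spaces: $\mathbb{R}_{>0}=(0,\infty)$; for $a\in\mathbb{R}$, $L^1_{a,1}(\mathbb{R}_{>0})=L^1(\mathbb{R}_{>0};(y^{a}+y)\,dy)$. $\mathcal{C}([0,T]_w;L^1_{-\beta,1}(\mathbb{R}_{>0}))$ is the space of weakly continuous functions from $[0,T]$ to $L^1_{-\beta,1}(\mathbb{R}_{>0})$; a sequence $(g_n)$ converges to $g$ in it if $\lim_{n\to\infty}\sup_{t\in[0,T]}\left|\int_0^\infty(y^{-\beta}+y)[g_n(t,y)-g(t,y)]\omega(y)\,dy\right|=0$ for every $\omega\in L^\infty(\mathbb{R}_{>0})$. Equation: the continuous coagulation and multiple fragmentation equation is $$\partial_tg(t,y)=\tfrac12\int_0^yA(y-z,z)g(t,y-z)g(t,z)\,dz-\int_0^\infty A(y,z)g(t,y)g(t,z)\,dz+\int_y^\infty b(y|z)S(z)g(t,z)\,dz-S(y)g(t,y),$$ with $g(0,y)=g^{in}(y)\ge 0$ a.e. Weak solutions are understood in the sense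 of the weak formulation in the claim. Truncated problem: let $\chi_I$ be the indicator function of $I$. For $n\ge 1$ and $\zeta\in\{0,1\}$ put $g_n^{in}=g^{in}\chi_{(0,n)}$, $S_n=S\chi_{(0,n)}$ and $$A_n^\zeta(y,z)=A(y,z)\chi_{(1/n,n)}(y)\chi_{(1/n,n)}(z)\,[1-\zeta+\zeta\chi_{(0,n)}(y+z)].$$ The truncated problem with parameter $\zeta$ is, for $y\in(0,n)$, $$\partial_tg_n(t,y)=\tfrac12\int_0^yA_n^\zeta(y-z,z)g_n(t,y-z)g_n(t,z)\,dz-\int_0^{n-\zeta y}A_n^\zeta(y,z)g_n(t,y)g_n(t,z)\,dz+\int_y^nb(y|z)S_n(z)g_n(t,z)\,dz-S_n(y)g_n(t,y),$$ with $g_n(0,y)=g_n^{in}(y)$. ($\zeta=1$ is the conservative and $\zeta=0$ the non-conservative truncation.) It has a unique nonnegative solution $g_n\in C^1([0,\infty);L^1(0,n))$, which is the $g_n$ meant in the claim. *)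

(* Defs.v *)
(* Functions of the size variable y > 0 are represented by
   total functions R -> R of which only the values on ]0, +oo[ matter. *)
From HB Require Import structures.
From mathcomp Require Import all_boot all_order all_algebra.
From mathcomp Require Import all_classical all_reals all_analysis.

Set Implicit Arguments.
Unset Strict Implicit.
Unset Printing Implicit Defensive.

Import Order.TTheory GRing.Theory Num.Theory.
Import numFieldNormedType.Exports.

Local Open Scope classical_set_scope.
Local Open Scope ring_scope.

Section Defs.
Context (R : realType).

Local Notation mu := (@lebesgue_measure R).

Definition Rpos : set R := `]0, +oo[.

Definition weight (a y : R) : R := y `^ a + y.

(* L^1_{a,1}(Rpos) = L^1(Rpos; (y^a + y) dy) *)
Definition in_L1w (a : R) (f : R -> R) : Prop :=
  mu.-integrable Rpos (fun y : R => (weight a y * f y)%:E).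

Definition in_Linfty (w : R -> R) : Prop := w \_ Rpos \in Lfun mu +oo%E.

(* C([0,T]_w; L^1_{a,1}(Rpos)); the dual of L^1_{a,1} is L^oo, through the
   pairing (f, w) |-> \int (y^a + y) f(y) w(y) dy *)
Definition weakly_continuous (T a : R) (g : R -> R -> R) : Prop :=
  (forall t : R, t \in `[0, T] -> in_L1w a (g t)) /\
  (forall w : R -> R, in_Linfty w ->
     {within `[0, T], continuous
        (fun t : R => \int[mu]_(y in Rpos) (weight a y * g t y * w y))}).

Definition weakly_converges (T a : R) (h : nat -> R -> R -> R)
    (g : R -> R -> R) : Prop :=
  [/\ forall k, weakly_continuous T a (h k),
      weakly_continuous T a g &
      forall w : R -> R, in_Linfty w ->
        ereal_sup
          [set (`| \int[mu]_(y in Rpos)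
                     (weight a y * (h k t y - g t y) * w y) |)%:E
          | t in `[0, T]] @[k --> \oo] --> 0%E].

Definition L1_dist (I : set R) (f g : R -> R) : \bar R :=
  (\int[mu]_(y in I) `| f y - g y |%:E)%E.

(* u belongs to C^1([0, +oo[; L^1(I)) with derivative v; the derivative is the
   limit in L^1(I) of difference quotients (one-sided at t = 0) *)
Definition is_C1_L1 (I : set R) (u v : R -> R -> R) : Prop :=
  [/\ forall t : R, 0 <= t -> mu.-integrable I (EFin \o u t),
      forall t : R, 0 <= t -> mu.-integrable I (EFin \o v t),
      forall t : R, 0 <= t ->
        L1_dist I (v s) (v t) @[s --> within `[0, +oo[ (nbhs t)] --> 0%E &
      forall t : R, 0 <= t ->
        L1_dist I (fun y => (u s y - u t y) / (s - t)) (v t)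
          @[s --> within `[0, +oo[ t^'] --> 0%E].

(* daughter distribution b(y|z) *)
Definition breakage (nu y z : R) : R :=
  if 0 < y < z then (nu + 2) * (y `^ nu / z `^ (1 + nu)) else 0.

Definition trunc_fun (n : nat) (f : R -> R) (y : R) : R :=
  f y * \1_(`]0, n%:R[) y.

Definition trunc_kernel (zeta : R) (n : nat) (A : R -> R -> R) (y z : R) : R :=
  A y z * \1_(`]n%:R^-1, n%:R[) y * \1_(`]n%:R^-1, n%:R[) z
        * (1 - zeta + zeta * \1_(`]0, n%:R[) (y + z)).

Definition truncated_rhs (A : R -> R -> R) (S : R -> R) (b : R -> R -> R)
    (zeta : R) (n : nat) (u : R -> R) (y : R) : R :=
  let An := trunc_kernel zeta n A in
  let Sn := trunc_fun n S in
  2^-1 * (\int[mu]_(z in `]0, y[) (An (y - z) z * u (y - z) * u z))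
  - (\int[mu]_(z in `]0, (n%:R - zeta * y)[) (An y z * u y * u z))
  + (\int[mu]_(z in `]y, n%:R[) (b y z * Sn z * u z))
  - Sn y * u y.

(* nonnegative solution of the truncated problem, extended by 0 to y >= n *)
Definition truncated_solution (A : R -> R -> R) (S : R -> R) (b : R -> R -> R)
    (gin : R -> R) (zeta : R) (n : nat) (u : R -> R -> R) : Prop :=
  [/\ exists2 v : R -> R -> R, is_C1_L1 `]0, n%:R[ u v &
        forall t : R, 0 <= t -> \forall y \ae mu, y \in `]0, n%:R[ ->
          v t y = truncated_rhs A S b zeta n (u t) y,
      \forall y \ae mu, y \in `]0, n%:R[ -> u 0 y = trunc_fun n gin y,
      forall t : R, 0 <= t ->
        \forall y \ae mu, y \in `]0, n%:R[ -> 0 <= u t y &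
      forall t y : R, 0 <= t -> n%:R <= y -> u t y = 0].

Definition omega_tilde (w : R -> R) (y z : R) : R := w (y + z) - w y - w z.

Definition eta_frag (b : R -> R -> R) (w : R -> R) (y : R) : R :=
  w y - \int[mu]_(z in `]0, y[) (b z y * w z).

Definition mass_conserving (gin : R -> R) (g : R -> R -> R) : Prop :=
  forall t : R, 0 <= t ->
    \int[mu]_(y in Rpos) (y * g t y) = \int[mu]_(y in Rpos) (y * gin y).

(* The first four clauses say that the integrals on the right-hand side of the
   equation converge; without them the total operator \int could return the
   default value 0. *)
Definition weak_formulation (A : R -> R -> R) (S : R -> R) (b : R -> R -> R)
    (gin : R -> R) (g : R -> R -> R) : Prop :=
  forall (T t : R) (w : R -> R), 0 < T -> t \in `[0, T] -> in_Linfty w ->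
  let coag s y z := omega_tilde w y z * A y z * g s y * g s z in
  let frag s y := eta_frag b w y * S y * g s y in
  [/\ forall s : R, s \in `[0, t] ->
        (mu \x mu)%E.-integrable (Rpos `*` Rpos)
          (fun p : R * R => (coag s p.1 p.2)%:E),
      forall s : R, s \in `[0, t] ->
        mu.-integrable Rpos (fun y => (frag s y)%:E),
      mu.-integrable `[0, t]
        (fun s => (\int[mu]_(y in Rpos) \int[mu]_(z in Rpos) coag s y z)%:E),
      mu.-integrable `[0, t] (fun s => (\int[mu]_(y in Rpos) frag s y)%:E) &
      \int[mu]_(y in Rpos) ((g t y - gin y) * w y) =
        2^-1 * (\int[mu]_(s in `[0, t])
                  \int[mu]_(y in Rpos) \int[mu]_(z in Rpos) coag s y z)
        - \int[mu]_(s in `[0, t]) \int[mu]_(y in Rpos) frag s y].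

End Defs.

Arguments Rpos {R}.

(* Main.v *)
(* The weighted solutions (y^-beta + y) g_n are weakly compact: the mass is
   nonincreasing, the moment of order -2 beta is controlled by testing with the
   nonincreasing functions min(y^-2beta, m) and Gronwall's lemma, and both the
   mass beyond l and the integrals over small sets E stay small.  For the last
   two, coagulation couples the quantity at the level k to the one at the level
   k - 1 of a decreasing family (l_k = 4^k, respectively sets all of whose
   translates are small), with a bounded factor, so that smallness at time 0
   propagates over [0, T].  A weak Arzela-Ascoli theorem then gives a limit
   uniformly in t.  In the weak form the kernels divided by the weights are
   bounded, and quadratic forms with bounded kernels are sequentially continuous
   for weak L^1 convergence.  The limit has at most the initial mass; it has at
   least that mass because min(y, l) is a test function for which fragmentation
   is a gain and the coagulation loss vanishes as l tends to infinity. *)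
Require Import Defs.
From HB Require Import structures.
From mathcomp Require Import all_boot all_order all_algebra.
From mathcomp Require Import all_classical all_reals all_analysis.
From mathcomp Require Import measurable_realfun ring lra.

Set Implicit Arguments.
Unset Strict Implicit.
Unset Printing Implicit Defensive.

Import Order.TTheory GRing.Theory Num.Theory.
Import numFieldNormedType.Exports.

Local Open Scope classical_set_scope.
Local Open Scope ring_scope.

(** * Integrals over the real line *)

Section real_integral.
Variable R : realType.
Local Notation mu := (@lebesgue_measure R).
Implicit Types f g : R -> R.

(** At each time the truncated equation holds only for almost every y, so every estimate tests it
    with a bounded function; unbounded weights are reached through the support (0, n) of the
    solution or through a minimum with a constant m that Fatou's lemma removes. For the mass beyond
    l, the gain at level l is fed by sizes above l/2, where max(0, y - l) may vanish, so an estimate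
    at a single level does not close; the excess over l/4 does control these sizes. For small sets,
    coagulation with a partner of size y moves E to E - y, so smallness is required of all
    translates at once. There the singular factor of the kernel and that of the weight fall on the
    same particle, which is where the order -2 beta comes from. Fragmentation feeds small sets with
    a density z^(nu - beta) that does not depend on the parent, because the growth of S cancels the
    normalisation of b. Dividing by the weights leaves bounded kernels that need not decay;
    equi-integrability makes up for that. Conservation of mass is derived from the limit equation,
    since the approximations themselves may lose mass when zeta = 0. *)

Definition integ f : Prop := mu.-integrable setT (EFin \o f).

Definition Int f : R := \int[mu]_x f x.

Lemma ae_imp (P Q : R -> Prop) : (forall x, P x -> Q x) ->
  {ae mu, forall x, P x} -> {ae mu, forall x, Q x}.
Proof. by move=> PQ; apply: (@filterS _ _ (ae_filter_ringOfSetsType _)). Qed.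

Lemma ae_and (P Q : R -> Prop) : {ae mu, forall x, P x} ->
  {ae mu, forall x, Q x} -> {ae mu, forall x, P x /\ Q x}.
Proof. exact: (@filterI _ _ (ae_filter_ringOfSetsType _)). Qed.

Lemma ae_all (P : R -> Prop) : (forall x, P x) -> {ae mu, forall x, P x}.
Proof. by move=> h; apply: nearW. Qed.

Lemma integ_meas f : integ f -> measurable_fun setT f.
Proof. by move=> /integrableP[/measurable_EFinP]. Qed.

Lemma IntE f : integ f -> (Int f)%:E = (\int[mu]_x (f x)%:E)%E.
Proof. by move=> fi; rewrite /Int /Rintegral fineK//; exact: integrable_fin_num. Qed.

Lemma integ_le f g : measurable_fun setT f -> (forall x, `|f x| <= g x) ->
  integ g -> integ f.
Proof.
move=> mf fg gi; apply: (le_integrable measurableT _ _ gi).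
  exact/measurable_EFinP.
move=> x _ /=; rewrite lee_fin (le_trans (fg x))//; exact: ler_norm.
Qed.

Lemma integ_eq f g : f =1 g -> integ f -> integ g.
Proof. by move=> /funext ->. Qed.

Lemma integ0 : integ (fun=> 0).
Proof. exact: integrable0. Qed.

Lemma integD f g : integ f -> integ g -> integ (fun x => f x + g x).
Proof. by move=> fi gi; apply: (integrableD measurableT fi gi). Qed.

Lemma integN f : integ f -> integ (fun x => - f x).
Proof. by move=> fi; have := integrableN fi. Qed.

Lemma integB f g : integ f -> integ g -> integ (fun x => f x - g x).
Proof. by move=> fi gi; apply: integD => //; exact: integN. Qed.

Lemma integZ c f : integ f -> integ (fun x => c * f x).
Proof. by move=> fi; apply: (integrableZl measurableT c fi). Qed.

Lemma integ_abs f : integ f -> integ (fun x => `|f x|).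
Proof. by move=> fi; have := integrable_abse fi. Qed.

Lemma integ_mulb (om f : R -> R) C : measurable_fun setT om -> (forall x, `|om x| <= C) ->
  integ f -> integ (fun x => om x * f x).
Proof.
move=> mom omC fi; apply: (@integ_le _ (fun x => C * `|f x|)).
- by apply: measurable_funM => //; exact: integ_meas.
- by move=> x; rewrite normrM ler_wpM2r.
- exact/integZ/integ_abs.
Qed.

Lemma indic_le1 (E : set R) x : `|\1_E x : R| <= 1.
Proof. by rewrite indicE; case: (_ \in _); rewrite ?normr1 ?normr0. Qed.

Lemma integ_indic (E : set R) f : measurable E -> integ f ->
  integ (fun x => \1_E x * f x).
Proof.
by move=> mE; apply: (integ_mulb (C := 1)) => [|x]; [exact: measurable_indic|exact: indic_le1].
Qed.

Lemma Int_eq f g : f =1 g -> Int f = Int g.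
Proof. by move=> /funext ->. Qed.

Lemma Int0 : Int (fun=> 0) = 0.
Proof. by rewrite /Int /Rintegral integral0. Qed.

Lemma IntD f g : integ f -> integ g -> Int (fun x => f x + g x) = Int f + Int g.
Proof. exact: RintegralD. Qed.

Lemma IntB f g : integ f -> integ g -> Int (fun x => f x - g x) = Int f - Int g.
Proof. exact: RintegralB. Qed.

Lemma IntZ c f : integ f -> Int (fun x => c * f x) = c * Int f.
Proof. exact: RintegralZl. Qed.

Lemma IntN f : integ f -> Int (fun x => - f x) = - Int f.
Proof. by move=> fi; rewrite -mulN1r -IntZ//; apply: Int_eq => x; rewrite mulN1r. Qed.

Lemma Int_le f g : integ f -> integ g -> (forall x, f x <= g x) -> Int f <= Int g.
Proof. by move=> fi gi fg; apply: le_Rintegral. Qed.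

Lemma Int_ge0 f : (forall x, 0 <= f x) -> 0 <= Int f.
Proof. by move=> f0; apply: Rintegral_ge0. Qed.

Lemma Int_abs f : integ f -> `|Int f| <= Int (fun x => `|f x|).
Proof. exact: le_normr_Rintegral. Qed.

Lemma Int_mulb (om f : R -> R) C : measurable_fun setT om -> (forall x, `|om x| <= C) ->
  integ f -> `|Int (fun x => om x * f x)| <= C * Int (fun x => `|f x|).
Proof.
move=> mom omC fi; have omf := integ_mulb mom omC fi.
apply: (le_trans (Int_abs omf)); rewrite -IntZ; last exact: integ_abs.
apply: Int_le => [||x]; [exact: integ_abs|exact/integZ/integ_abs|].
by rewrite normrM ler_wpM2r.
Qed.

Lemma ae_eq_Int f g : measurable_fun setT f -> measurable_fun setT g ->
  {ae mu, forall x, f x = g x} -> Int f = Int g.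
Proof.
move=> mf mg fg; congr fine; apply: ae_eq_integral => //; do ?exact/measurable_EFinP.
by apply: ae_imp fg => x /= ->.
Qed.

Lemma ae_eq_integ f g : measurable_fun setT g ->
  {ae mu, forall x, f x = g x} -> integ f -> integ g.
Proof.
move=> mg fg /[dup] /integ_meas mf /integrableP[_ fi]; apply/integrableP; split.
  exact/measurable_EFinP.
rewrite -(@ae_eq_integral _ _ _ mu setT _ (fun x => `|(f x)%:E|%E))//.
- by apply: measurableT_comp => //; exact/measurable_EFinP.
- by apply: measurableT_comp => //; exact/measurable_EFinP.
- by apply: ae_imp fg => x /= ->.
Qed.

Lemma integ_ge0P f : measurable_fun setT f -> (forall x, 0 <= f x) ->
  (\int[mu]_x (f x)%:E < +oo)%E -> integ f.
Proof.
move=> mf f0 fi; apply/integrableP; split; first exact/measurable_EFinP.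
by under eq_integral do rewrite /= ger0_norm//.
Qed.

Lemma Int_dct (f_ : nat -> R -> R) f g : (forall n, measurable_fun setT (f_ n)) ->
  (forall x, f_ n x @[n --> \oo] --> f x) ->
  (forall n x, `|f_ n x| <= g x) -> integ g ->
  integ f /\ Int (f_ n) @[n --> \oo] --> Int f.
Proof.
move=> mf ff fg gi.
have mlim : measurable_fun setT f by apply: (measurable_fun_cvg mf) => x _; exact: ff.
have [||||fi _ H] := @dominated_convergence _ _ _ mu setT measurableT
  (fun n => EFin \o f_ n) (EFin \o f) (EFin \o g) _ _ _ gi.
- by move=> n; apply/measurable_EFinP; exact: mf.
- exact/measurable_EFinP.
- by apply: ae_all => x _; apply/cvg_EFin; [exact: nearW|exact: ff].
- by apply: ae_all => x n _ /=; rewrite lee_fin.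
split => //.
have fni n : integ (f_ n) by exact: integ_le gi.
apply/fine_cvg; rewrite /= fineK; last exact: integrable_fin_num.
exact: H.
Qed.

(** Integrability of the limit is part of the conclusion: a bound valid for every truncation min(om,
    m) of a test function thereby passes to the function itself. *)
Lemma integ_fatou (f_ : nat -> R -> R) f C : (forall n, integ (f_ n)) ->
  (forall n x, 0 <= f_ n x) -> (forall x, f_ n x @[n --> \oo] --> f x) ->
  (forall n, Int (f_ n) <= C) -> integ f /\ Int f <= C.
Proof.
move=> fi f0 ff fC.
have mlim : measurable_fun setT f.
  by apply: (measurable_fun_cvg (fun n => integ_meas (fi n))) => x _; exact: ff.
have lim0 x : 0 <= f x.
  by rewrite -(cvg_lim _ (ff x))//; apply: limr_ge; [exact: cvgP (ff x)|exact: nearW].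
have key : (\int[mu]_x (f x)%:E <= C%:E)%E.
  have := @fatou _ _ _ mu setT measurableT (fun n => EFin \o f_ n).
  move=> /(_ (fun n => (measurable_EFinP _ _).2 (integ_meas (fi n))))/=.
  have h0 n x : setT x -> (0 <= (EFin \o f_ n) x)%E by move=> _; rewrite lee_fin.
  move=> /(_ h0) h.
  have E x : limn_einf (fun n => (f_ n x)%:E) = (f x)%:E.
    have c : (f_ n x)%:E @[n --> \oo] --> (f x)%:E.
      by apply/cvg_EFin; [exact: nearW|exact: ff].
    by rewrite is_cvg_limn_einfE; [exact/cvg_lim|apply/cvg_ex; exists (f x)%:E].
  rewrite (funext E) in h.
  apply: (le_trans h); rewrite limn_einf_lim; apply: lime_le.
    exact: is_cvg_einfs.
  apply: nearW => n; apply: (@le_trans _ _ (\int[mu]_x (f_ n x)%:E)%E).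
    by apply: ereal_inf_lbound; exists n => /=.
  by rewrite -IntE// lee_fin.
have fi' : integ f by apply: integ_ge0P => //; exact: le_lt_trans key (ltry _).
by split => //; rewrite -lee_fin IntE.
Qed.

Lemma Int_set (D : set R) f : \int[mu]_(x in D) f x = Int (fun x => \1_D x * f x).
Proof.
rewrite Rintegral_mkcond; apply: Int_eq => x.
by rewrite patchE indicE; case: (x \in D); rewrite ?mul1r ?mul0r.
Qed.

Lemma integ_set (D : set R) f : measurable D ->
  mu.-integrable D (EFin \o f) <-> integ (fun x => \1_D x * f x).
Proof.
move=> mD; rewrite /integ.
have H := integrable_mkcond (mu := mu) (EFin \o f) mD.
suff E : (EFin \o f) \_ D = EFin \o (fun x => \1_D x * f x) by rewrite -E; split => h; [rewrite -H|rewrite H].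
apply/funext => x; rewrite /= patchE indicE.
by case: (x \in D); rewrite ?mul1r ?mul0r.
Qed.

End real_integral.

(** * Iterated integrals on the plane and translations of the line *)

Section real_fubini.
Variable R : realType.
Local Notation mu := (@lebesgue_measure R).
Implicit Types (f g : R -> R) (K : R -> R -> R).

Definition meas2 K : Prop :=
  measurable_fun [set: R * R] (fun p : R * R => K p.1 p.2).

Definition integ2 K : Prop :=
  (mu \x mu)%E.-integrable [set: R * R] (fun p : R * R => (K p.1 p.2)%:E).

Lemma meas2_l K y : meas2 K -> measurable_fun setT (K y).
Proof. by move=> mK; have := measurableT_comp mK (pair1_measurable y). Qed.

Lemma meas2_r K z : meas2 K -> measurable_fun setT (fun y => K y z).
Proof. by move=> mK; have := measurableT_comp mK (pair2_measurable z). Qed.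

Lemma meas2_swap K : meas2 K -> meas2 (fun y z => K z y).
Proof. by move=> mK; have := measurableT_comp mK (@measurable_swap _ _ _ _). Qed.

(** No row has to be integrable: [Int] is the finite part of a difference of two Tonelli integrals,
    each measurable in y. *)
Lemma meas_Int K : meas2 K -> measurable_fun setT (fun y => Int (K y)).
Proof.
move=> mK; rewrite /Int /Rintegral.
have mE : measurable_fun [set: R * R] (fun p : R * R => (K p.1 p.2)%:E).
  exact/measurable_EFinP.
apply: (measurableT_comp (@fine_measurable R setT measurableT)).
have E : (fun y => \int[mu]_z (K y z)%:E)%E =
  (fun y => \int[mu]_z ((fun p : R * R => (K p.1 p.2)%:E)^\+ (y, z)) -
   \int[mu]_z ((fun p : R * R => (K p.1 p.2)%:E)^\- (y, z)))%E.
  apply/funext => y; rewrite integralE.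
  by congr (_ - _)%E; apply: eq_integral => z _; rewrite ?funeposE ?funenegE.
rewrite {}E; apply: emeasurable_funB; apply: measurable_fun_fubini_tonelli_F => //.
- exact: measurable_funepos.
- exact: measurable_funeneg.
Qed.

Lemma integ2_meas K : integ2 K -> meas2 K.
Proof. by move=> /integrableP[/measurable_EFinP]. Qed.

Lemma integ2_swap K : integ2 K -> integ2 (fun y z => K z y).
Proof.
move=> K2; have mK := integ2_meas K2.
have m1 := (measurable_EFinP setT (fun p : R * R => K p.1 p.2)).2 mK.
have m2 := (measurable_EFinP setT (fun p : R * R => K p.2 p.1)).2 (meas2_swap mK).
by apply/(integrable21ltyP mu mu m2); apply/(integrable12ltyP mu mu m1).
Qed.

Lemma integ2_dom K (h : R -> R) : meas2 K -> integ h ->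
  (forall y, integ (K y) /\ Int (fun z => `|K y z|) <= h y) -> integ2 K.
Proof.
move=> mK hi Kh; apply/integrable12ltyP; first exact/measurable_EFinP.
have /integrableP[mh] := hi; apply: le_lt_trans.
apply: ge0_le_integral => //.
- move=> y _; exact: integral_ge0.
- have := @measurable_fun_fubini_tonelli_F _ _ _ _ _ mu (fun p : R * R => `|(K p.1 p.2)%:E|%E).
  by apply => //; apply: measurableT_comp => //; exact/measurable_EFinP.
- exact: measurableT_comp.
- move=> y _; have [iK Kle] := Kh y.
  rewrite /= -(IntE (integ_abs iK)) lee_fin (le_trans Kle)//; exact: ler_norm.
Qed.

Lemma integ2_bound K f g : meas2 K -> integ f -> integ g ->
  (forall y z, `|K y z| <= f y * g z) -> integ2 K.
Proof.
move=> mK fi gi Kfg.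
have iK y : integ (K y).
  apply: (integ_le _ (Kfg y)); first exact: meas2_l.
  exact: integZ.
apply: (integ2_dom mK (h := fun y => Int g * f y)); first exact: integZ.
move=> y; split => //; rewrite mulrC -IntZ//.
by apply: Int_le; [exact: integ_abs|exact: integZ|exact: Kfg].
Qed.

(** Fubini's theorem controls the rows for almost every y only; where a row is not integrable, [Int]
    has a default value, which the outer integral does not see. *)
Lemma integ2_Int K : integ2 K ->
  integ (fun y => Int (K y)) /\
  (Int (fun y => Int (K y)))%:E = (\int[(mu \x mu)%E]_p (K p.1 p.2)%:E)%E.
Proof.
move=> iK; have mK := integ2_meas iK.
have Fi := integrable_fubini_F iK.
have ae : {ae mu, forall y, (Int (K y))%:E = fubini_F mu (fun p : R * R => (K p.1 p.2)%:E) y}.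
  apply: filterS (ae_integrable1 iK) => y Ky.
  by rewrite IntE.
have mI := meas_Int mK.
have i1 : integ (fun y => Int (K y)).
  have /integrableP[mF Foo] := Fi; apply/integrableP; split; first exact/measurable_EFinP.
  rewrite (@ae_eq_integral _ _ _ mu setT (fun x => `|fubini_F mu (fun p : R * R => (K p.1 p.2)%:E) x|%E))//.
  - by apply: measurableT_comp => //; exact/measurable_EFinP.
  - exact: measurableT_comp.
  - by apply: ae_imp ae => y h _; congr abse.
split => //; rewrite IntE// -integral12_prod_meas1//.
apply: ae_eq_integral => //; first exact/measurable_EFinP.
- by case/integrableP: Fi.
- by apply: ae_imp ae.
Qed.

Lemma integ2_Int_r K : integ2 K -> integ (fun z => Int (fun y => K y z)).
Proof. by move=> /integ2_swap/integ2_Int[]. Qed.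

Lemma Fubini_Int K : integ2 K ->
  Int (fun y => Int (fun z => K y z)) = Int (fun z => Int (fun y => K y z)).
Proof.
move=> iK; have [_ E1] := integ2_Int iK; have [_ E2] := integ2_Int (integ2_swap iK).
apply: EFin_inj; rewrite E1 E2.
rewrite -(integral12_prod_meas1 iK) -(integral21_prod_meas1 (integ2_swap iK)).
by [].
Qed.

Lemma measurable_shift (a : R) : measurable_fun [set: R] (fun y : R => y + a).
Proof. exact: measurable_funD. Qed.

(** Lebesgue measure is determined by its values on half-open intervals, and a translation keeps
    their lengths. *)
Lemma lebesgue_measure_shift (a : R) (A : set R) : measurable A ->
  pushforward mu (fun y : R => y + a) A = mu A.
Proof.
move=> mA.
pose nu : {measure set (measurableTypeR R) -> \bar R} := pushforward mu
  (fun y : measurableTypeR R => (y + a)%R : measurableTypeR R).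
rewrite -[LHS]/(nu (measurable_shift a) A).
rewrite (@lebesgue_measure_unique R (nu (measurable_shift a)))//.
move=> X [[x y] _ <-] /=; rewrite /pushforward.
have -> : (fun y : R => y + a) @^-1` `]x, y]%classic = `](x - a), (y - a)]%classic.
  by apply/seteqP; split => z /=; rewrite !in_itv/= ltrBlDr lerBrDr.
rewrite !lebesgue_measure_itv/= !lte_fin ltrD2r.
by case: ifP => // _; rewrite -!EFinB; congr EFin; ring.
Qed.

Let shift_mu (a : R) : {measure set (measurableTypeR R) -> \bar R}.
Proof.
pose nu : {measure set (measurableTypeR R) -> \bar R} := pushforward mu
  (fun y : measurableTypeR R => (y + a)%R : measurableTypeR R).
exact: nu (measurable_shift a).
Defined.

Lemma measurable_fun_shift f a : measurable_fun setT f ->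
  measurable_fun setT (fun y : R => f (y + a)).
Proof. by move=> mf; have := measurableT_comp mf (measurable_shift a). Qed.

Let integral_shift_mu (h : R -> \bar R) a :
  (\int[shift_mu a]_x h x = \int[mu]_x h x)%E.
Proof.
by apply: (@eq_measure_integral _ _ _ setT mu (shift_mu a) h) => A mA _; exact: lebesgue_measure_shift.
Qed.

Lemma integ_shift f a : integ f -> integ (fun y => f (y + a)).
Proof.
move=> fi; have mf := integ_meas fi.
have mfs := measurable_fun_shift a mf.
have /integrableP[_ foo] := fi; apply/integrableP; split; first exact/measurable_EFinP.
have := @ge0_integral_pushforward _ _ (measurableTypeR R) (measurableTypeR R) _ _ (measurable_shift a) mu setT
  (fun x => `|(EFin \o f) x|%E) measurableT.
move=> /(_ _ (fun x _ => abse_ge0 _)) H.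
by move: foo; rewrite -(integral_shift_mu _ a) H//; apply: measurableT_comp => //; exact/measurable_EFinP.
Qed.

Lemma Int_shift f a : integ f -> Int (fun y => f (y + a)) = Int f.
Proof.
move=> fi; have mf := integ_meas fi.
apply: EFin_inj; rewrite !IntE//; last exact: integ_shift.
have := @integral_pushforward _ _ (measurableTypeR R) (measurableTypeR R) _ _ (measurable_shift a) mu setT
  (EFin \o f) ((measurable_EFinP _ _).2 mf) (integ_shift a fi) measurableT.
by move=> H; rewrite -[RHS](integral_shift_mu _ a); exact: esym H.
Qed.

Lemma cvg_natP (u : nat -> R) l : u n @[n --> \oo] --> l <->
  forall e, 0 < e -> exists N, forall n, (N <= n)%N -> `|u n - l| <= e.
Proof.
split=> [/cvgrPdist_le h e e0|h].
  have [N _ hN] := h e e0; exists N => n Nn.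
  by rewrite distrC; exact: hN.
apply/cvgrPdist_le => e e0; have [N hN] := h e e0.
by exists N => // n /= Nn; rewrite distrC; exact: hN.
Qed.

(** [|f|] splits into its minimum with n and a remainder [h n] whose integral tends to 0 by
    dominated convergence; the bounded part contributes at most a multiple of the measure of E. *)
Lemma Int_abs_cont f : integ f -> forall e : R, 0 < e -> exists2 d : R, 0 < d &
  forall E : set R, measurable E -> (mu E <= d%:E)%E ->
  Int (fun x => \1_E x * `|f x|) <= e.
Proof.
move=> fi e e0.
pose h (n : nat) x := `|f x| - Num.min `|f x| n%:R.
have mf := integ_meas fi.
have mm n : measurable_fun setT (fun x => Num.min `|f x| (n%:R : R)).
  by apply: measurable_minr => //; exact: measurableT_comp.
have mh n : measurable_fun setT (h n).
  by apply: measurable_funB => //; exact: measurableT_comp.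
have hb n x : 0 <= h n x <= `|f x|.
  rewrite /h subr_ge0 ge_min lexx /= lerBlDr lerDl le_min normr_ge0/=; exact: ler0n.
have h0 x : h n x @[n --> \oo] --> (0 : R).
  apply: cvg_near_cst; exists (Num.truncn `|f x|).+1 => // n /= nf.
  rewrite /h min_l ?subrr//; apply: ltW; apply: (lt_le_trans (truncnS_gt _)).
  by rewrite ler_nat.
have [_ hI] : integ (fun=> 0 : R) /\ Int (h n) @[n --> \oo] --> Int (fun=> 0 : R).
  apply: (Int_dct mh h0 _ (integ_abs fi)) => n x.
  by case/andP: (hb n x) => ? ?; rewrite ger0_norm.
rewrite Int0 in hI.
have /cvg_natP /(_ (e / 2) (divr_gt0 e0 (ltr0Sn _ 1))) [n /(_ n (leqnn n))] := hI.
rewrite subr0 => hn.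
(* [n.+1] instead of n as bound of the truncated part avoids a division by zero. *)
exists (e / 2 / n.+1%:R); first by rewrite !divr_gt0.
move=> E mE Ed.
have iE : integ (\1_E : R -> R).
  apply: integ_ge0P => [|x|]; [exact: measurable_indic|by rewrite indicE|].
  by rewrite integral_indic// setIT (le_lt_trans Ed)// ltry.
have ih : integ (h n).
  apply: integ_le (integ_abs fi) => [//|x]; case/andP: (hb n x) => ? ?; by rewrite ger0_norm.
apply: (@le_trans _ _ (Int (fun x => h n x + n.+1%:R * \1_E x))).
  apply: Int_le => [||x]; [exact/integ_indic/integ_abs|by apply: integD => //; exact: integZ|].
  have /andP[hx0 hx1] := hb n x; rewrite indicE; case: (x \in E); rewrite ?mul1r ?mulr1 ?mul0r ?mulr0 ?addr0//.
  rewrite /h -lerBlDl opprB addrC subrK ge_min; apply/orP; right.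
  by rewrite ler_nat.
rewrite IntD//; last exact: integZ.
rewrite IntZ// [leRHS]splitr lerD//; first exact: le_trans (ler_norm _) hn.
rewrite -ler_pdivlMl// mulrC; rewrite -lee_fin IntE// integral_indic// setIT//.
Qed.

End real_fubini.

(** * Weak compactness and weak limits of quadratic forms *)

Section extraction.
Variable R : realType.

(** Read as points of a product of segments, the columns of [a] have a cluster point by Tychonoff's
    theorem. The k-th index of the subsequence is chosen so that the coordinates up to k are within
    1/(k+1) of it. *)
Lemma diagonal_extraction (a : nat -> nat -> R) (C : nat -> R) :
  (forall j n, `|a j n| <= C j) ->
  exists2 phi : nat -> nat, {homo phi : i j / (i < j)%N} &
    forall j, exists l : R, forall e : R, 0 < e ->
      exists N, forall k, (N <= k)%N -> `|a j (phi k) - l| <= e.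
Proof.
move=> aC.
pose K : set (prod_topology (fun _ : nat => R)) := [set f | forall j, `[- C j, C j]%classic (f j)].
have cK : compact K.
  apply: (@tychonoff _ (fun=> R) (fun j => `[- C j, C j]%classic)) => j.
  exact: segment_compact.
pose u (n : nat) : prod_topology (fun _ : nat => R) := fun j => a j n.
have Ku : (u @ \oo) K.
  by exists 0%N => // n _ j /=; rewrite in_itv/= -ler_norml; exact: aC.
have [l [Kl cl]] := cK _ _ Ku.
(* Constraining finitely many coordinates defines a neighbourhood in the product topology, so the
   cluster point is approached there at arbitrarily large indices. *)
have freq (N m : nat) (e : R) : 0 < e -> exists n, (N <= n)%N /\
    forall j, (j <= m)%N -> `|a j n - l j| <= e.
  move=> e0.
  pose V : set (prod_topology (fun _ : nat => R)) := [set f | forall j, (j <= m)%N -> `|f j - l j| <= e].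
  have nV : nbhs (l : prod_topology (fun _ : nat => R)) V.
    have FN := @nbhs_filter (prod_topology (fun _ : nat => R)) l.
    have H (m' : nat) : @nbhs _ (prod_topology (fun _ : nat => R)) l
        [set f | forall j, (j < m')%N -> `|f j - l j| <= e].
      elim: m' => [|m' IH].
        rewrite (_ : mkset _ = setT); first exact: (@filterT _ _ FN).
        by apply/seteqP; split => // f _ j; rewrite ltn0.
      have c := @proj_continuous _ (fun _ : nat => R) m' l.
      have h := (cvgrPdist_le _ _).1 c _ e0.
      apply: (@filterS _ _ FN _ _ _ (@filterI _ _ FN _ _ (h FN) IH)) => f [f1 f2] j.
      rewrite ltnS leq_eqVlt => /orP[/eqP ->|]; last exact: f2.
      by rewrite distrC.
    by apply: (@filterS _ _ FN _ _ _ (H m.+1)) => f hf j jm; apply: hf; rewrite ltnS.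
  have [|f [[n Nn <-] Vf]] := cl [set f | exists2 n, (N <= n)%N & u n = f] V _ nV.
    by exists N => // n /= Nn; exists n.
  by exists n; split.
have step (k p : nat) : {n : nat | (p < n)%N /\ forall j, (j <= k)%N -> `|a j n - l j| <= k.+1%:R^-1}.
  apply: cid; have [n [pn hn]] := freq p.+1 k k.+1%:R^-1 (ltac:(by rewrite invr_gt0)).
  by exists n.
pose fix phi k := if k is k'.+1 then sval (step k'.+1 (phi k')) else sval (step 0%N 0%N).
have phiS k : (phi k < phi k.+1)%N by rewrite /=; case: (step _ _) => n [].
have phil k : forall j, (j <= k)%N -> `|a j (phi k) - l j| <= k.+1%:R^-1.
  by case: k => [|k] /=; case: (step _ _) => n [].
exists phi; first by apply: homo_ltn => //; exact: ltn_trans.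
move=> j; exists (l j) => e e0.
exists (maxn j (Num.truncn e^-1)) => k; rewrite geq_max => /andP[jk ek].
apply: (le_trans (phil k j jk)); rewrite invf_ple ?posrE//.
apply/ltW/(lt_le_trans (truncnS_gt _)).
by rewrite ler_nat ltnS.
Qed.

Lemma halving_decays (B e : R) : 0 < e -> exists i : nat, B / 2 ^+ i <= e.
Proof.
move=> e0; exists (Num.truncn (B / e)).+1.
have h : B / e < (2 : R) ^+ (Num.truncn (B / e)).+1.
  apply: (lt_le_trans (truncnS_gt _)).
  by rewrite -natrX ler_nat ltnW// ltn_expl.
rewrite ler_pdivrMr ?exprn_gt0// mulrC -ler_pdivrMr//; exact: ltW.
Qed.

(* On a time step of length 1/(2C), each passage from F k to F k.+1 halves the
   part of the bound that does not come from the data; the claim follows by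
   covering [0, T] with finitely many such steps. *)
Lemma vanishing_propagation (F : nat -> set (R -> R)) (T C B : R) (d : nat -> R) :
  0 <= C -> (forall k, F k.+1 `<=` F k) ->
  (forall k f (t : R), F k f -> 0 <= t <= T -> f t <= B) ->
  (forall e : R, 0 < e -> exists k, forall f, F k f -> f 0 <= e) ->
  (forall e : R, 0 < e -> exists N, forall k, (N <= k)%N -> d k <= e) ->
  (forall k f (s t L : R), F k.+1 f -> 0 <= s -> s <= t -> t <= T ->
    (forall g (r : R), F k g -> s <= r <= t -> g r <= L) ->
    f t <= f s + (t - s) * (C * L + d k)) ->
  forall e : R, 0 < e -> exists k, forall f (t : R), F k f -> 0 <= t <= T -> f t <= e.
Proof.
move=> C0 Fdec FB F0 d0 Fstep.
have Fle k m : (k <= m)%N -> F m `<=` F k.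
  move=> /subnKC <-; elim: (m - k)%N => [|i IH]; first by rewrite addn0.
  by rewrite addnS; exact: subset_trans (Fdec _) IH.
(* C + 1 instead of C keeps the step finite when C = 0. *)
pose h : R := (2 * (C + 1))^-1.
have C1 : 0 < C + 1 by rewrite ltr_wpDl.
have h0 : 0 < h by rewrite invr_gt0 mulr_gt0.
have hC : h * C <= 2^-1.
  by rewrite /h mulrC ler_pdivrMr ?mulr_gt0// mulrA mulVf// mul1r lerDl.
have claim (j : nat) : forall e : R, 0 < e -> exists k, forall f (t : R), F k f ->
    0 <= t <= T -> t <= j%:R * h -> f t <= e.
  elim: j => [e e0|j IH e e0].
    have [k hk] := F0 e e0; exists k => f t Ff /andP[t0 _]; rewrite mul0r => t0'.
    by have -> : t = 0 by [apply/eqP; rewrite eq_le t0 t0']; exact: hk.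
  pose e' := e / 5.
  have e'0 : 0 < e' by rewrite divr_gt0.
  have [k1 hk1] := IH _ e'0.
  have [k2 hk2] := d0 (e' / h) (divr_gt0 e'0 h0).
  pose k0 := maxn k1 k2.
  (* One passage to the next level turns a bound L into L/2 + 2e': e' from the start of the time
     step, L/2 from C * L, and e' from d. The fixed point of this map is 4e'; one more e' absorbs
     the halved a priori bound, whence e = 5e'. *)
  have inner (i : nat) : forall f (t : R), F (k0 + i)%N f -> 0 <= t <= T ->
      t <= j.+1%:R * h -> f t <= Num.max B 0 / 2 ^+ i + 4 * e'.
    elim: i => [|i IHi] f t Ff tT tj.
      rewrite expr0 divr1 (le_trans (FB _ _ _ Ff tT))//.
      by rewrite (@le_trans _ _ (Num.max B 0))// ?le_max ?lexx// lerDl mulr_ge0// ltW.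
    have B0 : 0 <= Num.max B 0 / 2 ^+ i.+1.
      by rewrite divr_ge0 ?exprn_ge0// le_max lexx orbT.
    have [tj'|tj'] := leP t (j%:R * h).
      have := hk1 f t (Fle _ _ (leq_trans (leq_maxl k1 k2) (leq_addr _ _)) _ Ff) tT tj'.
      move: B0; lra.
    have jh0 : 0 <= j%:R * h by rewrite mulr_ge0// ltW.
    case/andP: tT => t0 tT.
    have := Fstep (k0 + i)%N f (j%:R * h) t (Num.max B 0 / 2 ^+ i + 4 * e').
    rewrite -addnS => /(_ Ff jh0 (ltW tj') tT) h1.
    have h2 : f t <= f (j%:R * h) + (t - j%:R * h) *
       (C * (Num.max B 0 / 2 ^+ i + 4 * e') + d (k0 + i)%N).
      apply: h1 => g r Fg /andP[jr rt]; apply: IHi => //.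
        by rewrite (le_trans jh0 jr) (le_trans rt tT).
      exact: le_trans rt tj.
    have h3 := hk1 f (j%:R * h) (Fle _ _ (leq_trans (leq_maxl k1 k2) (leq_addr _ _)) _ Ff).
    have {}h3 : f (j%:R * h) <= e'.
      by apply: h3 => //; rewrite jh0 (le_trans (ltW tj') tT).
    have h4 := hk2 (k0 + i)%N (leq_trans (leq_maxr k1 k2) (leq_addr _ _)).
    have th : t - j%:R * h <= h.
      by rewrite lerBlDl (le_trans tj)// -natr1 mulrDl mul1r.
    set L := Num.max B 0 / 2 ^+ i + 4 * e' in h2 *.
    have LE : Num.max B 0 / 2 ^+ i.+1 + 4 * e' = L / 2 + 2 * e'.
      rewrite /L exprS invfM; lra.
    have L0 : 0 <= L.
      by rewrite /L addr_ge0 ?mulr_ge0 ?divr_ge0 ?exprn_ge0 ?ler0n// ?le_max ?lexx ?orbT// ltW.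
    rewrite LE (le_trans h2)//.
    have A0 : 0 <= C * L + e' / h.
      by apply: addr_ge0; [exact: mulr_ge0|apply: divr_ge0; exact: ltW].
    have : (t - j%:R * h) * (C * L + d (k0 + i)%N) <= h * (C * L + e' / h).
      apply: (@le_trans _ _ ((t - j%:R * h) * (C * L + e' / h))).
        by rewrite ler_wpM2l ?subr_ge0 ?(ltW tj')// lerD2l.
      by rewrite ler_wpM2r.
    have -> : h * (C * L + e' / h) = h * (C * L) + e' by rewrite mulrDr [h * (e' / h)]mulrC divfK ?gt_eqF.
    have : h * (C * L) <= L / 2 by rewrite mulrA mulrC ler_wpM2l.
    lra.
  have [i hi] := halving_decays (Num.max B 0) e'0.
  exists (k0 + i)%N => f t Ff tT tj.
  have := inner i f t Ff tT tj.
  move: hi; rewrite /e'; lra.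
move=> e e0; have [k hk] := claim (Num.truncn (T / h)).+1 e e0.
exists k => f t Ff /[dup] tT /andP[_ tT']; apply: hk => //.
rewrite -ler_pdivrMr// ltW// (le_lt_trans _ (truncnS_gt _))//.
by rewrite ler_pdivrMr// divfK ?gt_eqF.
Qed.

End extraction.

(** * An induction principle for bounded measurable functions *)

Section bounded_functions.
Variable R : realType.

(** The approximation of y from below on the grid of mesh 1/(n+1), capped at m/(n+1). It is written
    as a sum over superlevel sets so that, composed with a measurable function, it is a combination
    of indicators built one term at a time. *)
Let level_sum (n m : nat) (y : R) : R :=
  \sum_(i < m) n.+1%:R^-1 * (i.+1%:R / n.+1%:R <= y :> R)%R%:R.

Let level_sumP n m y : 0 <= y ->
  [/\ m%:R / n.+1%:R <= y -> level_sum n m y = m%:R / n.+1%:R &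
      y <= m%:R / n.+1%:R -> `|y - level_sum n m y| <= n.+1%:R^-1].
Proof.
move=> y0; have n0 : 0 < n.+1%:R^-1 :> R by rewrite invr_gt0.
elim: m => [|m [IH1 IH2]].
  rewrite /level_sum big_ord0 mul0r; split => // y0'.
  have -> : y = 0 by apply/eqP; rewrite eq_le y0 y0'.
  by rewrite subr0 normr0 ltW.
have E : m.+1%:R / n.+1%:R = m%:R / n.+1%:R + n.+1%:R^-1 :> R.
  by rewrite -natr1 mulrDl mul1r.
rewrite /level_sum big_ord_recr/= -/(level_sum n m y).
have [h|h] := leP (m.+1%:R / n.+1%:R) y.
  rewrite mulr1 IH1; last by rewrite (le_trans _ h)// E lerDl ltW.
  rewrite -E; split => // h'.
  have -> : y = m.+1%:R / n.+1%:R by apply/eqP; rewrite eq_le h h'.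
  by rewrite subrr normr0 ltW.
rewrite mulr0 addr0; split=> _ //.
have [h2|h2] := leP y (m%:R / n.+1%:R); first exact: IH2.
rewrite IH1 ?(ltW h2)// ger0_norm ?subr_ge0 ?(ltW h2)//.
by rewrite lerBlDl -E ltW.
Qed.

(** An affine change maps [om] into [0, 1], where the level sums approximate it uniformly; constants
    come from the indicator of the whole line. *)
Lemma bounded_measurable_ind (Q : (R -> R) -> Prop) :
  (forall E : set R, measurable E -> Q \1_E) ->
  (forall (a : R) f g, Q f -> Q g -> Q (fun x => a * f x + g x)) ->
  (forall (f : R -> R) (C : R), measurable_fun setT f -> (forall x, `|f x| <= C) ->
    (forall e : R, 0 < e -> exists2 g, Q g & forall x, `|f x - g x| <= e) -> Q f) ->
  forall (om : R -> R) (C : R), measurable_fun setT om -> (forall x, `|om x| <= C) -> Q om.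
Proof.
move=> Q1 QD Ql om C mom omC.
pose c : R := `|C| + 1.
have c0 : 0 < c by rewrite ltr_wpDl.
have omc x : `|om x| <= c.
  by rewrite (le_trans (omC x))// (le_trans (ler_norm _))// lerDl.
pose h x := (om x + c) / (2 * c).
have mh : measurable_fun setT h by apply: measurable_funM => //; exact: measurable_funD.
have h0 x : 0 <= h x.
  by rewrite divr_ge0 ?mulr_ge0 ?(ltW c0)// -lerBlDr sub0r; have := omc x; rewrite ler_norml => /andP[].
have h1 x : h x <= 1.
  rewrite ler_pdivrMr ?mulr_gt0// mul1r mulr_natl mulr2n lerD2r.
  by have := omc x; rewrite ler_norml => /andP[].
have Q0 : Q (fun=> 0).
  have := Q1 set0 measurable0; congr Q; apply/funext => x.
  by rewrite indic0.
have Qh : Q h.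
  apply: (Ql h 1 mh) => [x|e e0]; first by rewrite ger0_norm.
  pose n := Num.truncn e^-1.
  have ne : n.+1%:R^-1 <= e.
    by rewrite invf_ple ?posrE//; exact/ltW/truncnS_gt.
  exists (fun x => level_sum n n.+1 (h x)) => [|x]; last first.
    have [_ H] := level_sumP n n.+1 (h0 x).
    by rewrite (le_trans (H _))// divff.
  elim: n.+1 => [|m IH].
    by move: Q0; congr Q; apply/funext => x; rewrite /level_sum big_ord0.
  pose E := [set x | m.+1%:R / n.+1%:R <= h x].
  have mE : measurable E.
    have := mh measurableT _ (measurable_itv `[(m.+1%:R / n.+1%:R : R), +oo[).
    rewrite setTI; congr measurable.
    by apply/seteqP; split => x /=; rewrite in_itv/= andbT.
  have := QD n.+1%:R^-1 _ _ (Q1 _ mE) IH; congr Q; apply/funext => x.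
  rewrite /level_sum big_ord_recr/= addrC indicE.
  by rewrite (_ : (x \in E) = (m.+1%:R / n.+1%:R <= h x))//; apply/idP/idP; rewrite inE.
have := QD (2 * c) h _ Qh (QD (- c) \1_setT _ (Q1 setT measurableT) Q0).
congr Q; apply/funext => x; rewrite indicT mulr1 addr0 /h mulrC divfK ?addrK//.
by rewrite mulf_neq0// gt_eqF.
Qed.

End bounded_functions.

(** * Equi-integrability, and the density of a weak limit *)

Section equi_integrability.
Variable R : realType.
Local Notation mu := (@lebesgue_measure R).

(** No measure appears: decreasing sets with empty intersection may shrink locally or escape to
    infinity, so one condition excludes both concentration and loss of mass on the line. It is meant
    for families of nonnegative functions. *)
Definition equi_integrable (P : set (R -> R)) : Prop :=
  forall E : nat -> set R, (forall k, measurable (E k)) ->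
  (forall k, E k.+1 `<=` E k) -> (forall x, exists k, ~ E k x) ->
  forall e : R, 0 < e -> exists N, forall f, P f ->
    Int (fun x => \1_(E N) x * f x) <= e.

Lemma equi_integrable_sub (P Q : set (R -> R)) : P `<=` Q ->
  equi_integrable Q -> equi_integrable P.
Proof.
by move=> PQ QE E mE E1 E0 e e0; have [N hN] := QE E mE E1 E0 e e0; exists N => f /PQ; exact: hN.
Qed.

Lemma indic_mono (E F : set R) x : E `<=` F -> \1_E x <= \1_F x :> R.
Proof.
move=> EF; rewrite !indicE ler_nat; have [|//] := boolP (x \in E).
by rewrite inE => /EF Fx; rewrite mem_set.
Qed.

Lemma indicU_disjoint (A B : set R) x : A `&` B = set0 ->
  \1_(A `|` B) x = \1_A x + \1_B x :> R.
Proof.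
move=> AB; rewrite !indicE in_setU; have [|_] := boolP (x \in A); last by rewrite add0r.
rewrite inE => Ax; have [|_] := boolP (x \in B); last by rewrite addr0.
by rewrite inE => Bx; have : (A `&` B) x by []; rewrite AB.
Qed.

Lemma Int_indic_mono (E F : set R) f : measurable E -> measurable F -> E `<=` F ->
  integ f -> (forall x, 0 <= f x) ->
  Int (fun x => \1_E x * f x) <= Int (fun x => \1_F x * f x).
Proof.
move=> mE mF EF fi f0; apply: Int_le => [||x]; [exact: integ_indic..|].
by rewrite ler_wpM2r// indic_mono.
Qed.

Lemma nonincreasing_sets (E : nat -> set R) k m : (forall k, E k.+1 `<=` E k) ->
  (k <= m)%N -> E m `<=` E k.
Proof.
move=> E1 /subnKC <-; elim: (m - k)%N => [|i IH]; first by rewrite addn0.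
by rewrite addnS; exact: subset_trans (E1 _) IH.
Qed.

(** As in Egorov's theorem, the sets where some later [h_ j] is further than d from h decrease to
    the empty set. On them equi-integrability gives smallness; off them the error is at most d times
    the bound on the integrals. *)
Lemma equi_integrable_cvg (P : set (R -> R)) (h_ : nat -> R -> R) h (B C : R) :
  equi_integrable P ->
  (forall f, P f -> [/\ integ f, forall x, 0 <= f x & Int f <= B]) ->
  (forall j, measurable_fun setT (h_ j)) -> (forall j x, `|h_ j x| <= C) ->
  (forall x, h_ j x @[j --> \oo] --> h x) ->
  forall e : R, 0 < e -> exists N, forall j, (N <= j)%N -> forall f, P f ->
    `|Int (fun x => (h_ j x - h x) * f x)| <= e.
Proof.
move=> EP PB mh hC hh e e0.
have mlim : measurable_fun setT h by apply: (measurable_fun_cvg mh) => x _; exact: hh.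
have limC x : `|h x| <= C.
  have c : `|h_ j x| @[j --> \oo] --> `|h x| by apply: cvg_norm; exact: hh.
  rewrite -(cvg_lim _ c)//; apply: limr_le; first exact: cvgP c.
  exact: nearW.
have B1 : 0 < `|B| + 1 by rewrite ltr_wpDl.
have C1 : 0 < `|C| + 1 by rewrite ltr_wpDl.
pose d := e / 2 / (`|B| + 1).
have d0 : 0 < d by rewrite !divr_gt0.
pose D j := [set x | d < `|h_ j x - h x|].
have mD j : measurable (D j).
  have mm : measurable_fun setT (fun x => `|h_ j x - h x|).
    by apply: measurableT_comp => //; exact: measurable_funB.
  have := mm measurableT _ (measurable_itv `](d : R), +oo[).
  rewrite setTI; congr measurable.
  by apply/seteqP; split => x /=; rewrite in_itv/= andbT.
pose E k := \bigcup_(j in [set j | (k <= j)%N]) D j.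
have mE k : measurable (E k) by apply: bigcup_measurable => j _; exact: mD.
have E1 k : E k.+1 `<=` E k by move=> x [j /= kj Dj]; exists j => //=; exact: ltnW.
have E0 x : exists k, ~ E k x.
  have /cvg_natP/(_ d d0)[N hN] := hh x.
  by exists N => -[j /= Nj]; rewrite /D /= ltNge hN.
have [N hN] := EP E mE E1 E0 (e / 2 / (2 * (`|C| + 1))) (divr_gt0 (divr_gt0 e0 (ltr0Sn _ 1)) (mulr_gt0 (ltr0Sn _ 1) C1)).
exists N => j Nj f Pf; have [fi f0 fB] := PB f Pf.
have mhj : measurable_fun setT (fun x => h_ j x - h x) by exact: measurable_funB.
have hb x : `|h_ j x - h x| <= 2 * (`|C| + 1).
  rewrite (le_trans (ler_normB _ _))// mulr_natl mulr2n lerD//.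
    by rewrite (le_trans (hC _ _))// (le_trans (ler_norm C))// lerDl.
  by rewrite (le_trans (limC _))// (le_trans (ler_norm C))// lerDl.
have hf := integ_mulb mhj hb fi.
apply: (le_trans (Int_abs hf)).
apply: (@le_trans _ _ (Int (fun x => d * f x + 2 * (`|C| + 1) * (\1_(E N) x * f x)))).
  apply: Int_le => [||x]; [exact: integ_abs|by apply: integD; apply: integZ => //; exact: integ_indic|].
  rewrite normrM (ger0_norm (f0 x)) mulrA -mulrDl ler_wpM2r//.
  have [xD|xD] := leP (`|h_ j x - h x|) d.
    by rewrite (le_trans xD)// lerDl mulr_ge0 ?mulr_ge0 ?addr_ge0// indicE.
  have xE : E N x by exists j.
  by rewrite indicE mem_set// mulr1 (le_trans (hb x))// lerDr ltW.
rewrite IntD; [|exact: integZ|by apply: integZ; exact: integ_indic].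
rewrite !IntZ//; last exact: integ_indic.
rewrite [leRHS]splitr lerD//.
  rewrite /d mulrAC ler_pdivrMr// ler_wpM2l ?divr_ge0 ?ltW//.
  by rewrite (le_lt_trans fB)// (le_lt_trans (ler_norm B))// ltrDl.
by rewrite mulrC -ler_pdivlMr ?mulr_gt0//; exact: hN.
Qed.

Section density.
Variable v : nat -> R -> R.
Hypothesis v_integ : forall n, integ (v n).
Hypothesis v_ge0 : forall n x, 0 <= v n x.
Hypothesis v_equi : equi_integrable (range v).
Hypothesis v_cvg : forall E : set R, measurable E ->
  cvgn (fun n => Int (fun x => \1_E x * v n x)).

Let L (E : set R) : R := limn (fun n => Int (fun x => \1_E x * v n x)).

Let LP E : measurable E -> Int (fun x => \1_E x * v n x) @[n --> \oo] --> L E.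
Proof. by move=> mE; exact: v_cvg. Qed.

Let LU (A B : set R) : measurable A -> measurable B -> A `&` B = set0 ->
  L (A `|` B) = L A + L B.
Proof.
move=> mA mB AB; apply/cvg_lim => //.
rewrite (_ : (fun n => _) = (fun n => Int (fun x => \1_A x * v n x) +
   Int (fun x => \1_B x * v n x))); first by apply: cvgD; exact: LP.
apply/funext => n.
rewrite -IntD; [|exact: integ_indic..].
apply: Int_eq => x; rewrite -mulrDl; congr (_ * _).
exact: indicU_disjoint.
Qed.

Let L_ge0 E : measurable E -> 0 <= L E.
Proof.
move=> mE; apply: limr_ge; first exact: v_cvg.
by apply: nearW => n; apply: Int_ge0 => x; rewrite mulr_ge0// indicE.
Qed.

Let L0 : L set0 = 0.
Proof.
apply/cvg_lim => //; apply: cvg_near_cst; apply: nearW => n.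
by rewrite (Int_eq (g := fun=> 0)) ?Int0// => x; rewrite indic0 mul0r.
Qed.

Let L_small (E : nat -> set R) : (forall k, measurable (E k)) ->
  (forall k, E k.+1 `<=` E k) -> (forall x, exists k, ~ E k x) ->
  forall e : R, 0 < e -> exists N, forall k, (N <= k)%N -> L (E k) <= e.
Proof.
move=> mE E1 E0 e e0; have [N hN] := v_equi mE E1 E0 e0.
exists N => k Nk; apply: limr_le; first exact: v_cvg.
apply: nearW => n; apply: le_trans (hN (v n) _); last by exists n.
by apply: Int_indic_mono => //; exact: nonincreasing_sets.
Qed.

(** The maximum with 0 matters on non-measurable sets only: there the limit carries no information,
    but a measure has to be nonnegative on every set. *)
Definition weak_limit_measure (E : set (measurableTypeR R)) : \bar R :=
  (Num.max 0 (L E))%:E.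

Local Notation nu := weak_limit_measure.

Let nuE E : measurable E -> nu E = (L E)%:E.
Proof. by move=> mE; rewrite /weak_limit_measure max_r// L_ge0. Qed.

Let nu0 : nu set0 = 0%E.
Proof. by rewrite nuE// L0. Qed.

Let nu_ge0 E : (0 <= nu E)%E.
Proof. by rewrite /weak_limit_measure lee_fin le_max lexx. Qed.

(** Finite additivity is inherited by the limit. Countable additivity amounts to continuity at the
    empty set along the remainders of the union, which is what equi-integrability provides. *)
Let nu_additive (F : nat -> set R) : (forall i, measurable (F i)) ->
  trivIset setT F -> measurable (\bigcup_n F n) ->
  (fun n => \sum_(0 <= i < n) nu (F i))%E @ \oo --> nu (\bigcup_n F n).
Proof.
move=> mF tF mU.
have mUn n : measurable (\big[setU/set0]_(i < n) F i) by exact: bigsetU_measurable.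
have E n : (\sum_(0 <= i < n) nu (F i))%E = (L (\big[setU/set0]_(i < n) F i))%:E.
  elim: n => [|n IH]; first by rewrite big_geq// big_ord0 L0.
  rewrite big_nat_recr//= IH big_ord_recr/= LU; [by rewrite nuE//; exact: mF|exact: mUn|exact: mF|].
  apply/seteqP; split => // x [+ Fx]; rewrite -bigcup_mkord => -[i /= lin Fi].
  have := tF i n I I (ex_intro _ x (conj Fi Fx)) => ein.
  by rewrite ein ltnn in lin.
under eq_fun do rewrite E.
rewrite nuE//; apply/cvg_EFin; first exact: nearW.
apply/cvg_natP => e e0.
pose D n := \bigcup_k F k `\` \big[setU/set0]_(i < n) F i.
have [N hN] : exists N, forall k, (N <= k)%N -> L (D k) <= e.
  apply: L_small => // [k|k x|x].
  - exact: measurableD.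
  - by rewrite /D big_ord_recr/= => -[Ux nx]; split => // ?; apply: nx; left.
  - have [[k _ Fk]|nU] := pselect ((\bigcup_k F k) x).
      exists k.+1 => -[_]; apply; rewrite big_ord_recr/=; by right.
    by exists 0%N => -[].
exists N => n Nn.
have : L (\bigcup_k F k) = L (\big[setU/set0]_(i < n) F i) + L (D n).
  rewrite -LU//; [|exact: measurableD|exact: setDIK].
  by rewrite setDUK//; exact: bigsetU_bigcup.
have := hN n Nn; have : 0 <= L (D n) by apply: L_ge0; exact: measurableD.
move=> h1 h2 ->; rewrite opprD addrA subrr add0r normrN ger0_norm//.
Qed.

Let nu_sigma : semi_sigma_additive nu.
Proof. by move=> F mF tF mU; exact: nu_additive. Qed.

Let nu_ac (E : set R) : measurable E -> mu E = 0%E -> nu E = 0%E.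
Proof.
move=> mE E0; rewrite nuE//; congr EFin; apply/cvg_lim => //.
apply: cvg_near_cst; apply: nearW => n.
have i1 := integ_indic mE (v_integ n).
rewrite -(Int0 R); apply: (ae_eq_Int (integ_meas i1)) => //.
exists E; split => // x /= h; apply: contrapT => nE; apply: h.
by rewrite indicE memNset// mul0r.
Qed.

HB.instance Definition _ :=
  isMeasure.Build _ (measurableTypeR R) R nu nu0 nu_ge0 nu_sigma.

Let nu_fin : fin_num_fun nu.
Proof. by move=> E mE; rewrite nuE. Qed.

HB.instance Definition _ :=
  Measure_isFinite.Build _ (measurableTypeR R) R nu nu_fin.

(** Radon-Nikodym for the limit set function: it is a finite measure, and it vanishes on null sets
    because the integral of each [v n] does. *)
Lemma density_exists : exists f, [/\ integ f, forall x, 0 <= f x &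
  forall E : set R, measurable E ->
    Int (fun x => \1_E x * v n x) @[n --> \oo] --> Int (fun x => \1_E x * f x)].
Proof.
have [|f [f0 ffin fi fE]] := @radon_nikodym_sigma_finite _ (measurableTypeR R) R mu nu.
  by apply/null_content_dominatesP => E mE; exact: nu_ac.
have fin : integ (fun x => fine (f x)).
  by apply: eq_integrable fi => // x _; rewrite /= fineK.
exists (fun x => fine (f x)); split => // [x|E mE]; first exact: fine_ge0.
suff -> : Int (fun x => \1_E x * fine (f x)) = L E by exact: LP.
apply: EFin_inj; rewrite IntE; last exact: integ_indic.
have -> : (L E)%:E = nu E by rewrite nuE.
rewrite (fE E mE) [RHS]integral_mkcond; apply: eq_integral => x _.
rewrite patchE indicE; case: (x \in E); last by rewrite mul0r.
by rewrite mul1r fineK.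
Qed.

End density.

End equi_integrability.

(** * From indicators to bounded test functions *)

Section bounded_tests.
Variable R : realType.

(** The bound on the integrals of [v] makes the class of admissible test functions stable under
    uniform limits; containing the indicators, it then contains all bounded measurable functions. *)
Lemma cvg_Int_bounded (v : nat -> R -> R) (f : R -> R) (B : R) :
  (forall n, integ (v n)) -> (forall n x, 0 <= v n x) -> (forall n, Int (v n) <= B) ->
  integ f -> (forall x, 0 <= f x) ->
  (forall E : set R, measurable E ->
    Int (fun x => \1_E x * v n x) @[n --> \oo] --> Int (fun x => \1_E x * f x)) ->
  forall (om : R -> R) C, measurable_fun setT om -> (forall x, `|om x| <= C) ->
    Int (fun x => om x * v n x) @[n --> \oo] --> Int (fun x => om x * f x).
Proof.
move=> vi v0 vB fi f0 vE om C mom omC.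
pose Q (om : R -> R) := [/\ measurable_fun setT om, exists C, forall x, `|om x| <= C &
  Int (fun x => om x * v n x) @[n --> \oo] --> Int (fun x => om x * f x)].
suff [] : Q om by [].
apply: (@bounded_measurable_ind _ Q _ _ _ om C mom omC).
- move=> E mE; split; [exact: measurable_indic|exists 1 => x; exact: indic_le1|exact: vE].
- move=> a g h [mg [Cg gC] gcv] [mh [Ch hC] hcv]; split.
  + by apply: measurable_funD => //; exact: measurable_funM.
  + exists (`|a| * Cg + Ch) => x; rewrite (le_trans (ler_normD _ _))// lerD//.
    by rewrite normrM ler_wpM2l.
  + have E u : integ u -> Int (fun x => (a * g x + h x) * u x) =
        a * Int (fun x => g x * u x) + Int (fun x => h x * u x).
      move=> ui; rewrite -IntZ; last exact: integ_mulb gC ui.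
      rewrite -IntD; [|exact/integZ/(integ_mulb _ gC)|exact: integ_mulb hC ui].
      by apply: Int_eq => x; rewrite mulrDl mulrA.
    rewrite E//; under eq_fun do rewrite E//.
    by apply: cvgD => //; apply: cvgMr.
- move=> g Cg mg gC gap; split => //; first by exists Cg.
  apply/cvg_natP => e e0.
  pose D := `|B| + Int f + 1.
  have If0 : 0 <= Int f by exact: Int_ge0.
  have D0 : 0 < D by rewrite ltr_wpDl// addr_ge0.
  have [h [mh [Ch hC] hcv] gh] := gap (e / 3 / D) (divr_gt0 (divr_gt0 e0 (ltr0Sn _ 2)) D0).
  have /cvg_natP/(_ (e / 3) (divr_gt0 e0 (ltr0Sn _ 2)))[N hN] := hcv.
  exists N => n Nn.
  have mgh : measurable_fun setT (fun x => g x - h x) by exact: measurable_funB.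
  have E u : integ u -> Int (fun x => g x * u x) =
      Int (fun x => h x * u x) + Int (fun x => (g x - h x) * u x).
    move=> ui; rewrite -IntD; [|exact: integ_mulb hC ui|exact: integ_mulb gh ui].
    by apply: Int_eq => x; rewrite -mulrDl addrC subrK.
  have bd u : integ u -> (forall x, 0 <= u x) -> Int u <= `|B| + Int f ->
      `|Int (fun x => (g x - h x) * u x)| <= e / 3.
    move=> ui u0 uB; rewrite (le_trans (Int_mulb mgh gh ui))//.
    rewrite (Int_eq (g := u)); last by move=> x; rewrite ger0_norm.
    rewrite mulrAC ler_pdivrMr// ler_wpM2l// ?divr_ge0 ?ltW//.
    by rewrite (le_lt_trans uB)// ltrDl.
  rewrite !E// opprD addrACA (le_trans (ler_normD _ _))//.
  rewrite (_ : e = e / 3 + (e / 3 + e / 3)); last by field.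
  rewrite lerD//; first exact: hN.
  rewrite (le_trans (ler_normB _ _))// lerD//; apply: bd => //.
    by rewrite (le_trans (vB n))// (le_trans (ler_norm _))// lerDl.
  by rewrite lerDr.
Qed.

End bounded_tests.

(** * Weak sequential compactness, uniformly in time *)

Section weak_compactness.
Variable R : realType.

Lemma cvg_of_cauchy (a : nat -> R) :
  (forall e : R, 0 < e -> exists N, forall n m, (N <= n)%N -> (N <= m)%N -> `|a n - a m| <= e) ->
  cvgn a.
Proof.
move=> h; apply/cauchy_cvgP/cauchy_exP => e e0.
have [N hN] := h (e / 2) (divr_gt0 e0 (ltr0Sn _ 1)).
exists (a N); exists N => // n /= Nn.
rewrite -ball_normE /= (le_lt_trans (hN _ _ (leqnn N) Nn))// ltr_pdivrMr//.
by rewrite mulr_natr mulr2n ltrDl.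
Qed.

Lemma cauchy_of_cvg (a : nat -> R) : cvgn a -> forall e : R, 0 < e ->
  exists N, forall n m, (N <= n)%N -> (N <= m)%N -> `|a n - a m| <= e.
Proof.
move=> /cvg_ex[l /cvg_natP al] e e0.
have [N hN] := al (e / 2) (divr_gt0 e0 (ltr0Sn _ 1)).
exists N => n m Nn Nm; rewrite (_ : a n - a m = (a n - l) - (a m - l)); last by ring.
by rewrite (le_trans (ler_normB _ _))// [leRHS]splitr lerD//; exact: hN.
Qed.

Lemma cauchy_approx (a : nat -> R) :
  (forall e : R, 0 < e -> exists2 b : nat -> R, cvgn b & exists N, forall n, (N <= n)%N -> `|a n - b n| <= e) ->
  cvgn a.
Proof.
move=> h; apply: cvg_of_cauchy => e e0.
have [b bcv [N1 ab]] := h (e / 3) (divr_gt0 e0 (ltr0Sn _ 2)).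
have [N2 hN] := cauchy_of_cvg bcv (divr_gt0 e0 (ltr0Sn _ 2)).
exists (maxn N1 N2) => n m; rewrite !geq_max => /andP[n1 n2] /andP[m1 m2].
rewrite (_ : a n - a m = (a n - b n) + (b n - b m) - (a m - b m)); last by ring.
rewrite (le_trans (ler_normB _ _))//.
rewrite (_ : e = e / 3 + e / 3 + e / 3); last by field.
rewrite lerD//; last exact: ab.
by rewrite (le_trans (ler_normD _ _))// lerD//; [exact: ab|exact: hN].
Qed.

(* Convergence on the rays (q, +oo) with q rational spreads to all Borel sets:
   the sets on which the integrals converge form a Dynkin class, and
   equi-integrability gives closure under countable disjoint unions. *)
Lemma cvg_Int_borel (v : nat -> R -> R) : (forall n, integ (v n)) ->
  (forall n x, 0 <= v n x) -> equi_integrable (range v) ->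
  (forall q : rat, cvgn (fun n => Int (fun x => \1_(`]ratr q, +oo[) x * v n x))) ->
  forall E : set R, measurable E -> cvgn (fun n => Int (fun x => \1_E x * v n x)).
Proof.
move=> vi v0 vE vq.
(* Increasing unions: the sets [E] minus [D k] decrease to the empty set, so replacing [E] by some
   [D N] costs little, uniformly in n. *)
have up (E : set R) (D : nat -> set R) : measurable E -> (forall k, measurable (D k)) ->
    (forall k, D k `<=` E) -> (forall k, D k `<=` D k.+1) ->
    (forall x, E x -> exists k, D k x) ->
    (forall k, cvgn (fun n => Int (fun x => \1_(D k) x * v n x))) ->
    cvgn (fun n => Int (fun x => \1_E x * v n x)).
  move=> mE mD DE D1 ED Dcv; apply: cauchy_approx => e e0.
  have [||x|N hN] := vE (fun k => E `\` D k) _ _ _ e e0.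
  - by move=> k; exact: measurableD.
  - by move=> k x [Ex nD]; split => // /D1.
  - have [Ex|nE] := pselect (E x); last by exists 0%N => -[].
    by have [k Dk] := ED x Ex; exists k => -[].
  exists (fun n => Int (fun x => \1_(D N) x * v n x)) => //; exists 0%N => n _.
  have mED : measurable (E `\` D N) by exact: measurableD.
  rewrite -IntB; [|exact: integ_indic..].
  rewrite (Int_eq (g := fun x => \1_(E `\` D N) x * v n x)); last first.
    move=> x; rewrite -mulrBl; congr (_ * _).
    have := indicU_disjoint x (@setDIK _ (D N) E).
    by rewrite setDUK// => ->; rewrite addrAC subrr add0r.
  rewrite ger0_norm; last by apply: Int_ge0 => x; rewrite mulr_ge0// indicE.
  by apply: hN; exists n.
have ray (a : R) : cvgn (fun n => Int (fun x => \1_(`]a, +oo[) x * v n x)).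
  have q k : {q : rat | a < ratr q < a + k.+1%:R^-1}.
    have /rat_in_itvoo/cid[q /[!in_itv]/= hq] : a < a + k.+1%:R^-1 by rewrite ltrDl invr_gt0.
    by exists q.
  (* The rationals [q k] approach a from above but not monotonically. The union of the first rays is
     increasing in k and is again one of the rays. *)
  pose D k : set R := \bigcup_(i in [set i | (i <= k)%N]) `]ratr (sval (q i)), +oo[%classic.
  have DE k : exists i, D k = `]ratr (sval (q i)), +oo[%classic.
    elim: k => [|k [i IH]].
      exists 0%N; apply/seteqP; split => [x [i /= i0]|x h]; last by exists 0%N.
      by have -> : i = 0%N by apply/eqP; rewrite -leqn0.
    have DS : D k.+1 = D k `|` `]ratr (sval (q k.+1)), +oo[%classic.
      apply/seteqP; split => x.
        by move=> [j /=]; rewrite leq_eqVlt => /orP[/eqP ->|]; [right|left; exists j].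
      by move=> [[j /= jk jx]|h]; [exists j => //=; exact: leqW|exists k.+1 => /=].
    have [h|h] := leP (ratr (sval (q i)) : R) (ratr (sval (q k.+1))).
      exists i; rewrite DS IH; apply/seteqP; split => x; last by left.
      by move=> [//|]/=; rewrite !in_itv/= !andbT; exact: le_lt_trans.
    exists k.+1; rewrite DS IH; apply/seteqP; split => x; last by right.
    by move=> [|//]/=; rewrite !in_itv/= !andbT; exact: lt_trans.
  apply: (up _ D) => // [k|k x|k x|x|k].
  - by have [i ->] := DE k; exact: measurable_itv.
  - move=> [i _] /=; rewrite !in_itv/= !andbT; apply: lt_trans.
    by case/andP: (svalP (q i)).
  - by move=> [i /= ik ix]; exists i => //=; exact: leqW.
  - rewrite /= in_itv/= andbT => ax.
    pose k := Num.truncn (x - a)^-1.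
    exists k, k => //=; rewrite in_itv/= andbT.
    have /andP[_ h] := svalP (q k); rewrite (lt_le_trans h)// -lerBrDl.
    by rewrite invf_ple ?posrE ?subr_gt0//; exact/ltW/truncnS_gt.
  - by have [i ->] := DE k.
have vT : cvgn (fun n => Int (fun x => \1_[set: R] x * v n x)).
  apply: (up _ (fun k => `](- k%:R), +oo[%classic)) => // [k x|x _].
  - rewrite /= !in_itv/= !andbT; apply: le_lt_trans.
    by rewrite lerN2 ler_nat.
  - exists (Num.truncn `|x|).+1; rewrite /= in_itv/= andbT ltrNl.
    by rewrite (le_lt_trans (ler_norm _))// normrN; exact: truncnS_gt.
have compl (E : set R) : measurable E -> cvgn (fun n => Int (fun x => \1_E x * v n x)) ->
    cvgn (fun n => Int (fun x => \1_(~` E) x * v n x)).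
  move=> mE Ecv.
  have -> : (fun n => Int (fun x => \1_(~` E) x * v n x)) =
    (fun n => Int (fun x => \1_[set: R] x * v n x) - Int (fun x => \1_E x * v n x)).
    apply/funext => n; rewrite -IntB; [|exact: integ_indic..].
    by apply: Int_eq => x; rewrite -mulrBl indicT !indicE in_setC; case: (x \in E); rewrite /= ?subrr ?subr0.
  move/cvg_ex: vT => [l1 h1]; move/cvg_ex: Ecv => [l2 h2].
  by apply/cvg_ex; exists (l1 - l2); apply: cvgB.
have disj (F : nat -> set R) : (forall n, measurable (F n)) -> trivIset setT F ->
    (forall n, cvgn (fun m => Int (fun x => \1_(F n) x * v m x))) ->
    cvgn (fun m => Int (fun x => \1_(\bigcup_k F k) x * v m x)).
  move=> mF tF Fcv.
  apply: (up _ (fun n => \big[setU/set0]_(i < n) F i)) => [|n|n|n|x [k _ Fk]|n].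
  - exact: bigcupT_measurable.
  - exact: bigsetU_measurable.
  - exact: bigsetU_bigcup.
  - by rewrite big_ord_recr/=; exact: subsetUl.
  - by exists k.+1; rewrite big_ord_recr/=; right.
  - elim: n => [|n IH].
      rewrite big_ord0 (_ : (fun n => _) = cst 0); first exact: is_cvg_cst.
      by apply/funext => n; rewrite (Int_eq (g := fun=> 0)) ?Int0// => x; rewrite indic0 mul0r.
    rewrite big_ord_recr/=.
    have -> : (fun m => Int (fun x => \1_((\big[setU/set0]_(i < n) F i) `|` F n) x * v m x)) =
      (fun m => Int (fun x => \1_(\big[setU/set0]_(i < n) F i) x * v m x) +
        Int (fun x => \1_(F n) x * v m x)).
      apply/funext => m; rewrite -IntD; [|by apply: integ_indic => //; exact: bigsetU_measurable|exact: integ_indic].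
      apply: Int_eq => x; rewrite -mulrDl indicU_disjoint//.
      apply/seteqP; split => // y [+ Fy]; rewrite -bigcup_mkord => -[i /= lin Fi].
      have := tF i n I I (ex_intro _ y (conj Fi Fy)) => ein.
      by rewrite ein ltnn in lin.
    move/cvg_ex: IH => [l1 h1]; move/cvg_ex: (Fcv n) => [l2 h2].
    by apply/cvg_ex; exists (l1 + l2); apply: cvgD.
move=> E mE.
have {mE} : <<s @RGenOInfty.G R >> E.
  by have := mE; rewrite -[measurable E]/((@ocitv R).-sigma.-measurable E) RGenOInfty.measurableE.
pose P (E : set (measurableTypeR R)) := cvgn (fun n => Int (fun x => \1_E x * v n x)).
rewrite -[cvgn _]/(P E); move: E.
apply: (@dynkin_induction _ (measurableTypeR R) (@RGenOInfty.G R) P).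
- exact: RGenOInfty.measurableE.
- move=> A B [a ->] [b ->]; exists (Num.max a b).
  by apply/seteqP; split => x /=; rewrite !in_itv/= !andbT gt_max => /andP.
- exact: vT.
- by move=> A [a ->]; exact: ray.
- by move=> A mA; exact: compl.
- by move=> F mF tF Fcv; exact: disj.
Qed.

(** Extraction concerns countably many scalars only, the integrals over rational rays at rational
    times. Equicontinuity extends the convergence to every time, rays determine the Borel sets, and
    [density_exists] supplies the limit function at each time. *)
Lemma weak_arzela_ascoli (u : nat -> R -> R -> R) (B : R -> R) :
  (forall n t, 0 <= t -> integ (u n t)) -> (forall n t x, 0 <= u n t x) ->
  (forall T n t, 0 <= t <= T -> Int (u n t) <= B T) ->
  (forall T, equi_integrable [set f | exists n t, 0 <= t <= T /\ f = u n t]) ->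
  (forall (om : R -> R) (C T : R), measurable_fun setT om -> (forall x, `|om x| <= C) ->
    forall e : R, 0 < e -> exists2 d : R, 0 < d & forall n s t, 0 <= s <= T ->
      0 <= t <= T -> `|t - s| <= d ->
      `|Int (fun x => om x * u n t x) - Int (fun x => om x * u n s x)| <= e) ->
  exists phi : nat -> nat, exists U : R -> R -> R,
    [/\ {homo phi : i j / (i < j)%N}, forall t, 0 <= t -> integ (U t),
        forall t x, 0 <= U t x &
        forall (om : R -> R) (C T e : R), measurable_fun setT om -> (forall x, `|om x| <= C) ->
          0 < e -> exists N, forall k, (N <= k)%N -> forall t, 0 <= t <= T ->
          `|Int (fun x => om x * u (phi k) t x) - Int (fun x => om x * U t x)| <= e].
Proof.
move=> ui u0 uB uE uC.
(* Rational times are clipped at 0, since the hypotheses concern nonnegative times. *)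
pose pos (r : rat) : R := Num.max 0 (ratr r).
have pos0 r : 0 <= pos r by rewrite le_max lexx.
pose ray (q : rat) : R -> R := \1_(`]ratr q, +oo[).
have mray q : measurable_fun setT (ray q) by exact: measurable_indic.
have ray1 q x : `|ray q x| <= 1 by exact: indic_le1.
pose a (j n : nat) : R := if (unpickle j : option (rat * rat)) is Some qr then
  Int (fun x => ray qr.1 x * u n (pos qr.2) x) else 0.
pose Ca (j : nat) : R := if (unpickle j : option (rat * rat)) is Some qr then
  B (pos qr.2) else 0.
have [phi phi_inc phiP] : exists2 phi : nat -> nat, {homo phi : i j / (i < j)%N} &
    forall j, exists l : R, forall e : R, 0 < e ->
      exists N, forall k, (N <= k)%N -> `|a j (phi k) - l| <= e.
  apply: (@diagonal_extraction R a Ca) => j n; rewrite /a /Ca.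
  case: (unpickle j) => [[q r]|]; last by rewrite normr0.
  rewrite (le_trans (Int_mulb (mray q) (ray1 q) (ui n _ (pos0 r))))// mul1r.
  rewrite (Int_eq (g := u n (pos r))); last by move=> x; rewrite ger0_norm.
  by apply: uB; rewrite pos0 lexx.
have cv_rat q r : cvgn (fun k => Int (fun x => ray q x * u (phi k) (pos r) x)).
  have [l hl] := phiP (pickle (q, r)); apply/cvg_ex; exists l; apply/cvg_natP => e e0.
  by have [N hN] := hl e e0; exists N => k /hN; rewrite /a pickleK.
have cv_real q t : 0 <= t -> cvgn (fun k => Int (fun x => ray q x * u (phi k) t x)).
  move=> t0; apply: cauchy_approx => e e0.
  have [d d0 hd] := uC (ray q) 1 (t + 1) (mray q) (ray1 q) e e0.
  have /rat_in_itvoo[r] : t < t + Num.min d 1 by rewrite ltrDl lt_min d0 ltr01.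
  rewrite in_itv/= => /andP[tr rt].
  have posr : pos r = ratr r by rewrite /pos max_r// (le_trans t0)// ltW.
  exists (fun k => Int (fun x => ray q x * u (phi k) (pos r) x)); first exact: cv_rat.
  exists 0%N => k _; apply: hd; rewrite ?pos0 ?t0 ?lerDl//= posr.
    by rewrite (le_trans (ltW rt))// lerD2l ge_min lexx orbT.
  rewrite distrC ger0_norm ?subr_ge0 ?(ltW tr)// lerBlDl (le_trans (ltW rt))//.
  by rewrite lerD2l ge_min lexx.
have equi_t t : 0 <= t -> equi_integrable (range (fun k => u (phi k) t)).
  move=> t0; apply: equi_integrable_sub (uE t) => f [k _ <-].
  by exists (phi k), t; rewrite t0 lexx.
have HU t : exists f : R -> R, 0 <= t -> [/\ integ f, forall x, 0 <= f x &
    forall E : set R, measurable E ->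
      Int (fun x => \1_E x * u (phi k) t x) @[k --> \oo] --> Int (fun x => \1_E x * f x)].
  have [t0|t0] := leP 0 t; last by exists (fun=> 0).
  have [f Hf] := density_exists (fun k => ui (phi k) t t0) (fun k => u0 (phi k) t) (equi_t t t0)
    (cvg_Int_borel (fun k => ui (phi k) t t0) (fun k => u0 (phi k) t) (equi_t t t0)
      (fun q => cv_real q t t0)).
  by exists f.
have {HU}[U0 HU0] := choice HU.
pose U t := if 0 <= t then U0 t else fun=> 0.
have Upos t : 0 <= t -> U t = U0 t by rewrite /U => ->.
have Ui t : 0 <= t -> integ (U t) by move=> t0; rewrite Upos//; have [] := HU0 t t0.
have U_ge0 t x : 0 <= U t x.
  rewrite /U; case: ifPn => // t0; by have [] := HU0 t t0.
have Ucv (om : R -> R) (C t : R) : measurable_fun setT om -> (forall x, `|om x| <= C) -> 0 <= t ->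
    Int (fun x => om x * u (phi k) t x) @[k --> \oo] --> Int (fun x => om x * U t x).
  move=> mom omC t0; have [_ _ h] := HU0 t t0; rewrite -Upos// in h.
  apply: (@cvg_Int_bounded _ _ _ (B t) _ _ _ (Ui t t0) (U_ge0 t) h om C mom omC) => n.
  - exact: ui.
  - by move=> x; exact: u0.
  - by apply: uB; rewrite t0 lexx.
exists phi, U; split => // om C T e mom omC e0.
have e3 : 0 < e / 3 by rewrite divr_gt0.
have [d d0 hd] := uC om C T mom omC (e / 3) e3.
have Uhd s t : 0 <= s <= T -> 0 <= t <= T -> `|t - s| <= d ->
    `|Int (fun x => om x * U t x) - Int (fun x => om x * U s x)| <= e / 3.
  move=> sT tT std.
  have c : `|Int (fun x => om x * u (phi k) t x) - Int (fun x => om x * u (phi k) s x)| @[k --> \oo] -->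
     `|Int (fun x => om x * U t x) - Int (fun x => om x * U s x)|.
    apply: cvg_norm; apply: cvgB; apply: (@Ucv _ C) => //; first by case/andP: tT.
    by case/andP: sT.
  rewrite -(cvg_lim _ c)//; apply: limr_le; first exact: cvgP c.
  by apply: nearW => k; exact: hd.
(* Uniformity in t: convergence up to e/3 at finitely many grid times suffices, since between t and
   the grid point below it the sequence and its limit each move by at most e/3. *)
have grid (M : nat) : exists N, forall k, (N <= k)%N -> forall i, (i < M)%N ->
    `|Int (fun x => om x * u (phi k) (i%:R * d) x) - Int (fun x => om x * U (i%:R * d) x)| <= e / 3.
  elim: M => [|M [N hN]]; first by exists 0%N.
  have Md0 : 0 <= M%:R * d by rewrite mulr_ge0// ltW.
  have /cvg_natP/(_ _ e3)[N' hN'] := Ucv om C (M%:R * d) mom omC Md0.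
  exists (maxn N N') => k; rewrite geq_max => /andP[Nk N'k] i.
  by rewrite ltnS leq_eqVlt => /orP[/eqP ->|]; [exact: hN'|exact: hN].
have [N hN] := grid (Num.truncn (T / d)).+1.
exists N => k Nk t /andP[t0 tT].
pose i := Num.truncn (t / d).
have td0 : 0 <= t / d by rewrite divr_ge0// ltW.
have it : i%:R * d <= t by rewrite -ler_pdivlMr// truncn_le.
have ti : t - i%:R * d <= d.
  have := truncnS_gt (t / d); rewrite ltr_pdivrMr// -natr1 mulrDl mul1r => h.
  by rewrite lerBlDl ltW.
have iM : (i < (Num.truncn (T / d)).+1)%N.
  by rewrite ltnS le_truncn// ler_pM2r ?invr_gt0.
have iT : 0 <= i%:R * d <= T by rewrite mulr_ge0 ?(ltW d0)//= (le_trans it).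
have tT' : 0 <= t <= T by rewrite t0.
have tid : `|t - i%:R * d| <= d by rewrite ger0_norm// subr_ge0.
have h1 := hd (phi k) _ _ iT tT' tid.
have h2 := hN k Nk i iM.
have h3 := Uhd _ _ iT tT' tid.
set x1 := Int _ in h1 *; set x2 := Int _ in h1 h2 *; set x3 := Int _ in h2 h3 *; set x4 := Int _ in h3 *.
rewrite (_ : x1 - x4 = (x1 - x2) + (x2 - x3) - (x4 - x3)); last by ring.
rewrite (le_trans (ler_normB _ _))// (_ : e = e / 3 + e / 3 + e / 3); last by field.
by rewrite lerD// (le_trans (ler_normD _ _))// lerD.
Qed.

End weak_compactness.

(** * Weak continuity of quadratic forms *)

Section quadratic_forms.
Variable R : realType.
Implicit Types (K : R -> R -> R) (f g p q : R -> R).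

(** Keeping [f y] outside the inner integral presents the form as a linear functional of f whose
    test function is the row integral, so that results on linear functionals can be applied
    twice. *)
Definition qform K f : R := Int (fun y => Int (fun z => K y z * f z) * f y).

Lemma meas2_mul K K' : meas2 K -> meas2 K' -> meas2 (fun y z => K y z * K' y z).
Proof. exact: measurable_funM. Qed.

Lemma meas2_add K K' : meas2 K -> meas2 K' -> meas2 (fun y z => K y z + K' y z).
Proof. exact: measurable_funD. Qed.

Lemma meas2_opp K : meas2 K -> meas2 (fun y z => - K y z).
Proof. by move=> mK; apply: measurableT_comp. Qed.

Lemma meas2_fst f : measurable_fun setT f -> meas2 (fun y _ => f y).
Proof. by move=> mf; have := measurableT_comp mf (@measurable_fst _ _ R R). Qed.

Lemma meas2_snd f : measurable_fun setT f -> meas2 (fun _ z => f z).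
Proof. by move=> mf; have := measurableT_comp mf (@measurable_snd _ _ R R). Qed.

Lemma meas2_sum f : measurable_fun setT f -> meas2 (fun y z => f (y + z)).
Proof.
move=> mf; have ms : measurable_fun [set: R * R] (fun p : R * R => p.1 + p.2).
  by apply: measurable_funD; [exact: measurable_fst|exact: measurable_snd].
by have := measurableT_comp mf ms.
Qed.

Lemma meas2_row K f : meas2 K -> measurable_fun setT f ->
  measurable_fun setT (fun y => Int (fun z => K y z * f z)).
Proof. by move=> mK mf; apply: meas_Int; apply: meas2_mul => //; exact: meas2_snd. Qed.

Section bounded_kernel.
Variables (K : R -> R -> R) (C : R) (f : R -> R).
Hypothesis (mK : meas2 K) (KC : forall y z, `|K y z| <= C) (fi : integ f).

Lemma integ_row y : integ (fun z => K y z * f z).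
Proof. by apply: (integ_mulb (C := C)) => //; exact: meas2_l. Qed.

Lemma row_bound y : `|Int (fun z => K y z * f z)| <= C * Int (fun z => `|f z|).
Proof. by apply: Int_mulb => //; exact: meas2_l. Qed.

Lemma integ_qform : integ (fun y => Int (fun z => K y z * f z) * f y).
Proof.
by apply: (integ_mulb (C := C * Int (fun z => `|f z|))) => //;
  [apply: meas2_row => //; exact: integ_meas|exact: row_bound].
Qed.

Lemma qform_bound : `|qform K f| <= C * Int (fun z => `|f z|) * Int (fun z => `|f z|).
Proof.
apply: Int_mulb => //; last exact: row_bound.
by apply: meas2_row => //; exact: integ_meas.
Qed.

End bounded_kernel.

Lemma qform_ae K f g : meas2 K -> measurable_fun setT f -> measurable_fun setT g ->
  {ae @lebesgue_measure R, forall x, f x = g x} -> qform K f = qform K g.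
Proof.
move=> mK mf mg fg; rewrite /qform.
have E y : Int (fun z => K y z * f z) = Int (fun z => K y z * g z).
  apply: ae_eq_Int; [by apply: measurable_funM => //; exact: meas2_l..|].
  by apply: ae_imp fg => z ->.
rewrite (Int_eq (g := fun y => Int (fun z => K y z * g z) * f y)); last by move=> y; rewrite E.
apply: ae_eq_Int.
- by apply: measurable_funM => //; exact: meas2_row.
- by apply: measurable_funM => //; exact: meas2_row.
- by apply: ae_imp fg => z ->.
Qed.

Lemma qformD K K' C C' f : meas2 K -> meas2 K' -> (forall y z, `|K y z| <= C) ->
  (forall y z, `|K' y z| <= C') -> integ f ->
  qform (fun y z => K y z + K' y z) f = qform K f + qform K' f.
Proof.
move=> mK mK' KC KC' fi; rewrite /qform -IntD; [|exact: integ_qform KC fi|exact: integ_qform KC' fi].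
apply: Int_eq => y; rewrite -mulrDl -IntD; [|exact: integ_row KC fi y|exact: integ_row KC' fi y].
by congr (_ * _); apply: Int_eq => z; rewrite mulrDl.
Qed.

Lemma qformN K C f : meas2 K -> (forall y z, `|K y z| <= C) -> integ f ->
  qform (fun y z => - K y z) f = - qform K f.
Proof.
move=> mK KC fi; rewrite /qform -IntN; last exact: integ_qform KC fi.
apply: Int_eq => y; rewrite -mulNr -IntN; last exact: integ_row KC fi y.
by congr (_ * _); apply: Int_eq => z; rewrite mulNr.
Qed.

Lemma qform_le K C f (h : R -> R) : meas2 K -> (forall y z, `|K y z| <= C) ->
  integ f -> (forall y, 0 <= f y) -> integ (fun y => h y * f y) ->
  (forall y, f y != 0 -> Int (fun z => K y z * f z) <= h y) ->
  qform K f <= Int (fun y => h y * f y).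
Proof.
move=> mK KC fi f0 hi Kh; apply: Int_le => // [|y]; first exact: integ_qform KC fi.
have [->|fy] := eqVneq (f y) 0; first by rewrite !mulr0.
by rewrite ler_wpM2r// Kh.
Qed.

(** The two products of the symmetrised majorant have the same integral, whence the factor 2.
    Domination is asked only where f does not vanish, which brings in the support of the truncated
    solutions. *)
Lemma qform_le_prod K C f p q : meas2 K -> (forall y z, `|K y z| <= C) ->
  integ f -> (forall y, 0 <= f y) ->
  integ (fun y => p y * f y) -> integ (fun y => q y * f y) ->
  (forall y z, f y != 0 -> f z != 0 -> K y z <= p y * q z + q y * p z) ->
  qform K f <= 2 * (Int (fun y => p y * f y) * Int (fun y => q y * f y)).
Proof.
move=> mK KC fi f0 ip iq Kpq.
set P := Int (fun y => p y * f y); set Q := Int (fun y => q y * f y).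
have iE : integ (fun y => (p y * Q + q y * P) * f y).
  apply: integ_eq (integD (integZ Q ip) (integZ P iq)) => y; ring.
apply: (@le_trans _ _ (Int (fun y => (p y * Q + q y * P) * f y))).
  apply: (qform_le mK KC fi f0 iE) => y fy.
  rewrite /P /Q -!IntZ// -IntD; [|exact: integZ..].
  apply: Int_le => [||z]; [exact: (integ_row mK KC fi)|by apply: integD; exact: integZ|].
  have [->|fz] := eqVneq (f z) 0; first by rewrite !mulr0 addr0.
  by rewrite !mulrA -mulrDl ler_wpM2r// Kpq.
rewrite (Int_eq (g := fun y => Q * (p y * f y) + P * (q y * f y))); last by move=> y; ring.
rewrite IntD; [|exact: integZ..].
rewrite !IntZ// -/P -/Q.
by rewrite le_eqVlt; apply/orP; left; apply/eqP; ring.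
Qed.

Section weak_limits.
Variables (v : nat -> R -> R) (V : R -> R) (B : R).
Hypothesis v_integ : forall k, integ (v k).
Hypothesis v_ge0 : forall k y, 0 <= v k y.
Hypothesis v_bound : forall k, Int (v k) <= B.
Hypothesis v_equi : equi_integrable (range v).
Hypothesis V_integ : integ V.
Hypothesis v_weak : forall (om : R -> R) C, measurable_fun setT om ->
  (forall y, `|om y| <= C) ->
  Int (fun y => om y * v k y) @[k --> \oo] --> Int (fun y => om y * V y).

(** The test functions vary with k, and pointwise bounded convergence is enough: replacing [h_ k] by
    its limit is covered by equi-integrability, after which weak convergence applies. *)
Lemma linear_cvg (h_ : nat -> R -> R) (h : R -> R) C :
  (forall k, measurable_fun setT (h_ k)) -> (forall k y, `|h_ k y| <= C) ->
  (forall y, h_ k y @[k --> \oo] --> h y) ->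
  Int (fun y => h_ k y * v k y) @[k --> \oo] --> Int (fun y => h y * V y).
Proof.
move=> mh hC hh.
have mlim : measurable_fun setT h by apply: (measurable_fun_cvg mh) => y _; exact: hh.
have hCl y : `|h y| <= C.
  have c : `|h_ k y| @[k --> \oo] --> `|h y| by apply: cvg_norm; exact: hh.
  rewrite -(cvg_lim _ c)//; apply: limr_le; first exact: cvgP c.
  exact: nearW.
apply/cvg_natP => e e0.
have e2 : 0 < e / 2 by rewrite divr_gt0.
have PB f : range v f -> [/\ integ f, forall x, 0 <= f x & Int f <= B].
  by move=> [k _ <-].
have [N1 hN1] := equi_integrable_cvg v_equi PB mh hC hh e2.
have /cvg_natP/(_ _ e2)[N2 hN2] := v_weak mlim hCl.
exists (maxn N1 N2) => k; rewrite geq_max => /andP[k1 k2].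
have -> : Int (fun y => h_ k y * v k y) =
    Int (fun y => (h_ k y - h y) * v k y) + Int (fun y => h y * v k y).
  rewrite -IntD.
  - by apply: Int_eq => y; rewrite -mulrDl subrK.
  - apply: (integ_mulb (C := C + C)) => // [|y]; first exact: measurable_funB.
    by rewrite (le_trans (ler_normB _ _))// lerD.
  - exact: integ_mulb hCl _.
rewrite -addrA (le_trans (ler_normD _ _))// [leRHS]splitr lerD//; last exact: hN2.
by apply: hN1 => //; exists k.
Qed.

(** For fixed y the row integrals converge by the linear statement, and they are bounded uniformly
    in y and k. They are therefore admissible varying test functions for a second use of it. *)
Lemma quadratic_cvg (K_ : nat -> R -> R -> R) K C :
  (forall k, meas2 (K_ k)) -> (forall k y z, `|K_ k y z| <= C) ->
  (forall y z, K_ k y z @[k --> \oo] --> K y z) ->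
  qform (K_ k) (v k) @[k --> \oo] --> qform K V.
Proof.
move=> mK KC KK; apply: (@linear_cvg _ _ (`|C| * B)) => [k|k y|y].
- by apply: meas2_row => //; exact: integ_meas.
- have KC' y' z : `|K_ k y' z| <= `|C| by rewrite (le_trans (KC _ _ _))// ler_norm.
  apply: (le_trans (row_bound (mK k) KC' (v_integ k) y)).
  rewrite ler_wpM2l// (Int_eq (g := v k))// => x; by rewrite ger0_norm.
- apply: (@linear_cvg _ _ C) => [k|k z|z]; [exact: meas2_l|exact: KC|exact: KK].
Qed.

End weak_limits.

End quadratic_forms.

(** * A Gronwall inequality in integrated form *)

Section gronwall.
Variable R : realType.

(* [M] does not depend on the a priori bound [B], which may thus be the
   non-uniform bound available for one truncated problem. *)
Lemma gronwall_sup (C T : R) : 0 <= C -> exists2 M : R, 0 <= M &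
  forall (f : R -> R) (B f0 d : R), 0 <= d -> 0 <= f0 -> f 0 <= f0 ->
  (forall t, 0 <= t <= T -> f t <= B) ->
  (forall s t L : R, 0 <= s -> s <= t -> t <= T -> 0 <= L ->
    (forall r, s <= r <= t -> f r <= L) -> f t <= f s + (t - s) * (C * L + d)) ->
  forall t, 0 <= t <= T -> f t <= M * (f0 + d).
Proof.
move=> C0.
pose h : R := (2 * (C + 1))^-1.
have C1 : 0 < C + 1 by rewrite ltr_wpDl.
have h0 : 0 < h by rewrite invr_gt0 mulr_gt0.
have hC : h * C <= 2^-1.
  by rewrite /h mulrC ler_pdivrMr ?mulr_gt0// mulrA mulVf// mul1r lerDl.
have h2 : h <= 2^-1.
  rewrite /h invfM ler_piMr// invf_le1// lerDr//.
(* A factor at most 4 for each of the time steps of length h that cover [0, T]. *)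
exists (4 ^+ (Num.truncn (T / h)).+1); first exact: exprn_ge0.
move=> f B f0 d d0 f00 ff0 fB fstep.
pose X : R := f0 + d.
have X0 : 0 <= X by rewrite addr_ge0.
have claim (j : nat) : forall t, 0 <= t <= T -> t <= j%:R * h -> f t <= 4 ^+ j * X.
  elim: j => [|j IH] t tT tj.
    have -> : t = 0 by case/andP: tT => t0 _; apply/eqP; rewrite eq_le t0 -(mul0r h) tj.
    by rewrite expr0 mul1r (le_trans ff0)// lerDl.
  have [tj'|tj'] := leP t (j%:R * h).
    by rewrite (le_trans (IH t tT tj'))// ler_wpM2r// exprS ler_peMl ?exprn_ge0// (ler_nat _ 1 4).
  set Y := 4 ^+ j * X in IH.
  have XY : X <= Y.
    rewrite /Y ler_peMl// exprn_ege1// (ler_nat _ 1 4)//.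
  have dY : d <= Y by rewrite (le_trans _ XY)// lerDr.
  have Y0 : 0 <= Y := le_trans X0 XY.
  have jh0 : 0 <= j%:R * h by rewrite mulr_ge0// ltW.
  pose B0 := Num.max B 0.
  have B00 : 0 <= B0 by rewrite le_max lexx orbT.
  (* A bound L improves to L/2 + Y + Y/2, where Y dominates the value at the start of the step and
     also d. The fixed point is 3Y; the a priori bound survives only as B0 / 2^i and disappears as i
     grows. *)
  have inner (i : nat) : forall r, j%:R * h <= r -> r <= t -> f r <= B0 / 2 ^+ i + 3 * Y.
    elim: i => [|i IHi] r jr rt.
      rewrite expr0 divr1 (le_trans (fB _ _))//.
        by case/andP: tT => _ tT; rewrite (le_trans jh0 jr) (le_trans rt).
      by rewrite (@le_trans _ _ B0)// ?le_max ?lexx// lerDl mulr_ge0.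
    case/andP: tT => t0 tT.
    have L0 : 0 <= B0 / 2 ^+ i + 3 * Y by rewrite addr_ge0 ?mulr_ge0 ?divr_ge0 ?exprn_ge0.
    have := fstep (j%:R * h) r _ jh0 jr (le_trans rt tT) L0.
    move=> /(_ (fun r' h' => IHi r' (proj1 (andP h')) (le_trans (proj2 (andP h')) rt))).
    have h3 : f (j%:R * h) <= Y.
      by apply: IH => //; rewrite jh0 (le_trans (ltW tj') tT).
    have rh : r - j%:R * h <= h.
      by rewrite lerBlDl (le_trans rt)// (le_trans tj)// -natr1 mulrDl mul1r.
    have rh0 : 0 <= r - j%:R * h by rewrite subr_ge0.
    set L := B0 / 2 ^+ i + 3 * Y in L0 *.
    have LE : B0 / 2 ^+ i.+1 + 3 * Y = L / 2 + 3 / 2 * Y.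
      by rewrite /L exprS invfM; lra.
    have A0 : 0 <= C * L + d by rewrite addr_ge0// mulr_ge0.
    have e1 : (r - j%:R * h) * (C * L + d) <= h * (C * L + d) by rewrite ler_wpM2r.
    have e2 : h * (C * L) <= L / 2 by rewrite mulrA mulrC ler_wpM2l.
    have e3 : h * d <= 2^-1 * Y.
      by rewrite (@le_trans _ _ (2^-1 * d))// ?ler_wpM2r// ler_wpM2l// invr_ge0.
    rewrite LE; move: e1; rewrite mulrDr; lra.
  have : f t <= 3 * Y.
    rewrite leNgt; apply/negP => h3.
    have e0 : 0 < (f t - 3 * Y) / 2 by rewrite divr_gt0// subr_gt0.
    have [i hi] := halving_decays B0 e0.
    have := inner i t (ltW tj') (lexx t); lra.
  rewrite exprS -mulrA -/Y; lra.
move=> t /[dup] tT /andP[t0 tT']; apply: claim => //.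
rewrite -ler_pdivrMr// ltW// (le_lt_trans _ (truncnS_gt _))//.
by rewrite ler_pM2r// invr_gt0.
Qed.

End gronwall.

(** * Truncated problems *)

Section weak_form_of_the_right_hand_side.
Variable R : realType.

Lemma qform_eq (K K' : R -> R -> R) (f : R -> R) :
  (forall y z, K y z = K' y z) -> qform K f = qform K' f.
Proof.
by move=> KK; rewrite (_ : K = K')//; apply/funext => y; apply/funext.
Qed.

Lemma qform_tr K C (f : R -> R) : meas2 K -> (forall y z, `|K y z| <= C) -> integ f ->
  qform (fun y z => K z y) f = qform K f.
Proof.
move=> mK KC fi; have mf := integ_meas fi.
pose F y z := K z y * f z * f y.
have iF : integ2 F.
  apply: (@integ2_bound _ _ (fun y => C * `|f y|) (fun z => `|f z|)).
  - by apply: meas2_mul; [apply: meas2_mul; [exact: meas2_swap|exact: meas2_snd]|exact: meas2_fst].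
  - exact/integZ/integ_abs.
  - exact: integ_abs.
  - by move=> y z; rewrite /F !normrM mulrAC ler_wpM2r// ler_wpM2r.
transitivity (Int (fun y => Int (fun z => F y z))).
  apply: Int_eq => y; rewrite mulrC -IntZ; first by apply: Int_eq => z; rewrite mulrC.
  by apply: (integ_mulb (C := C)) => //; exact: meas2_r.
rewrite Fubini_Int//; apply: Int_eq => z; rewrite mulrC -IntZ; last exact: integ_row KC fi z.
by apply: Int_eq => y; rewrite /F; ring.
Qed.

Definition frag_test (b : R -> R -> R) (om : R -> R) (y : R) : R :=
  om y - Int (fun z => b z y * om z).

(** The indicator expresses that the equation is posed on (0, N): a pair of total size at least N
    creates no particle there. The same formula serves both truncations, the conservative kernel
    vanishing on such pairs. *)
Definition coag_test (N : R) (om : R -> R) (y z : R) : R :=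
  \1_(`]0, N[) (y + z) * om (y + z) - om y - om z.

Variables (a b : R -> R -> R) (s h : R -> R) (N Ca Cs cb : R).
Hypothesis ma : meas2 a.
Hypothesis aC : forall y z, `|a y z| <= Ca.
Hypothesis a_sym : forall y z, a y z = a z y.
Hypothesis mb : meas2 b.
Hypothesis b_ge0 : forall y z, 0 <= b y z.
Hypothesis b_supp : forall y z, ~~ (0 < y < z) -> b y z = 0.
Hypothesis b_integ : forall z, integ (fun y => b y z).
Hypothesis b_bound : forall z, Int (fun y => b y z) <= cb.
Hypothesis ms : measurable_fun setT s.
Hypothesis sC : forall z, `|s z| <= Cs.
Hypothesis s_supp : forall z, ~~ (0 < z < N) -> s z = 0.
Hypothesis hi : integ h.
Hypothesis h_supp : forall y, ~~ (0 < y < N) -> h y = 0.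

Definition weak_rhs (om : R -> R) : R :=
  2^-1 * qform (fun y z => coag_test N om y z * a y z) h
  - Int (fun y => frag_test b om y * s y * h y).

Variables (om : R -> R) (C : R).
Hypothesis mom : measurable_fun setT om.
Hypothesis omC : forall y, `|om y| <= C.

Let mh : measurable_fun setT h := integ_meas hi.
Let C0 : 0 <= C := le_trans (normr_ge0 (om 0)) (omC 0).
Let om' y := \1_(`]0, N[) y * om y.
Let mom' : measurable_fun setT om'.
Proof. by apply: measurable_funM => //; exact: measurable_indic. Qed.
Let omC' y : `|om' y| <= C.
Proof.
by rewrite /om' indicE; case: (_ \in _); rewrite ?mul1r// mul0r normr0.
Qed.

Lemma coag_test_meas : meas2 (coag_test N om).
Proof.
exact: (meas2_add (meas2_add (meas2_sum mom') (meas2_opp (meas2_fst mom)))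
  (meas2_opp (meas2_snd mom))).
Qed.

Lemma coag_test_bound y z : `|coag_test N om y z| <= 3 * C.
Proof.
rewrite /coag_test (_ : 3 * C = C + C + C); last by ring.
rewrite (le_trans (ler_normB _ _))// lerD// (le_trans (ler_normB _ _))// lerD//.
exact: (omC' (y + z)).
Qed.

Lemma frag_test_meas : measurable_fun setT (frag_test b om).
Proof.
apply: measurable_funB => //; apply: meas_Int.
by apply: meas2_mul; [exact: meas2_swap|exact: meas2_snd].
Qed.

Lemma integ_breakage_test y : integ (fun z => b z y * om z).
Proof. by apply: integ_eq (integ_mulb mom omC (b_integ y)) => z; rewrite mulrC. Qed.

Lemma breakage_test_bound y : `|Int (fun z => b z y * om z)| <= C * cb.
Proof.
rewrite (Int_eq (g := fun z => om z * b z y)); last by move=> z; rewrite mulrC.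
rewrite (le_trans (Int_mulb mom omC (b_integ y)))// ler_wpM2l//.
by rewrite (Int_eq (g := fun z => b z y))// => z; rewrite ger0_norm.
Qed.

Lemma frag_test_bound y : `|frag_test b om y| <= C * (1 + cb).
Proof.
rewrite mulrDr mulr1 (le_trans (ler_normB _ _))// lerD//; exact: breakage_test_bound.
Qed.

Let gain y := Int (fun z => a (y - z) z * h (y - z) * h z).

(** Fubini followed by the translation of y by z turns the convolution into a quadratic form. The
    inner integrand is known to be integrable for almost every y only, hence the detour through an
    almost everywhere equality. *)
Let gainE : integ (fun y => om' y * gain y) /\ Int (fun y => om' y * gain y) =
  qform (fun y z => om' (y + z) * a y z) h.
Proof.
have mhs : meas2 (fun z y => h (y - z)).
  have md : measurable_fun [set: R * R] (fun p : R * R => p.2 - p.1).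
    by apply: measurable_funB; [exact: measurable_snd|exact: measurable_fst].
  by have := measurableT_comp mh md.
have mas : meas2 (fun z y => a (y - z) z).
  have md : measurable_fun [set: R * R] (fun p : R * R => (p.2 - p.1, p.1)).
    apply: measurable_fun_pair; last exact: measurable_fst.
    by apply: measurable_funB; [exact: measurable_snd|exact: measurable_fst].
  by have := measurableT_comp ma md.
pose F z y := om' y * (a (y - z) z * h (y - z) * h z).
have mF : meas2 F.
  apply: meas2_mul; first exact: meas2_snd.
  by apply: meas2_mul; [exact: meas2_mul|exact: meas2_fst].
have Fb z y : `|F z y| <= C * Ca * `|h z| * `|h (y - z)|.
  rewrite /F normrM (_ : C * Ca * _ * _ = C * (Ca * `|h (y - z)| * `|h z|)); last by ring.
  by rewrite ler_pM// !normrM ler_wpM2r// ler_wpM2r.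
have iF : integ2 F.
  apply: (@integ2_dom _ _ (fun z => C * Ca * Int (fun y => `|h y|) * `|h z|)) => //.
    exact/integZ/integ_abs.
  move=> z; have i1 : integ (fun y => C * Ca * `|h z| * `|h (y - z)|).
    exact/integZ/(integ_shift _ (integ_abs hi)).
  have i2 : integ (F z) by apply: integ_le (Fb z) i1; exact: meas2_l.
  split => //; apply: (@le_trans _ _ (Int (fun y => C * Ca * `|h z| * `|h (y - z)|))).
    by apply: Int_le => //; exact: integ_abs.
  rewrite IntZ; last exact: (integ_shift _ (integ_abs hi)).
  by rewrite (Int_shift _ (integ_abs hi)) mulrAC.
have iFr := integ2_Int_r iF.
have mgain : measurable_fun setT (fun y => om' y * gain y).
  apply: measurable_funM => //; apply: meas_Int; apply: meas2_swap.
  by apply: meas2_mul; [exact: meas2_mul|exact: meas2_fst].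
have E : {ae @lebesgue_measure R, forall y, Int (fun z => F z y) = om' y * gain y}.
  apply: ae_imp (ae_integrable2 iF) => y Fy.
  have [oy|oy] := eqVneq (om' y) 0.
    by rewrite oy mul0r (Int_eq (g := fun=> 0)) ?Int0// => z; rewrite /F oy mul0r.
  rewrite /gain -IntZ//.
  have : integ (fun z => F z y) by [].
  move=> /(integZ (om' y)^-1); apply: integ_eq => z.
  by rewrite /F mulKf.
split; first exact: ae_eq_integ E iFr.
rewrite -(ae_eq_Int (integ_meas iFr) mgain E) -Fubini_Int//.
apply: Int_eq => z.
have [iz _] : integ (F z) /\ True.
  split => //; apply: integ_le (Fb z) _; first exact: meas2_l.
  exact/integZ/(integ_shift _ (integ_abs hi)).
have -> : Int (F z) = Int (fun y => F z (y + z)) by rewrite Int_shift.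
rewrite mulrC -IntZ.
  by apply: Int_eq => y; rewrite /F addrK a_sym [y + z]addrC; ring.
apply: (integ_mulb (C := C * Ca)) => //.
  apply: measurable_funM; last exact: meas2_l.
  by have := meas2_l z (meas2_sum mom').
by move=> y; rewrite normrM ler_pM.
Qed.

(** Fubini moves the test function onto the fragments. Its cut-off at N disappears because a
    fragment is smaller than its parent, and [s] confines the parent to (0, N). *)
Let fragE : integ (fun y => om' y * Int (fun z => b y z * (s z * h z))) /\
  Int (fun y => om' y * Int (fun z => b y z * (s z * h z))) =
  Int (fun z => s z * h z * Int (fun y => b y z * om y)).
Proof.
have si : integ (fun z => s z * h z) by exact: integ_mulb sC hi.
pose F z y := om' y * (b y z * (s z * h z)).
have mF : meas2 F.
  apply: meas2_mul; first exact: meas2_snd.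
  apply: meas2_mul; first exact: meas2_swap.
  exact: meas2_fst (integ_meas si).
have ib z : integ (fun y => C * `|s z * h z| * b y z) by exact: integZ.
have Fb z y : `|F z y| <= C * `|s z * h z| * b y z.
  rewrite /F normrM [`|b y z * _|]normrM (ger0_norm (b_ge0 _ _)) [b y z * _]mulrC mulrA.
  by rewrite ler_wpM2r// ler_wpM2r.
have iFz z : integ (F z) by apply: integ_le (Fb z) (ib z); exact: meas2_l.
have iF : integ2 F.
  apply: (@integ2_dom _ _ (fun z => C * cb * `|s z * h z|)) => //.
    exact/integZ/integ_abs.
  move=> z; split => //.
  apply: (@le_trans _ _ (Int (fun y => C * `|s z * h z| * b y z))).
    by apply: Int_le => //; exact: integ_abs.
  by rewrite IntZ// mulrAC ler_wpM2r ?mulr_ge0// ler_wpM2l.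
have iFr := integ2_Int_r iF.
have mg : measurable_fun setT (fun y => om' y * Int (fun z => b y z * (s z * h z))).
  by apply: measurable_funM => //; apply: meas2_row => //; exact: integ_meas si.
have E : {ae @lebesgue_measure R, forall y, Int (fun z => F z y) =
    om' y * Int (fun z => b y z * (s z * h z))}.
  apply: ae_imp (ae_integrable2 iF) => y Fy.
  have [oy|oy] := eqVneq (om' y) 0.
    by rewrite oy mul0r (Int_eq (g := fun=> 0)) ?Int0// => z; rewrite /F oy mul0r.
  rewrite -IntZ//.
  have : integ (fun z => F z y) by [].
  move=> /(integZ (om' y)^-1); apply: integ_eq => z.
  by rewrite /F mulKf.
split; first exact: ae_eq_integ E iFr.
rewrite -(ae_eq_Int (integ_meas iFr) mg E) -Fubini_Int//.
apply: Int_eq => z; rewrite -IntZ; last exact: integ_breakage_test.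
apply: Int_eq => y; rewrite /F /om' indicE.
have [zN|/s_supp ->] := boolP (0 < z < N); last by ring.
have [yz|/b_supp ->] := boolP (0 < y < z); last by ring.
rewrite mem_set ?mul1r; first by ring.
by rewrite /= in_itv/=; move: yz zN => /andP[-> yz] /andP[_ zN]; exact: lt_trans zN.
Qed.

(** By symmetry of [a], the loss term is half the sum of the forms carrying [om y] and [om z];
    together with the gain it makes up [coag_test]. *)
Lemma weak_rhsE : Int (fun y => \1_(`]0, N[) y * om y * (2^-1 * gain y
    - Int (fun z => a y z * h z) * h y + Int (fun z => b y z * (s z * h z)) - s y * h y))
  = weak_rhs om.
Proof.
have [i1 E1] := gainE; have [i3 E3] := fragE.
have omaC y z : `|om y * a y z| <= C * Ca by rewrite normrM ler_pM.
have moma : meas2 (fun y z => om y * a y z) by apply: meas2_mul => //; exact: meas2_fst.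
have i2 : integ (fun y => Int (fun z => om y * a y z * h z) * h y).
  exact: integ_qform moma omaC hi.
have sh : integ (fun y => s y * h y) := integ_mulb ms sC hi.
have i4 : integ (fun y => om y * (s y * h y)) := integ_mulb mom omC sh.
have omh y : \1_(`]0, N[) y * om y * h y = om y * h y.
  have [yN|/h_supp ->] := boolP (0 < y < N); last by rewrite !mulr0.
  by rewrite indicE mem_set ?mul1r//= in_itv.
have -> : Int (fun y => \1_(`]0, N[) y * om y * (2^-1 * gain y
    - Int (fun z => a y z * h z) * h y + Int (fun z => b y z * (s z * h z)) - s y * h y)) =
  Int (fun y => 2^-1 * (om' y * gain y) - Int (fun z => om y * a y z * h z) * h y +
    om' y * Int (fun z => b y z * (s z * h z)) - om y * (s y * h y)).
  apply: Int_eq => y.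
  have -> : Int (fun z => om y * a y z * h z) * h y = om' y * h y * Int (fun z => a y z * h z).
    rewrite omh -mulrA [h y * _]mulrC mulrA -IntZ; last exact: integ_row ma aC hi y.
    by congr (_ * _); apply: Int_eq => z; rewrite mulrA.
  rewrite -[om y * (s y * h y)]mulrCA -omh -/(om' y); ring.
have i1' : integ (fun y => 2^-1 * (om' y * gain y)) by exact: integZ.
have e1 := IntB (integD (integB i1' i2) i3) i4.
have e2 := IntD (integB i1' i2) i3.
have e3 := IntB i1' i2.
rewrite {}e1 {}e2 {}e3 (IntZ _ i1) E1 E3.
have mK1 : meas2 (fun y z => om' (y + z) * a y z) := meas2_mul (meas2_sum mom') ma.
have K1C y z : `|om' (y + z) * a y z| <= C * Ca by rewrite normrM ler_pM.
have mK2 : meas2 (fun y z => om z * a y z) := meas2_mul (meas2_snd mom) ma.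
have K2C y z : `|om z * a y z| <= C * Ca by rewrite normrM ler_pM.
have K12C y z : `|om y * a y z + om z * a y z| <= C * Ca + C * Ca.
  exact: le_trans (ler_normD _ _) (lerD (omaC y z) (K2C y z)).
have K12C' y z : `|- (om y * a y z + om z * a y z)| <= C * Ca + C * Ca by rewrite normrN.
have q1 := qformD mK1 (meas2_opp (meas2_add moma mK2)) K1C K12C' hi.
have q2 := qformN (meas2_add moma mK2) K12C hi.
have q3 := qformD moma mK2 omaC K2C hi.
have q4 := qform_tr moma omaC hi.
have q5 : qform (fun y z => om z * a y z) h = qform (fun y z => om z * a z y) h.
  by apply: qform_eq => y z; rewrite a_sym.
have q6 : qform (fun y z => coag_test N om y z * a y z) h =
    qform (fun y z => om' (y + z) * a y z + - (om y * a y z + om z * a y z)) h.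
  by apply: qform_eq => y z; rewrite /coag_test /om'; ring.
have q7 : Int (fun y => frag_test b om y * s y * h y) =
    Int (fun y => om y * (s y * h y)) - Int (fun z => s z * h z * Int (fun y => b y z * om y)).
  have i5 : integ (fun z => s z * h z * Int (fun y => b y z * om y)).
    apply: integ_eq (integ_mulb _ breakage_test_bound sh) => [y|]; first by rewrite mulrC.
    by apply: meas_Int; apply: meas2_mul; [exact: meas2_swap|exact: meas2_snd].
  rewrite -(IntB i4 i5).
  by apply: Int_eq => y; rewrite /frag_test; ring.
rewrite /weak_rhs q7 q6 q1 q2 q3 q5 q4 -/(qform (fun y z => om y * a y z) h).
have key (q q' j j' : R) : 2^-1 * q - q' + j - j' = 2^-1 * (q - (q' + q')) - (j' - j) by field.
exact: key.
Qed.

End weak_form_of_the_right_hand_side.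

(** * The fundamental theorem of calculus on a closed half-line *)

Section half_line_calculus.
Variable R : realType.
Local Notation mu := (@lebesgue_measure R).
Variables F D : R -> R.
Hypothesis D_cont : forall t, 0 <= t -> forall e : R, 0 < e -> exists2 d : R, 0 < d &
  forall s, 0 <= s -> `|s - t| < d -> `|D s - D t| <= e.

Lemma half_line_within_continuous (s T : R) : 0 <= s -> {within `[s, T], continuous D}.
Proof.
move=> s_ge0; apply/subspace_continuousP => t /=; rewrite in_itv/= => /andP[st tT].
have t0 := le_trans s_ge0 st.
apply/cvgrPdist_le => e e0; have [d d0 hd] := D_cont t0 e0.
apply/nbhs_ballP; exists d => // r /=; rewrite /ball/= => rtd.
rewrite in_itv/= => /andP[sr rT]; rewrite distrC; apply: hd; last by rewrite distrC.
exact: le_trans sr.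
Qed.

Hypothesis F_deriv : forall t, 0 <= t -> forall e : R, 0 < e -> exists2 d : R, 0 < d &
  forall s, 0 <= s -> s != t -> `|s - t| < d -> `|(F s - F t) / (s - t) - D t| <= e.

Let F_cont t : 0 <= t -> forall e : R, 0 < e -> exists2 d : R, 0 < d &
  forall s, 0 <= s -> `|s - t| < d -> `|F s - F t| <= e.
Proof.
move=> t0 e e0; have [d d0 hd] := F_deriv t0 ltr01.
have c0 : 0 < `|D t| + 1 by rewrite ltr_wpDl.
exists (Num.min d (e / (`|D t| + 1))); first by rewrite lt_min d0 divr_gt0.
move=> s s0; rewrite lt_min => /andP[sd se].
have [->|st] := eqVneq s t; first by rewrite subrr normr0 ltW.
have h := hd s s0 st sd.
have st0 : s - t != 0 by rewrite subr_eq0.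
rewrite -[F s - F t](divfK st0) normrM.
have h2 : `|(F s - F t) / (s - t)| <= `|D t| + 1.
  by rewrite -[X in `|X|](subrK (D t)) (le_trans (ler_normD _ _))// addrC lerD2l.
rewrite (le_trans (ler_pM _ _ h2 (ltW se)))//.
by rewrite mulrC divfK// gt_eqF.
Qed.

(** Two-sided derivatives are needed in the open interval only, with one-sided continuity at its
    ends, so a one-sided derivative at time 0 suffices. *)
Lemma half_line_FTC s t : 0 <= s -> s <= t ->
  F t - F s = \int[mu]_(r in `[s, t]) D r.
Proof.
move=> s0; rewrite le_eqVlt => /predU1P[->|st].
  by rewrite subrr set_itv1 Rintegral_set1.
have dF r : s < r -> h^-1 *: ((F \o shift r) (h *: (1:R)) - F r) @[h --> 0^'] --> D r.
  move=> sr; have r0 : 0 < r := le_lt_trans s0 sr.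
  apply/cvgrPdist_le => e e0; have [d d0 hd] := F_deriv (ltW r0) e0.
  (* Radius at most r keeps [h + r] in the half-line where F is controlled. *)
  apply/nbhs_ballP; exists (Num.min d r); first by rewrite /= lt_min d0.
  move=> h /=; rewrite /ball/= sub0r normrN lt_min => /andP[hd1 hr] h0.
  have := hd (h + r); rewrite addrK => /(_ _ _ hd1); rewrite distrC => H.
  rewrite -[_ *: (_ - _)]mulrC /= -[h *: 1]/(h * 1) mulr1; apply: H.
    by move: hr; rewrite ltr_norml => /andP[h1 _]; rewrite -lerBlDr sub0r ltW.
  by rewrite -subr_eq0 addrK.
have derF r : s < r -> derivable F r 1 by move=> sr; apply/cvg_ex; exists (D r); exact: dF.
have F1 r : s < r -> derive1 F r = D r.
  by move=> sr; rewrite derive1E /derive; apply/cvg_lim => //; exact: dF.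
have t0 : 0 < t := le_lt_trans s0 st.
have H := @continuous_FTC2 R D F s t st.
rewrite /Rintegral H ?oppr0 //.
- exact: half_line_within_continuous.
- split.
  + by move=> x; rewrite in_itv/= => /andP[sx _]; exact: derF.
  + apply/cvgrPdist_le => e e0; have [d d0 hd] := F_cont s0 e0.
    apply/nbhs_ballP; exists d => //= x; rewrite /ball/= => xd sx.
    by rewrite distrC; apply: hd; [exact: le_trans s0 (ltW sx)|rewrite distrC].
  + apply/cvgrPdist_le => e e0; have [d d0 hd] := F_cont (ltW t0) e0.
    apply/nbhs_ballP; exists (Num.min d t); first by rewrite /= lt_min d0.
    move=> x; rewrite /ball/= lt_min => /andP[xd xt] xt'.
    rewrite distrC; apply: hd; last by rewrite distrC.
    by move: xt; rewrite ltr_norml => /andP[_]; rewrite ltrBlDl ltrDr => /ltW.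
- by move=> x; rewrite in_itv/= => /andP[sx _]; exact: F1.
Qed.

End half_line_calculus.

(** * Integrals of C^1 curves in L^1 against bounded functions *)

Section C1_solutions.
Variable R : realType.
Local Notation mu := (@lebesgue_measure R).
Variables (N : R) (u v : R -> R -> R).
Hypothesis uv : is_C1_L1 `]0, N[ u v.
Variables (om : R -> R) (C : R).
Hypothesis mom : measurable_fun setT om.
Hypothesis omC : forall y, `|om y| <= C.

Let I : set R := `]0, N[%classic.
Let C0 : 0 <= C := le_trans (normr_ge0 (om 0)) (omC 0).

Lemma C1_integ_sol t : 0 <= t -> integ (fun y => \1_I y * u t y).
Proof. by case: uv => h _ _ _ /h /integ_set; apply. Qed.

Lemma C1_integ_der t : 0 <= t -> integ (fun y => \1_I y * v t y).
Proof. by case: uv => _ h _ _ /h /integ_set; apply. Qed.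

Let L1_dist_small (Q : set_system R) {FQ : Filter Q} (f : R -> R -> R) (g : R -> R) :
  L1_dist I (f s) g @[s --> Q] --> 0%E ->
  forall e : R, 0 < e -> \forall s \near Q, Int (fun y => \1_I y * `|f s y - g y|) <= e.
Proof.
move=> /fine_cvgP[_ /cvgrPdist_le h] e e0; have := h e e0; apply: filterS => s /=.
rewrite sub0r normrN; apply: le_trans.
rewrite -Int_set; exact: ler_norm.
Qed.

Let Int_test (p q : R -> R) : integ (fun y => \1_I y * p y) -> integ (fun y => \1_I y * q y) ->
  `|Int (fun y => om y * (\1_I y * p y)) - Int (fun y => om y * (\1_I y * q y))|
    <= C * Int (fun y => \1_I y * `|p y - q y|).
Proof.
move=> ip iq; rewrite -IntB; [|exact: integ_mulb omC ip|exact: integ_mulb omC iq].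
rewrite (Int_eq (g := fun y => om y * (\1_I y * p y - \1_I y * q y))); last by move=> y; rewrite mulrBr.
rewrite (le_trans (Int_mulb mom omC (integB ip iq)))// ler_wpM2l// le_eqVlt; apply/orP; left.
by apply/eqP; apply: Int_eq => y; rewrite -mulrBr normrM indicE; case: (_ \in _); rewrite ?normr1 ?normr0.
Qed.

(** Integration against [om] is a bounded linear form on L^1 of the interval, so it carries
    difference quotients and their limits in L^1 to scalar ones. *)
Lemma C1_FTC s t : 0 <= s -> s <= t ->
  Int (fun y => om y * (\1_I y * u t y)) - Int (fun y => om y * (\1_I y * u s y)) =
  \int[mu]_(r in `[s, t]) Int (fun y => om y * (\1_I y * v r y)) /\
  {within `[0, t], continuous (fun r => Int (fun y => om y * (\1_I y * v r y)))}.
Proof.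
move=> s0 st.
pose D r := Int (fun y => om y * (\1_I y * v r y)).
pose F r := Int (fun y => om y * (\1_I y * u r y)).
case: uv => _ _ vcont uder.
have C1 : 0 < C + 1 by rewrite ltr_wpDl.
have eC (e : R) : 0 < e -> 0 < e / (C + 1) by move=> e0; rewrite divr_gt0.
have Ce (e x : R) : 0 < e -> x <= e / (C + 1) -> C * x <= e.
  move=> e0 xe; rewrite (le_trans (ler_wpM2l C0 xe))// mulrCA -[leRHS]mulr1 ler_wpM2l ?(ltW e0)//.
  by rewrite ler_pdivrMr// mul1r lerDl.
have Dc t' : 0 <= t' -> forall e : R, 0 < e -> exists2 d : R, 0 < d &
    forall s', 0 <= s' -> `|s' - t'| < d -> `|D s' - D t'| <= e.
  move=> t0 e e0.
  have : \forall s' \near within `[0, +oo[ (nbhs t'),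
    Int (fun y => \1_I y * `|v s' y - v t' y|) <= e / (C + 1).
    exact: (L1_dist_small (vcont t' t0) (eC e e0)).
  move=> /nbhs_ballP[d /= d0 hd]; exists d => // s' s'0 sd.
  rewrite (le_trans (Int_test (C1_integ_der s'0) (C1_integ_der t0)))//.
  apply: Ce => //; apply: hd => //=; last by rewrite in_itv/= s'0.
  by rewrite /ball/= distrC.
have Fd t' : 0 <= t' -> forall e : R, 0 < e -> exists2 d : R, 0 < d &
    forall s', 0 <= s' -> s' != t' -> `|s' - t'| < d -> `|(F s' - F t') / (s' - t') - D t'| <= e.
  move=> t0 e e0.
  have : \forall s' \near within `[0, +oo[ (dnbhs t'),
    Int (fun y => \1_I y * `|(u s' y - u t' y) / (s' - t') - v t' y|) <= e / (C + 1).
    exact: (L1_dist_small (uder t' t0) (eC e e0)).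
  move=> /nbhs_ballP[d /= d0 hd]; exists d => // s' s'0 s't sd.
  have st0 : s' - t' != 0 by rewrite subr_eq0.
  have iq : integ (fun y => \1_I y * ((u s' y - u t' y) / (s' - t'))).
    apply: integ_eq (integZ (s' - t')^-1 (integB (C1_integ_sol s'0) (C1_integ_sol t0))) => y.
    by ring.
  have -> : (F s' - F t') / (s' - t') = Int (fun y => om y * (\1_I y * ((u s' y - u t' y) / (s' - t')))).
    rewrite mulrC /F -IntB; [|exact: (integ_mulb mom omC (C1_integ_sol s'0))|exact: (integ_mulb mom omC (C1_integ_sol t0))].
    rewrite -IntZ; last by apply: integB; [exact: (integ_mulb mom omC (C1_integ_sol s'0))|exact: (integ_mulb mom omC (C1_integ_sol t0))].
    by apply: Int_eq => y; ring.
  rewrite (le_trans (Int_test iq (C1_integ_der t0)))//.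
  apply: Ce => //; apply: hd => //=; first by rewrite /ball/= distrC.
  by rewrite in_itv/= s'0.
split; first exact: (half_line_FTC Dc Fd s0 st).
exact: (half_line_within_continuous Dc (lexx 0)).
Qed.

End C1_solutions.

(** The data of the theorem gathered in one parameter for all the estimates; [cf_c1] is a fixed
    witness of the bound on the daughter distribution. *)
Record coag_frag (R : realType) := CoagFrag {
  cf_k1 : R; cf_k2 : R; cf_beta : R; cf_nu : R; cf_c1 : R; cf_zeta : R;
  cf_A : R -> R -> R; cf_S : R -> R; cf_gin : R -> R; cf_gn : nat -> R -> R -> R;
  cf_k1_ge0 : 0 <= cf_k1;
  cf_k2_ge0 : 0 <= cf_k2;
  cf_beta_range : 0 <= cf_beta < 2^-1;
  cf_nu_range : -1 < cf_nu <= 0;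
  cf_A_meas : measurable_fun (Rpos `*` Rpos) (fun p : R * R => cf_A p.1 p.2);
  cf_A_ge0 : forall y z : R, 0 < y -> 0 < z -> 0 <= cf_A y z;
  cf_A_sym : forall y z : R, 0 < y -> 0 < z -> cf_A y z = cf_A z y;
  cf_S_meas : measurable_fun Rpos cf_S;
  cf_S_ge0 : forall y : R, 0 < y -> 0 <= cf_S y;
  cf_A_bound : forall y z : R, 0 < y -> 0 < z ->
    cf_A y z <= cf_k1 * ((1 + y + z) / (y * z) `^ cf_beta);
  cf_c1_gt2 : 2 < cf_c1;
  cf_b_bound : forall z : R, 0 < z ->
    (\int[lebesgue_measure]_(y in `]0%R, z[)
       (y `^ (- (2 * cf_beta)) * breakage cf_nu y z)%:E
     <= (cf_c1 * z `^ (- (2 * cf_beta)))%:E)%E;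
  cf_S_bound : forall y : R, 0 < y -> cf_S y <= cf_k2 * y `^ (1 + cf_nu);
  cf_gin_ge0 : \forall y \ae (@lebesgue_measure R), 0 < y -> 0 <= cf_gin y;
  cf_gin_L1 : in_L1w (- (2 * cf_beta)) cf_gin;
  cf_zeta01 : cf_zeta = 0 \/ cf_zeta = 1;
  cf_gn_sol : forall n, (1 <= n)%N ->
    truncated_solution cf_A cf_S (breakage cf_nu) cf_gin cf_zeta n (cf_gn n) }.

(** * Power weights *)

Section power_weights.
Variable R : realType.
Implicit Types y z a : R.

Lemma powR_one a : 1 `^ a = 1 :> R.
Proof. by rewrite powR1. Qed.

Lemma powR_anti a y z : 0 < y -> y <= z -> a <= 0 -> z `^ a <= y `^ a.
Proof.
move=> y0 yz a0; have z0 : 0 < z := lt_le_trans y0 yz.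
have E x : x `^ a = (x `^ (- a))^-1 by rewrite powRN invrK.
rewrite !E lef_pV2 ?posrE ?powR_gt0//.
by rewrite ge0_ler_powR ?oppr_ge0// ?nnegrE ltW.
Qed.

Lemma powR_ge1 a y : 0 < y -> y <= 1 -> a <= 0 -> 1 <= y `^ a.
Proof. by move=> y0 y1 a0; rewrite -(powR_one a) powR_anti. Qed.

Lemma powR_le1 a y : 1 <= y -> a <= 0 -> y `^ a <= 1.
Proof. by move=> y1 a0; rewrite -[leRHS](powR_one a) powR_anti. Qed.

Lemma weight_ge0 a y : 0 <= y -> 0 <= weight a y.
Proof. by move=> y0; rewrite addr_ge0// powR_ge0. Qed.

Lemma weight_gt0 a y : 0 < y -> 0 < weight a y.
Proof. by move=> y0; rewrite ltr_wpDl// powR_ge0. Qed.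

Lemma le1_weight a y : 0 < y -> a <= 0 -> 1 <= weight a y.
Proof.
move=> y0 a0; have [y1|y1] := leP y 1.
  by rewrite (le_trans (powR_ge1 y0 y1 a0))// lerDl ltW.
by rewrite (le_trans (ltW y1))// lerDr powR_ge0.
Qed.

(** Below 1 the power is dominated by [y ^ a], above 1 by y. Every exponent met later lies between
    the order of an available moment and 1, and is absorbed in this way. *)
Lemma powR_le_weight a p y : 0 < y -> a <= p -> p <= 1 -> y `^ p <= weight a y.
Proof.
move=> y0 ap p1; have [y1|y1] := leP y 1.
  rewrite (@le_trans _ _ (y `^ a))//; last by rewrite lerDl ltW.
  rewrite -(subrK a p) powRD; last by apply/implyP => _; rewrite gt_eqF.
  rewrite ler_piMl ?powR_ge0// -(powR_one (p - a)) ge0_ler_powR ?nnegrE ?subr_ge0//.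
  exact: ltW.
rewrite (@le_trans _ _ y)//; last by rewrite lerDr powR_ge0.
rewrite -[leRHS]powRr1 ?(ltW y0)// ler_powR//; exact: ltW.
Qed.

Lemma measurable_weight a : measurable_fun [set: R] (weight a).
Proof. by apply: measurable_funD => //; exact: measurable_powR. Qed.

End power_weights.

(** * Coefficients extended by zero to the whole line *)

Section coefficients.
Variables (R : realType) (P : coag_frag R).
Local Notation mu := (@lebesgue_measure R).
Local Notation beta := (cf_beta P).
Local Notation nu := (cf_nu P).
Local Notation b := (breakage (cf_nu P)).

(** The hypotheses say nothing about nonpositive sizes. Extension by zero gives coefficients that
    are measurable and signed everywhere; [pos_init] also removes the negative values of the datum,
    which occur on a null set. *)
Definition pos_A (y z : R) : R := \1_Rpos y * (\1_Rpos z * cf_A P y z).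
Definition pos_S (y : R) : R := \1_Rpos y * cf_S P y.
Definition pos_init (y : R) : R := \1_Rpos y * Num.max 0 (cf_gin P y).
(* Index n stands for the truncation parameter n.+1. *)
Definition trunc_A (n : nat) : R -> R -> R := trunc_kernel (cf_zeta P) n.+1 (cf_A P).
Definition trunc_S (n : nat) : R -> R := trunc_fun n.+1 (cf_S P).

Lemma indic_itvE (i : interval R) (y : R) : \1_([set` i]) y = (y \in i)%R%:R :> R.
Proof. by rewrite indicE mem_setE. Qed.

Lemma indic_Rpos (y : R) : \1_Rpos y = (0 < y)%R%:R :> R.
Proof. by rewrite indic_itvE in_itv/= andbT. Qed.

Lemma beta_ge0 : 0 <= beta. Proof. by case/andP: (cf_beta_range P). Qed.
Lemma beta_lt1 : beta < 1.
Proof. by case/andP: (cf_beta_range P) => _ h; apply: (lt_trans h); rewrite invf_lt1// ltr1n. Qed.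
Lemma nu_gtN1 : -1 < nu. Proof. by case/andP: (cf_nu_range P). Qed.
Lemma nu_le0 : nu <= 0. Proof. by case/andP: (cf_nu_range P). Qed.
Lemma c1_ge0 : 0 <= cf_c1 P. Proof. exact: le_trans (ler0n _ 2) (ltW (cf_c1_gt2 P)). Qed.

Lemma breakageE y z : b y z = \1_Rpos y * (\1_Rpos (z - y) * ((nu + 2) * (y `^ nu * z `^ (- (1 + nu))))).
Proof.
rewrite /breakage !indic_Rpos subr_gt0 powRN.
by case: (0 < y); case: (y < z); rewrite /= ?mul0r ?mul1r ?mulr0.
Qed.

Lemma breakage_meas : meas2 b.
Proof.
have mp : measurable_fun [set: R] (\1_Rpos : R -> R) by apply: measurable_indic; exact: measurable_itv.
have -> : b = (fun y z => \1_Rpos y * (\1_Rpos (z - y) * ((nu + 2) * (y `^ nu * z `^ (- (1 + nu)))))).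
  by apply/funext => y; apply/funext => z; exact: breakageE.
apply: meas2_mul; first exact: meas2_fst.
apply: meas2_mul.
  have md : measurable_fun [set: R * R] (fun p : R * R => p.2 - p.1).
    by apply: measurable_funB; [exact: measurable_snd|exact: measurable_fst].
  by have := measurableT_comp mp md.
have mk : meas2 (fun y z => y `^ nu * z `^ (- (1 + nu))).
  by apply: meas2_mul; [apply: meas2_fst|apply: meas2_snd]; exact: measurable_powR.
exact: (measurable_funM (measurable_cst (nu + 2)) mk).
Qed.

Lemma breakage_ge0 y z : 0 <= b y z.
Proof.
rewrite /breakage; case: ifP => // _.
rewrite mulr_ge0 ?divr_ge0 ?powR_ge0//; have := nu_gtN1; lra.
Qed.

Lemma breakage_supp y z : ~~ (0 < y < z) -> b y z = 0.
Proof. by rewrite /breakage => /negbTE ->. Qed.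

Lemma breakage_moment z : 0 < z -> integ (fun y => y `^ (- (2 * beta)) * b y z) /\
  Int (fun y => y `^ (- (2 * beta)) * b y z) <= cf_c1 P * z `^ (- (2 * beta)).
Proof.
move=> z0; have := cf_b_bound P z0.
have f0 y : 0 <= y `^ (- (2 * beta)) * b y z by rewrite mulr_ge0 ?powR_ge0 ?breakage_ge0.
rewrite integral_mkcond (_ : (\int[_]_y _)%E = (\int[mu]_y (y `^ (- (2 * beta)) * b y z)%:E)%E); last first.
  apply: eq_integral => y _; rewrite patchE mem_setE in_itv/=.
  by case: ifPn => // /breakage_supp ->; rewrite mulr0.
move=> h; have i : integ (fun y => y `^ (- (2 * beta)) * b y z).
  apply: integ_ge0P => //; last exact: le_lt_trans h (ltry _).
  by apply: measurable_funM; [exact: measurable_powR|exact: meas2_r breakage_meas].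
by split => //; rewrite -lee_fin IntE.
Qed.

(** For y < z the factor y^(-2 beta) is at least z^(-2 beta), so the moment hypothesis also bounds
    the number of fragments by [cf_c1]. *)
Lemma breakage_integ z : integ (fun y => b y z) /\ Int (fun y => b y z) <= cf_c1 P.
Proof.
have [z0|z0] := ltP 0 z; last first.
  have E y : b y z = 0.
    by apply: breakage_supp; apply/negP => /andP[h1 h2]; have := lt_trans h1 h2; rewrite ltNge z0.
  split; first by apply: integ_eq (@integ0 R) => y; rewrite E.
  by rewrite (Int_eq (g := fun=> 0)) ?Int0 ?c1_ge0.
have [i h] := breakage_moment z0.
have z2 : 0 < z `^ (2 * beta) by rewrite powR_gt0.
have bl y : `|b y z| <= z `^ (2 * beta) * (y `^ (- (2 * beta)) * b y z).
  rewrite ger0_norm ?breakage_ge0//.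
  have [/andP[y0 yz]|/breakage_supp ->] := boolP (0 < y < z); last by rewrite !mulr0.
  rewrite mulrA ler_peMl ?breakage_ge0// -ler_pdivrMl// mulr1 -powRN.
  apply: powR_anti => //; first exact: ltW.
  by rewrite oppr_le0 mulr_ge0// beta_ge0.
have ib : integ (fun y => b y z).
  by apply: integ_le bl (integZ _ i); exact: meas2_r breakage_meas.
split => //; apply: (@le_trans _ _ (Int (fun y => z `^ (2 * beta) * (y `^ (- (2 * beta)) * b y z)))).
  by apply: Int_le => //; [exact: integZ|move=> y; exact: le_trans (ler_norm _) (bl y)].
by rewrite IntZ// -ler_pdivlMl// [_^-1 * _]mulrC -powRN.
Qed.

Lemma breakage_int_le z : Int (fun y => b y z) <= cf_c1 P.
Proof. by case: (breakage_integ z). Qed.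

Lemma breakage_int z : integ (fun y => b y z).
Proof. by case: (breakage_integ z). Qed.

Lemma pos_A_meas : meas2 pos_A.
Proof.
have mD : measurable (Rpos `*` Rpos : set (R * R)) by apply: measurableX; exact: measurable_itv.
have := (measurable_restrictT _ mD).1 (cf_A_meas P).
congr measurable_fun; apply/funext => -[y z] /=.
rewrite patchE /pos_A !indic_Rpos in_setX /Rpos !mem_setE !in_itv/= !andbT.
by case: (0 < y); case: (0 < z); rewrite /= ?mul0r ?mul1r ?mulr0.
Qed.

Lemma pos_S_meas : measurable_fun setT pos_S.
Proof.
have mD : measurable (Rpos : set R) by exact: measurable_itv.
have := (measurable_restrictT _ mD).1 (cf_S_meas P).
congr measurable_fun; apply/funext => y.
rewrite patchE /pos_S indic_Rpos /Rpos mem_setE in_itv/= andbT.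
by case: (0 < y); rewrite /= ?mul0r ?mul1r.
Qed.

Lemma pos_A_ge0 y z : 0 <= pos_A y z.
Proof.
rewrite /pos_A !indic_Rpos; have [y0|y0] := ltP 0 y; have [z0|z0] := ltP 0 z; rewrite ?mul0r ?mulr0// !mul1r.
exact: cf_A_ge0.
Qed.

Lemma pos_A_sym y z : pos_A y z = pos_A z y.
Proof.
rewrite /pos_A !indic_Rpos; have [y0|y0] := ltP 0 y; have [z0|z0] := ltP 0 z; rewrite ?mul0r ?mulr0// !mul1r.
exact: cf_A_sym.
Qed.

Lemma pos_A_le y z : 0 < y -> 0 < z ->
  pos_A y z <= cf_k1 P * ((1 + y + z) * (y `^ (- beta) * z `^ (- beta))).
Proof.
move=> y0 z0; rewrite /pos_A !indic_Rpos y0 z0 !mul1r (le_trans (cf_A_bound P y0 z0))//.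
rewrite ler_wpM2l ?cf_k1_ge0// powRM ?(ltW y0) ?(ltW z0)// invfM -!powRN//.
Qed.

Lemma pos_S_ge0 y : 0 <= pos_S y.
Proof.
rewrite /pos_S !indic_Rpos; have [y0|y0] := ltP 0 y; rewrite ?mul0r// !mul1r.
exact: cf_S_ge0.
Qed.

Lemma pos_S_le y : 0 < y -> pos_S y <= cf_k2 P * y `^ (1 + nu).
Proof. by move=> y0; rewrite /pos_S indic_Rpos y0 mul1r cf_S_bound. Qed.

Lemma trunc_AE n y z : trunc_A n y z = pos_A y z * \1_(`]n.+1%:R^-1, n.+1%:R[) y *
  \1_(`]n.+1%:R^-1, n.+1%:R[) z * (1 - cf_zeta P + cf_zeta P * \1_(`]0, n.+1%:R[) (y + z)).
Proof.
rewrite /trunc_A /trunc_kernel /pos_A; congr (_ * _).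
have n0 : 0 < n.+1%:R^-1 :> R by rewrite invr_gt0.
rewrite !indic_itvE /= !in_itv/= !andbT.
have [y0|y0] := ltP n.+1%:R^-1 y; last by rewrite !mulr0 !mul0r.
have [z0|z0] := ltP n.+1%:R^-1 z; last by rewrite !mulr0.
by rewrite (lt_trans n0 y0) (lt_trans n0 z0) !mul1r.
Qed.

Lemma trunc_factor (I : set R) (x : R) :
  0 <= 1 - cf_zeta P + cf_zeta P * (\1_I x : R) <= 1.
Proof.
rewrite indicE; case: (cf_zeta01 P) => ->; case: (_ \in _);
by rewrite ?subr0 ?mul0r ?addr0 ?subrr ?add0r ?mulr1 ?mulr0 ?lexx ?ler01.
Qed.

End coefficients.

(** * Bounds and supports of the truncated coefficients *)

Section truncated_coefficients.
Variables (R : realType) (P : coag_frag R) (n : nat).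
Local Notation beta := (cf_beta P).
Local Notation nu := (cf_nu P).
Local Notation pos_A := (pos_A P).
Local Notation pos_S := (pos_S P).
Local Notation N := (n.+1%:R : R).

Let N0 : 0 < N. Proof. by []. Qed.

Lemma trunc_A_meas : meas2 (trunc_A P n).
Proof.
have E : trunc_A P n = (fun y z => pos_A y z * \1_(`]N^-1, N[) y *
  \1_(`]N^-1, N[) z * (1 - cf_zeta P + cf_zeta P * \1_(`]0, N[) (y + z))).
  by apply/funext => y; apply/funext => z; exact: trunc_AE.
rewrite E; apply: meas2_mul; last first.
  apply: measurable_funD => //; apply: measurable_funM => //.
  by apply: (@meas2_sum R (\1_(`]0, N[))); apply: measurable_indic; exact: measurable_itv.
apply: meas2_mul; last by apply: meas2_snd; apply: measurable_indic; exact: measurable_itv.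
apply: meas2_mul; last by apply: meas2_fst; apply: measurable_indic; exact: measurable_itv.
exact: pos_A_meas.
Qed.

Lemma trunc_A_ge0 y z : 0 <= trunc_A P n y z.
Proof.
rewrite trunc_AE; apply: mulr_ge0; last first.
  by case/andP: (trunc_factor P (`]0, N[)%classic (y + z)).
apply: mulr_ge0; last by rewrite indicE.
by apply: mulr_ge0; [exact: pos_A_ge0|rewrite indicE].
Qed.

Lemma trunc_A_le y z : trunc_A P n y z <= pos_A y z.
Proof.
have key (x p q r : R) : 0 <= x -> 0 <= p <= 1 -> 0 <= q <= 1 -> 0 <= r <= 1 ->
    x * p * q * r <= x.
  move=> x0 /andP[p0 p1] /andP[q0 q1] /andP[r0 r1].
  rewrite -!mulrA -[leRHS]mulr1 ler_wpM2l// mulr_ile1 ?mulr_ge0// mulr_ile1//.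
have i01 (I : set R) (x : R) : 0 <= (\1_I x : R) <= 1.
  by rewrite indicE; case: (_ \in _); rewrite ?lexx ?ler01.
by rewrite trunc_AE; apply: key; [exact: pos_A_ge0|exact: i01|exact: i01|exact: trunc_factor].
Qed.

Lemma trunc_A_sym y z : trunc_A P n y z = trunc_A P n z y.
Proof. by rewrite !trunc_AE pos_A_sym [y + z]addrC; ring. Qed.

Lemma trunc_A_supp y z : ~~ (N^-1 < y < N) -> trunc_A P n y z = 0.
Proof. by rewrite trunc_AE indic_itvE in_itv/= => /negbTE ->; rewrite mulr0 !mul0r. Qed.

Lemma trunc_A_suppr y z : ~~ (N^-1 < z < N) -> trunc_A P n y z = 0.
Proof. by move=> h; rewrite trunc_A_sym trunc_A_supp. Qed.

Lemma trunc_A_supp_sum y z : cf_zeta P = 1 -> N <= y + z -> trunc_A P n y z = 0.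
Proof.
move=> z1 yzN; rewrite trunc_AE z1 subrr add0r mul1r !indic_itvE !in_itv/=.
have -> : (y + z < N) = false by rewrite ltNge yzN.
by rewrite andbF mulr0.
Qed.

(** This bound deteriorates with n. It serves to make the quadratic forms of one truncated problem
    converge and never enters a uniform estimate. *)
Definition trunc_A_max : R := cf_k1 P * ((1 + N + N) * (N `^ beta * N `^ beta)).

Lemma trunc_A_bound y z : `|trunc_A P n y z| <= trunc_A_max.
Proof.
have m0 : 0 <= trunc_A_max.
  by rewrite /trunc_A_max !mulr_ge0 ?cf_k1_ge0 ?addr_ge0 ?powR_ge0.
have [/andP[y1 y2]|/trunc_A_supp ->] := boolP (N^-1 < y < N); last by rewrite normr0.
have [/andP[z1 z2]|/trunc_A_suppr ->] := boolP (N^-1 < z < N); last by rewrite normr0.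
have iN0 : 0 < N^-1 by rewrite invr_gt0.
have y0 := lt_trans iN0 y1; have z0 := lt_trans iN0 z1.
rewrite ger0_norm ?trunc_A_ge0// (le_trans (trunc_A_le _ _))// (le_trans (pos_A_le P y0 z0))//.
have pw x : N^-1 < x -> x `^ (- beta) <= N `^ beta.
  move=> x1; rewrite (@le_trans _ _ (N^-1 `^ (- beta)))//.
    by apply: powR_anti => //; [exact: ltW|rewrite oppr_le0 beta_ge0].
  have -> : N^-1 = N `^ (-1) by rewrite powR_inv1.
  by rewrite -powRrM mulrNN mul1r.
rewrite /trunc_A_max ler_wpM2l ?cf_k1_ge0// ler_pM ?mulr_ge0 ?powR_ge0 ?addr_ge0 ?(ltW y0) ?(ltW z0)//.
  by rewrite lerD ?lerD2l// ltW.
by rewrite ler_pM ?powR_ge0 ?pw.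
Qed.

Lemma trunc_SE y : trunc_S P n y = pos_S y * \1_(`]0, N[) y.
Proof.
rewrite /trunc_S /trunc_fun /pos_S indic_itvE in_itv/= indic_Rpos.
by case: (0 < y); rewrite ?mul1r//= !mulr0.
Qed.

Lemma trunc_S_meas : measurable_fun setT (trunc_S P n).
Proof.
rewrite (funext trunc_SE); apply: measurable_funM; first exact: pos_S_meas.
by apply: measurable_indic; exact: measurable_itv.
Qed.

Lemma trunc_S_ge0 y : 0 <= trunc_S P n y.
Proof. by rewrite trunc_SE mulr_ge0 ?pos_S_ge0// indicE. Qed.

Lemma trunc_S_le y : trunc_S P n y <= pos_S y.
Proof. by rewrite trunc_SE ler_piMr ?pos_S_ge0// indicE; case: (_ \in _). Qed.

Lemma trunc_S_supp y : ~~ (0 < y < N) -> trunc_S P n y = 0.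
Proof. by rewrite trunc_SE indic_itvE in_itv/= => /negbTE ->; rewrite mulr0. Qed.

Lemma trunc_S_bound y : `|trunc_S P n y| <= cf_k2 P * N `^ (1 + nu).
Proof.
have [/andP[y0 yN]|/trunc_S_supp ->] := boolP (0 < y < N); last first.
  by rewrite normr0 mulr_ge0 ?cf_k2_ge0 ?powR_ge0.
rewrite ger0_norm ?trunc_S_ge0// (le_trans (trunc_S_le _))// (le_trans (pos_S_le P y0))//.
rewrite ler_wpM2l ?cf_k2_ge0// ge0_ler_powR ?nnegrE ?(ltW y0) ?(ltW yN)//.
by rewrite addrC -lerBlDr sub0r ltW ?nu_gtN1.
Qed.

End truncated_coefficients.

(** * Nonnegative representatives of the truncated solutions *)

Section positive_solution.
Variables (R : realType) (P : coag_frag R).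
Local Notation mu := (@lebesgue_measure R).
Local Notation beta := (cf_beta P).
Local Notation b := (breakage (cf_nu P)).
Local Notation w2 := (weight (- (2 * cf_beta P))).

Let mRpos : measurable (Rpos : set R). Proof. exact: measurable_itv. Qed.

Lemma beta2_le0 : - (2 * beta) <= 0.
Proof. by rewrite oppr_le0 mulr_ge0// beta_ge0. Qed.

Lemma beta_le0 : - beta <= 0.
Proof. by rewrite oppr_le0 beta_ge0. Qed.

Lemma pos_init_ge0 y : 0 <= pos_init P y.
Proof. by rewrite /pos_init mulr_ge0 ?indicE// le_max lexx. Qed.

Lemma pos_initE y : pos_init P y = Num.max 0 (\1_Rpos y * cf_gin P y).
Proof.
rewrite /pos_init indicE; case: (_ \in _); first by rewrite !mul1r.
by rewrite !mul0r maxxx.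
Qed.

(** The integrability hypothesis yields measurability of the weighted datum; dividing by the
    positive weight recovers that of the datum. *)
Lemma init_meas : measurable_fun setT (fun y => \1_Rpos y * cf_gin P y).
Proof.
have i1 : integ (fun y => \1_Rpos y * (w2 y * cf_gin P y)).
  exact: (proj1 (@integ_set R Rpos (fun y => w2 y * cf_gin P y) mRpos) (cf_gin_L1 P)).
have E y : \1_Rpos y * cf_gin P y = w2 y `^ (-1) * (\1_Rpos y * (w2 y * cf_gin P y)).
  rewrite indic_Rpos; have [y0|y0] := ltP 0 y; last by rewrite !mul0r mulr0.
  rewrite !mul1r powR_inv1; last exact/weight_ge0/ltW.
  by rewrite mulKf// gt_eqF// weight_gt0.
rewrite (funext E); apply: measurable_funM; last exact: integ_meas.
by have := measurableT_comp (@measurable_powR R (-1)) (measurable_weight (- (2 * beta))).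
Qed.

Lemma pos_init_meas : measurable_fun setT (pos_init P).
Proof. by rewrite (funext pos_initE); apply: measurable_maxr => //; exact: init_meas. Qed.

Lemma pos_init_ae : {ae mu, forall y, \1_Rpos y * cf_gin P y = pos_init P y}.
Proof.
apply: ae_imp (cf_gin_ge0 P) => y; rewrite /pos_init indic_Rpos.
by have [y0 /(_ isT) h|] := ltP 0 y; rewrite ?mul0r// !mul1r max_r.
Qed.

Lemma pos_init_weight : integ (fun y => w2 y * pos_init P y).
Proof.
have i1 : integ (fun y => \1_Rpos y * (w2 y * cf_gin P y)).
  exact: (proj1 (@integ_set R Rpos (fun y => w2 y * cf_gin P y) mRpos) (cf_gin_L1 P)).
apply: integ_le (integ_abs i1).
  by apply: measurable_funM; [exact: measurable_weight|exact: pos_init_meas].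
move=> y; rewrite pos_initE indic_Rpos.
have [y0|y0] := ltP 0 y; last by rewrite !mul0r maxxx mulr0 normr0.
rewrite !mul1r !normrM ler_wpM2l//.
by rewrite ger0_norm ?le_max ?lexx// ge_max normr_ge0 ler_norm.
Qed.

Lemma pos_init_integ : integ (pos_init P).
Proof.
apply: integ_le pos_init_weight; first exact: pos_init_meas.
move=> y; rewrite ger0_norm ?pos_init_ge0//.
have [y0|y0] := ltP 0 y; last by rewrite /pos_init indic_Rpos ltNge y0 mul0r mulr0.
by rewrite ler_peMl ?pos_init_ge0// le1_weight// beta2_le0.
Qed.

Variable n : nat.
Local Notation N := (n.+1%:R : R).
Local Notation I := (`]0, n.+1%:R[%classic : set R).
Local Notation u := (cf_gn P n.+1).

(* The solutions of the statement are nonnegative only almost everywhere. *)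
Definition pos_sol (t y : R) : R :=
  if 0 <= t then \1_I y * Num.max 0 (u t y) else 0.

Lemma pos_sol_ge0 t y : 0 <= pos_sol t y.
Proof.
by rewrite /pos_sol; case: ifP => // _; rewrite mulr_ge0 ?indicE// le_max lexx.
Qed.

Lemma pos_sol_supp t y : ~~ (0 < y < N) -> pos_sol t y = 0.
Proof.
rewrite /pos_sol; case: ifP => // _.
by rewrite indic_itvE in_itv/= => /negbTE ->; rewrite mul0r.
Qed.

Let pos_solE t y : 0 <= t -> pos_sol t y = Num.max 0 (\1_I y * u t y).
Proof.
rewrite /pos_sol => ->; rewrite indicE; case: (_ \in _); first by rewrite !mul1r.
by rewrite !mul0r maxxx.
Qed.

Lemma pos_sol_integ t : integ (pos_sol t).
Proof.
have [t0|t0] := leP 0 t; last first.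
  by apply: integ_eq (@integ0 R) => y; rewrite /pos_sol leNgt t0.
have [[v uv _] _ _ _] := cf_gn_sol P (ltn0Sn n).
have i := C1_integ_sol uv t0.
apply: integ_le (integ_abs i) => [|y].
  rewrite (_ : pos_sol t = fun y => Num.max 0 (\1_I y * u t y)); last first.
    by apply/funext => y; exact: pos_solE.
  by apply: measurable_maxr => //; exact: integ_meas.
by rewrite ger0_norm ?pos_sol_ge0// pos_solE// ge_max normr_ge0 ler_norm.
Qed.

Lemma pos_sol_ae t : 0 <= t -> {ae mu, forall y, \1_I y * u t y = pos_sol t y}.
Proof.
move=> t0; have [_ _ h _] := cf_gn_sol P (ltn0Sn n).
apply: ae_imp (h t t0) => y; rewrite pos_solE// indic_itvE.
by case: (y \in `]0, N[) => [/(_ isT) h'|_]; rewrite ?mul1r ?mul0r max_r.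
Qed.

Lemma pos_sol_init (om : R -> R) (C : R) : measurable_fun setT om -> (forall y, `|om y| <= C) ->
  Int (fun y => om y * pos_sol 0 y) = Int (fun y => om y * (\1_I y * pos_init P y)).
Proof.
move=> mom omC; have [_ h0 _ _] := cf_gn_sol P (ltn0Sn n).
have i1 : integ (fun y => \1_I y * pos_init P y) by apply: integ_indic => //; exact: pos_init_integ.
apply: ae_eq_Int.
- exact: (integ_meas (integ_mulb mom omC (pos_sol_integ 0))).
- exact: (integ_meas (integ_mulb mom omC i1)).
- apply: ae_imp h0 => y; rewrite /pos_sol lexx indic_itvE in_itv/=.
  have [/andP[y0 yN] h|_ _] := boolP (0 < y < N); last by rewrite !mul0r.
  rewrite h ?in_itv/= ?y0 ?yN// /trunc_fun /pos_init indic_Rpos indic_itvE in_itv/= y0 yN.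
  by rewrite !mul1r mulr1.
Qed.

(** All domains of integration are already encoded in the supports of the coefficients. This
    includes the upper limit n - zeta y: for zeta = 1 the kernel vanishes when y + z >= n. *)
Let rhs_point t y : integ (fun z => \1_I z * u t z) -> y \in `]0, N[ ->
  truncated_rhs (cf_A P) (cf_S P) b (cf_zeta P) n.+1 (u t) y =
  2^-1 * Int (fun z => trunc_A P n (y - z) z * (\1_I (y - z) * u t (y - z)) * (\1_I z * u t z))
  - Int (fun z => trunc_A P n y z * (\1_I z * u t z)) * (\1_I y * u t y)
  + Int (fun z => b y z * (trunc_S P n z * (\1_I z * u t z)))
  - trunc_S P n y * (\1_I y * u t y).
Proof.
move=> ih yI; have /andP[y0 yN] : 0 < y < N by move: yI; rewrite in_itv.
have iN0 : 0 < N^-1 by rewrite invr_gt0.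
rewrite /truncated_rhs -/(trunc_A P n) -/(trunc_S P n) !Int_set.
have Iy : \1_I y = 1 :> R by rewrite indic_itvE yI.
congr (2^-1 * _ - _ + _ - _).
- apply: Int_eq => z; rewrite !indic_itvE !in_itv/=.
  have [/andP[z1 z2]|zN] := boolP (N^-1 < z < N); last by rewrite trunc_A_suppr// !mul0r mulr0.
  have [/andP[yz1 yz2]|yzN] := boolP (N^-1 < y - z < N); last by rewrite trunc_A_supp// !mul0r mulr0.
  have z0 := lt_trans iN0 z1; have yz0 := lt_trans iN0 yz1.
  by rewrite z0 z2 yz0 yz2 -subr_gt0 yz0 !mul1r.
- rewrite Iy mul1r [RHS]mulrC -IntZ; last first.
    exact: integ_row (trunc_A_meas P n) (trunc_A_bound P n) ih y.
  apply: Int_eq => z; rewrite !indic_itvE !in_itv/=.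
  have [/andP[z1 z2]|zN] := boolP (N^-1 < z < N); last by rewrite trunc_A_suppr// !mul0r !mulr0.
  have z0 := lt_trans iN0 z1; rewrite z0 z2 !mul1r /=.
  case: (cf_zeta01 P) => zE.
    by rewrite zE mul0r subr0 z2 mul1r; ring.
  have [yzN|yzN] := ltP (y + z) N.
    by rewrite zE mul1r ltrBrDl yzN mul1r; ring.
  by rewrite trunc_A_supp_sum// !mul0r !mulr0.
- apply: Int_eq => z; rewrite !indic_itvE !in_itv/=.
  have [/andP[z1 z2]|zN] := boolP (0 < z < N); last by rewrite trunc_S_supp// mulr0 mul0r !mulr0.
  rewrite z2 andbT; have [yz|yz] := ltP y z; first by rewrite !mul1r; ring.
  rewrite mul0r breakage_supp ?mul0r//.
  by apply/negP => /andP[_]; rewrite ltNge yz.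
- by rewrite Iy mul1r.
Qed.

Let weak_rhs_ae (h g om : R -> R) (C : R) : measurable_fun setT om -> (forall y, `|om y| <= C) ->
  integ h -> integ g -> {ae mu, forall y, h y = g y} ->
  weak_rhs (trunc_A P n) b (trunc_S P n) h N om = weak_rhs (trunc_A P n) b (trunc_S P n) g N om.
Proof.
move=> mom omC hi gi hg; rewrite /weak_rhs; congr (_ * _ - _).
  apply: qform_ae hg; [|exact: integ_meas|exact: integ_meas].
  by apply: meas2_mul; [exact: coag_test_meas|exact: trunc_A_meas].
have mf : measurable_fun setT (fun y => frag_test b om y * trunc_S P n y).
  by apply: measurable_funM; [exact: (frag_test_meas (breakage_meas P) mom)|exact: trunc_S_meas].
apply: ae_eq_Int; [by apply: measurable_funM => //; exact: integ_meas..|].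
by apply: ae_imp hg => y ->.
Qed.

(** Changing the solution on a null set at each time alters neither side, so the identity passes
    from the given C^1 solution to its nonnegative representative. Continuity in time is kept
    because it makes the right-hand side integrable. *)
Lemma pos_sol_weak (om : R -> R) (C s t : R) : measurable_fun setT om -> (forall y, `|om y| <= C) ->
  0 <= s -> s <= t ->
  Int (fun y => om y * pos_sol t y) - Int (fun y => om y * pos_sol s y) =
    \int[mu]_(r in `[s, t]) weak_rhs (trunc_A P n) b (trunc_S P n) (pos_sol r) N om /\
  {within `[0, t], continuous
     (fun r => weak_rhs (trunc_A P n) b (trunc_S P n) (pos_sol r) N om)}.
Proof.
move=> mom omC s0 st; have t0 := le_trans s0 st.
have [[v uv vE] _ _ _] := cf_gn_sol P (ltn0Sn n).
have hi r : 0 <= r -> integ (fun y => \1_I y * u r y) by move=> r0; exact: (C1_integ_sol uv r0).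
have E r : 0 <= r -> Int (fun y => om y * (\1_I y * v r y)) =
    weak_rhs (trunc_A P n) b (trunc_S P n) (pos_sol r) N om.
  move=> r0; rewrite -(weak_rhs_ae mom omC (hi r r0) (pos_sol_integ r) (pos_sol_ae r0)).
  have hsupp y : ~~ (0 < y < N) -> \1_I y * u r y = 0.
    by rewrite indic_itvE in_itv/= => /negbTE ->; rewrite mul0r.
  have := @weak_rhsE R (trunc_A P n) b (trunc_S P n) (fun y => \1_I y * u r y) N _ _ _
    (trunc_A_meas P n) (trunc_A_bound P n) (trunc_A_sym P n) (breakage_meas P)
    (breakage_ge0 P) (@breakage_supp R P) (breakage_int P) (breakage_int_le P)
    (trunc_S_meas P n) (trunc_S_bound P n) (@trunc_S_supp R P n) (hi r r0) hsupp om C mom omC.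
  move=> <-; apply: ae_eq_Int.
  - exact: (integ_meas (integ_mulb mom omC (C1_integ_der uv r0))).
  - have mh := integ_meas (hi r r0).
    have mA := trunc_A_meas P n.
    have mhs : meas2 (fun y z => \1_I (y - z) * u r (y - z)).
      have md : measurable_fun [set: R * R] (fun p : R * R => p.1 - p.2).
        by apply: measurable_funB; [exact: measurable_fst|exact: measurable_snd].
      by have := measurableT_comp mh md.
    have mas : meas2 (fun y z => trunc_A P n (y - z) z).
      have md : measurable_fun [set: R * R] (fun p : R * R => (p.1 - p.2, p.2)).
        apply: measurable_fun_pair; last exact: measurable_snd.
        by apply: measurable_funB; [exact: measurable_fst|exact: measurable_snd].
      by have := measurableT_comp mA md.
    apply: measurable_funM.
      by apply: measurable_funM => //; exact: measurable_indic.
    apply: measurable_funB; last by apply: measurable_funM => //; exact: trunc_S_meas.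
    apply: measurable_funD.
      apply: measurable_funB.
        apply: measurable_funM => //; apply: meas_Int.
        by apply: meas2_mul; [exact: meas2_mul|exact: meas2_snd].
      by apply: measurable_funM => //; exact: meas2_row.
    apply: meas2_row; first exact: breakage_meas.
    by apply: measurable_funM => //; exact: trunc_S_meas.
  - apply: ae_imp (vE r r0) => y; rewrite [\1_I y * om y]mulrC -mulrA.
    have [yI h|yI _] := boolP (y \in `]0, N[).
      by congr (_ * _); rewrite (h isT) rhs_point//; exact: hi.
    by rewrite indic_itvE (negbTE yI) !mul0r.
have [h1 h2] := C1_FTC uv mom omC s0 st.
split.
  transitivity (Int (fun y => om y * (\1_I y * u t y)) - Int (fun y => om y * (\1_I y * u s y))).
    have aeq r : 0 <= r -> Int (fun y => om y * pos_sol r y) = Int (fun y => om y * (\1_I y * u r y)).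
      move=> r0; apply: ae_eq_Int.
      - exact: (integ_meas (integ_mulb mom omC (pos_sol_integ r))).
      - exact: (integ_meas (integ_mulb mom omC (hi r r0))).
      - by apply: ae_imp (pos_sol_ae r0) => y ->.
    by rewrite !aeq.
  rewrite h1; apply: eq_Rintegral => r; rewrite mem_setE in_itv/= => /andP[sr _].
  by apply: E; exact: le_trans sr.
apply: subspace_eq_continuous h2 => r; rewrite mem_setE in_itv/= => /andP[r0 _].
exact: E.
Qed.

End positive_solution.

(** * Uniform estimates *)

Section breakage_first_moment.
Variables (R : realType) (P : coag_frag R).
Local Notation mu := (@lebesgue_measure R).
Local Notation nu := (cf_nu P).
Local Notation b := (breakage (cf_nu P)).

(** Differentiability settles the positive arguments; at the endpoint 0 continuity is checked
    directly. *)
Lemma powR_within_continuous (c p y : R) : 0 < p ->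
  {within `[0, y], continuous (fun z : R => c * z `^ p)}.
Proof.
move=> p0; apply/subspace_continuousP => x /=; rewrite in_itv/= => /andP[x0 xy].
apply: cvgMr.
have [->|xn0] := eqVneq x 0; last first.
  have /derivable1_diffP/differentiable_continuous c0 : derivable (fun z : R^o => (z : R) `^ p : R^o) (x : R^o) 1.
    by apply: derivable_powR; rewrite in_itv/= andbT lt_neqAle eq_sym xn0.
  exact: cvg_within_filter c0.
apply/cvgrPdist_le => e e0; rewrite powR0 ?gt_eqF//.
apply/nbhs_ballP; exists (e `^ p^-1); first by rewrite /= powR_gt0.
move=> z; rewrite /ball/= sub0r normrN => ze; rewrite in_itv/= => /andP[z0 zy].
rewrite sub0r normrN ger0_norm ?powR_ge0//.
have -> : e = (e `^ p^-1) `^ p by rewrite -powRrM mulVf ?gt_eqF// powRr1// ltW.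
rewrite ge0_ler_powR ?nnegrE ?powR_ge0 ?(ltW p0)//.
by rewrite (le_trans (ler_norm _))// ltW.
Qed.

Lemma integral_powR (p y : R) : 0 < p -> 0 < y ->
  mu.-integrable `[0, y[ (EFin \o (fun z : R => (p + 1) * z `^ p)) /\
  \int[mu]_(z in `[0, y[) ((p + 1) * z `^ p) = y `^ (p + 1).
Proof.
move=> p0 y0; have c := @powR_within_continuous (p + 1) p y p0.
have p1 : 0 < p + 1 by rewrite addr_gt0.
have i1 : mu.-integrable `[0, y] (EFin \o (fun z : R => (p + 1) * z `^ p)).
  by apply: continuous_compact_integrable; [exact: segment_compact|exact: c].
have i2 : mu.-integrable `[0, y[ (EFin \o (fun z : R => (p + 1) * z `^ p)).
  apply: integrableS i1 => //.
  by move=> z /=; rewrite !in_itv/= => /andP[-> /ltW].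
split => //; rewrite Rintegral_itv_bndo_bndc//.
have H := @continuous_FTC2 R (fun z => (p + 1) * z `^ p) (fun z => z `^ (p + 1)) 0 y y0 c.
rewrite /Rintegral H /=.
- by rewrite powR0 ?gt_eqF// oppr0 addr0.
- have c1 := @powR_within_continuous 1 (p + 1) y p1.
  have c0 : (fun z : R => z `^ (p + 1)) = (fun z : R => 1 * z `^ (p + 1)).
    by apply/funext => z; rewrite mul1r.
  rewrite -c0 in c1; have [_ h1 h2] := (continuous_within_itvP _ y0).1 c1.
  split => // z; rewrite in_itv/= => /andP[z0 _].
  by apply: derivable_powR; rewrite in_itv/= andbT.
- move=> z; rewrite in_itv/= => /andP[z0 _].
  by rewrite powR_derive1 ?in_itv/= ?andbT// addrK.
Qed.

(** With p = 1 + nu, the constant nu + 2 = p + 1 is the one for which z^(nu + 2) is a primitive: the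
    fragments have the mass of their parent. *)
Lemma breakage_mass y : 0 < y -> integ (fun z => b z y * z) /\ Int (fun z => b z y * z) = y.
Proof.
move=> y0; have p0 : 0 < 1 + nu by have := nu_gtN1 P; rewrite -ltrBlDl sub0r.
have [i1 E1] := integral_powR p0 y0.
have m1 : measurable (`[0, y[ : set R) by exact: measurable_itv.
have i2 := (proj1 (integ_set _ m1)) i1.
have E z : b z y * z = y `^ (- (1 + nu)) * (\1_(`[0, y[) z * ((1 + nu + 1) * z `^ (1 + nu))).
  rewrite breakageE !indic_Rpos indic_itvE in_itv/= subr_gt0 le_eqVlt.
  have [z0|z0|z0] := ltgtP 0 z.
  - have [zy|zy] := ltP z y; rewrite ?orbT/= ?mulr0n ?mulr1n ?(mulr0, mul0r)// !mul1r.
    rewrite [z `^ (1 + nu)]powRD ?powRr1 ?(ltW z0)//; last by apply/implyP => _; rewrite gt_eqF.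
    ring.
  - by rewrite /= !mul0r mulr0.
  - by rewrite -z0 [in RHS]powR0 ?gt_eqF// !mulr0.
split; first by apply: integ_eq (integZ (y `^ (- (1 + nu))) i2) => z; rewrite E.
rewrite (Int_eq E) IntZ// -Int_set E1 -powRD; last by apply/implyP => _; rewrite gt_eqF.
by rewrite addKr powRr1// ltW.
Qed.

End breakage_first_moment.

(** * Growth of moments, and the mass of the truncated solutions *)

Section moments.
Variables (R : realType) (P : coag_frag R).
Local Notation mu := (@lebesgue_measure R).
Local Notation nu := (cf_nu P).
Local Notation b := (breakage (cf_nu P)).
Local Notation w2 := (weight (- (2 * cf_beta P))).
Local Notation G := (pos_sol P).
Local Notation D n r om :=
  (weak_rhs (trunc_A P n) b (trunc_S P n) (pos_sol P n r) n.+1%:R om).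

Lemma rhs_integrable n (om : R -> R) (C t : R) : measurable_fun setT om ->
  (forall y, `|om y| <= C) -> 0 <= t ->
  mu.-integrable `[0, t] (fun r => (D n r om)%:E).
Proof.
move=> mom omC t0; apply: continuous_compact_integrable; first exact: segment_compact.
by have [] := pos_sol_weak P n mom omC (lexx 0) t0.
Qed.

(** The integrated differential inequality, in the shape that [gronwall_sup] and
    [vanishing_propagation] expect. *)
Lemma pos_sol_growth n (om : R -> R) (C s t M : R) : measurable_fun setT om ->
  (forall y, `|om y| <= C) -> 0 <= s -> s <= t ->
  (forall r, s <= r <= t -> D n r om <= M) ->
  Int (fun y => om y * G n t y) <= Int (fun y => om y * G n s y) + (t - s) * M.
Proof.
move=> mom omC s0 st DM.
have [h _] := pos_sol_weak P n mom omC s0 st.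
rewrite -lerBlDl h.
have i1 : mu.-integrable `[s, t] (fun r => (D n r om)%:E).
  apply: (integrableS _ _ _ (rhs_integrable n mom omC (le_trans s0 st))) => //.
  by move=> x /=; rewrite !in_itv/= => /andP[sx ->]; rewrite (le_trans s0).
have mst : measurable (`[s, t] : set R) by exact: measurable_itv.
have mst' : mu `[s, t] = (t - s)%:E.
  rewrite lebesgue_measure_itv/= lte_fin; move: st; rewrite le_eqVlt => /predU1P[->|->].
    by rewrite ltxx subrr.
  by rewrite EFinB.
have i2 : mu.-integrable `[s, t] (EFin \o (fun _ : R => M)).
  apply: measurable_bounded_integrable => //.
    by have : (mu `[s, t] < +oo)%E by rewrite mst' ltry.
  by exists `|M|; split => // x xM z _ /=; exact: ltW.
apply: (@le_trans _ _ (\int[mu]_(r in `[s, t]) M)).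
  by apply: le_Rintegral => // r; rewrite /= in_itv/=; exact: DM.
by rewrite Rintegral_cst// [X in fine X]mst' /= mulrC.
Qed.

(** The bound depends on n and on [om]; it only supplies the a priori finiteness from which the
    Gronwall argument starts. *)
Lemma pos_sol_bounded n (om : R -> R) (C T : R) : measurable_fun setT om ->
  (forall y, `|om y| <= C) -> exists B, forall t, 0 <= t <= T ->
  Int (fun y => om y * G n t y) <= B.
Proof.
move=> mom omC; have [T0|T0] := leP 0 T; last first.
  by exists 0 => t /andP[t0 tT]; have := le_trans t0 tT; rewrite leNgt T0.
pose B := Int (fun r => \1_(`[0, T]) r * `|D n r om|).
exists (Int (fun y => om y * G n 0 y) + B) => t /andP[t0 tT].
have [h _] := pos_sol_weak P n mom omC (lexx 0) t0.
rewrite -lerBlDl h Int_set.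
have iT := (proj1 (integ_set (fun r => D n r om) (measurable_itv `[0, T]))) (rhs_integrable n mom omC T0).
have it := (proj1 (integ_set (fun r => D n r om) (measurable_itv `[0, t]))) (rhs_integrable n mom omC t0).
have E r : `|\1_(`[0, T]) r * D n r om| = \1_(`[0, T]) r * `|D n r om|.
  by rewrite normrM ger0_norm// indicE.
apply: Int_le => // [|r]; first exact: integ_eq E (integ_abs iT).
rewrite (le_trans (ler_norm _))// normrM ger0_norm ?indicE// ler_wpM2r//.
rewrite -!indicE; apply: indic_mono => x /=; rewrite !in_itv/= => /andP[-> xt].
exact: le_trans tT.
Qed.

Lemma qform_le0 K C (f : R -> R) : meas2 K -> (forall y z, `|K y z| <= C) ->
  integ f -> (forall y, 0 <= f y) ->
  (forall y z, f y != 0 -> f z != 0 -> K y z <= 0) -> qform K f <= 0.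
Proof.
move=> mK KC fi f0 K0.
have i0 : integ (fun y => 0 * f y) by apply: integ_eq (@integ0 R) => y; rewrite mul0r.
have := @qform_le_prod R K C f (fun=> 0) (fun=> 0) mK KC fi f0 i0 i0.
rewrite (Int_eq (g := fun=> 0)); last by move=> y; rewrite mul0r.
rewrite Int0 mulr0 mulr0; apply => y z fy fz.
by rewrite ?mul0r addr0; exact: K0.
Qed.

Lemma pos_sol_neq0 n t y : G n t y != 0 -> 0 < y < n.+1%:R.
Proof. by apply: contraNT => /pos_sol_supp ->. Qed.

Lemma rhs_coag_le0 n t (om : R -> R) (C : R) : measurable_fun setT om ->
  (forall y, `|om y| <= C) ->
  (forall y z, 0 < y < n.+1%:R -> 0 < z < n.+1%:R -> coag_test n.+1%:R om y z <= 0) ->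
  qform (fun y z => coag_test n.+1%:R om y z * trunc_A P n y z) (G n t) <= 0.
Proof.
move=> mom omC cle.
apply: (@qform_le0 _ (3 * C * trunc_A_max P n)).
- by apply: meas2_mul; [exact: coag_test_meas|exact: trunc_A_meas].
- move=> y z; rewrite normrM ler_pM//; first exact: coag_test_bound.
  exact: trunc_A_bound.
- exact: pos_sol_integ.
- exact: pos_sol_ge0.
- move=> y z /pos_sol_neq0 yN /pos_sol_neq0 zN.
  by rewrite mulr_le0_ge0 ?trunc_A_ge0// cle.
Qed.

Lemma rhs_frag_le n t (om : R -> R) (C : R) (h : R -> R) : measurable_fun setT om ->
  (forall y, `|om y| <= C) -> integ (fun y => h y * G n t y) ->
  (forall y, 0 < y < n.+1%:R -> - (frag_test b om y * pos_S P y) <= h y) ->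
  - Int (fun y => frag_test b om y * trunc_S P n y * G n t y) <= Int (fun y => h y * G n t y).
Proof.
move=> mom omC hi hle.
have ms : measurable_fun setT (fun y => frag_test b om y * trunc_S P n y).
  by apply: measurable_funM; [exact: (frag_test_meas (breakage_meas P) mom)|exact: trunc_S_meas].
have fC y : `|frag_test b om y * trunc_S P n y| <=
    C * (1 + cf_c1 P) * (cf_k2 P * n.+1%:R `^ (1 + nu)).
  rewrite normrM ler_pM//; last exact: trunc_S_bound.
  exact: (frag_test_bound (breakage_ge0 P) (breakage_int P) (breakage_int_le P) mom omC).
have i := integ_mulb ms fC (pos_sol_integ P n t).
rewrite -IntN//; apply: Int_le => // [|y]; first exact: integN.
have [->|/pos_sol_neq0 yN] := eqVneq (G n t y) 0; first by rewrite !mulr0 oppr0.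
rewrite -mulNr ler_wpM2r ?pos_sol_ge0// (le_trans _ (hle y yN))//.
by rewrite trunc_SE indic_itvE in_itv/= yN mulr1.
Qed.

Definition init_mass : R := Int (fun y => y * pos_init P y).

Lemma init_integ_le (om : R -> R) : measurable_fun setT om ->
  (forall y, 0 < y -> `|om y| <= w2 y) -> integ (fun y => om y * pos_init P y).
Proof.
move=> mom omw; apply: integ_le (integ_abs (pos_init_weight P)).
  by apply: measurable_funM => //; exact: pos_init_meas.
move=> y; have [y0|y0] := ltP 0 y; last by rewrite /pos_init indic_Rpos ltNge y0 mul0r !mulr0 normr0.
by rewrite !normrM ler_wpM2r// (le_trans (omw y y0))// ler_norm.
Qed.

Lemma init_mass_integ : integ (fun y => y * pos_init P y).
Proof.
by apply: init_integ_le => // y y0; rewrite gtr0_norm// lerDr powR_ge0.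
Qed.

Lemma init_mass_ge0 : 0 <= init_mass.
Proof.
apply: Int_ge0 => y; have [y0|y0] := ltP 0 y; first by rewrite mulr_ge0 ?pos_init_ge0// ltW.
by rewrite /pos_init indic_Rpos ltNge y0 mul0r mulr0.
Qed.

(** The size cut at N is bounded and sees the whole solution. Coagulation loses at most the pairs of
    total size at least N, and fragmentation creates no mass by [breakage_mass]. *)
Lemma moment1 n t : 0 <= t -> integ (fun y => y * G n t y) /\ Int (fun y => y * G n t y) <= init_mass.
Proof.
move=> t0; pose N : R := n.+1%:R.
pose om (y : R) : R := \1_(`]0, N[) y * y.
have mI : measurable (`]0, N[ : set R) by exact: measurable_itv.
have mom : measurable_fun setT om by apply: measurable_funM => //; exact: measurable_indic.
have omN y : `|om y| <= N.
  rewrite /om indic_itvE in_itv/=; have [/andP[y0 yN]|_] := boolP (0 < y < N).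
    by rewrite mul1r gtr0_norm// ltW.
  by rewrite mul0r normr0 /N.
have E r y : om y * G n r y = y * G n r y.
  have [->|/pos_sol_neq0 yN] := eqVneq (G n r y) 0; first by rewrite !mulr0.
  by rewrite /om indic_itvE in_itv/= yN mul1r.
have iG r : integ (fun y => om y * G n r y) := integ_mulb mom omN (pos_sol_integ P n r).
split; first exact: integ_eq (E t) (iG t).
rewrite -(Int_eq (E t)).
have om0 y : 0 <= om y.
  rewrite /om indic_itvE in_itv/=; have [/andP[y0 _]|_] := boolP (0 < y < N); last by rewrite mul0r.
  by rewrite mul1r ltW.
have omle y : 0 < y -> om y <= y.
  by move=> y0; rewrite /om ler_piMl ?(ltW y0)// indicE; case: (_ \in _).
have D0 r : 0 <= r <= t -> D n r om <= 0.
  move=> _; rewrite /weak_rhs -[leRHS]addr0 lerD//.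
    rewrite mulr_ge0_le0 ?invr_ge0//; apply: (@rhs_coag_le0 n r om N mom omN) => y z /[dup] yN /andP[y0 _] /[dup] zN /andP[z0 _].
    have -> : coag_test N om y z = \1_(`]0, N[) (y + z) * om (y + z) - y - z.
      by rewrite /coag_test {2 3}/om !indic_itvE !in_itv/= yN zN !mul1r.
    rewrite -addrA -opprD subr_le0 (@le_trans _ _ (om (y + z)))//.
      by rewrite ler_piMl// indicE; case: (_ \in _).
    by apply: omle; rewrite addr_gt0.
  apply: (le_trans (rhs_frag_le (h := fun=> 0) mom omN _ _)).
  - by apply: integ_eq (@integ0 R) => y; rewrite mul0r.
  - move=> y /[dup] yN /andP[y0 _]; rewrite oppr_le0 mulr_ge0 ?pos_S_ge0//.
    have [bi bm] := breakage_mass P y0.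
    rewrite /frag_test subr_ge0 {2}/om indic_itvE in_itv/= yN mul1r -[leRHS]bm.
    apply: Int_le => // [|z].
      exact: (integ_breakage_test (breakage_int P) mom omN y).
    have [/andP[z0 _]|/breakage_supp ->] := boolP (0 < z < y); last by rewrite !mul0r.
    by rewrite ler_wpM2l ?breakage_ge0// omle.
  - by rewrite (Int_eq (g := fun=> 0)) ?Int0// => y; rewrite mul0r.
have := pos_sol_growth mom omN (lexx 0) t0 D0.
rewrite mulr0 addr0 => /le_trans; apply.
rewrite (pos_sol_init P n mom omN); apply: Int_le => [||y].
- apply: integ_mulb omN _ => //; apply: integ_indic => //; exact: pos_init_integ.
- exact: init_mass_integ.
have [y0|y0] := ltP 0 y; last by rewrite /pos_init indic_Rpos ltNge y0 mul0r !mulr0.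
rewrite mulrA ler_wpM2r ?pos_init_ge0// (@le_trans _ _ (om y))//; last exact: omle.
by rewrite ler_piMr// indicE; case: (_ \in _).
Qed.

End moments.

(** * The moment of order -2 beta *)

Section moment_of_negative_order.
Variables (R : realType) (P : coag_frag R).
Local Notation nu := (cf_nu P).
Local Notation b := (breakage (cf_nu P)).
Local Notation w2 := (weight (- (2 * cf_beta P))).
Local Notation G := (pos_sol P).
Local Notation p2 := (fun y => y `^ (- (2 * cf_beta P))).

Let om (m : nat) (y : R) : R := \1_Rpos y * Num.min (p2 y) m%:R.

Let om_pos m y : 0 < y -> om m y = Num.min (p2 y) m%:R.
Proof. by move=> y0; rewrite /om indic_Rpos y0 mul1r. Qed.

Let om_ge0 m y : 0 <= om m y.
Proof. by rewrite /om mulr_ge0 ?indicE// le_min powR_ge0 ler0n. Qed.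

Let om_le m y : `|om m y| <= m%:R.
Proof.
rewrite ger0_norm ?om_ge0// /om indicE; case: (_ \in _); last by rewrite mul0r.
by rewrite mul1r ge_min lexx orbT.
Qed.

Let om_meas m : measurable_fun setT (om m).
Proof.
apply: measurable_funM; first by apply: measurable_indic; exact: measurable_itv.
by apply: measurable_minr => //; exact: measurable_powR.
Qed.

Let om_anti m y z : 0 < y -> y <= z -> om m z <= om m y.
Proof.
move=> y0 yz; rewrite !om_pos//; last exact: lt_le_trans yz.
by rewrite le_min !ge_min lexx orbT andbT powR_anti// beta2_le0.
Qed.

Let om_le_p2 m y : 0 < y -> om m y <= p2 y.
Proof. by move=> y0; rewrite om_pos// ge_min lexx. Qed.

(** Each branch of the minimum is treated separately: the power by the moment hypothesis, the
    constant m by the number of fragments. The same constant [cf_c1] serves both. *)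
Let frag_gain m y : 0 < y -> Int (fun z => b z y * om m z) <= cf_c1 P * om m y.
Proof.
move=> y0; have c0 := c1_ge0 P; have [bi bm] := breakage_moment P y0.
have bo := integ_breakage_test (breakage_int P) (om_meas m) (om_le m) y.
have h1 : Int (fun z => b z y * om m z) <= cf_c1 P * p2 y.
  apply: le_trans bm; apply: Int_le => // z.
  have [/andP[z0 _]|/breakage_supp ->] := boolP (0 < z < y); last by rewrite mul0r mulr0.
  by rewrite mulrC ler_wpM2r ?breakage_ge0// om_le_p2.
have h2 : Int (fun z => b z y * om m z) <= cf_c1 P * m%:R.
  apply: (@le_trans _ _ (m%:R * Int (fun z => b z y))); last first.
    by rewrite mulrC ler_wpM2r// breakage_int_le.
  rewrite -IntZ; last exact: breakage_int.
  apply: Int_le => // [|z]; first exact/integZ/breakage_int.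
  by rewrite mulrC ler_wpM2r ?breakage_ge0// (le_trans (ler_norm _))// om_le.
by rewrite om_pos// minr_pMr// le_min h1 h2.
Qed.

(** The growth y^(1 + nu) of S is harmless: it is at most 1 for y <= 1, while for y > 1 the test
    function is at most 1 and y^(1 + nu) <= y. The surplus is paid by the mass. *)
Let om_frag m y : 0 < y ->
  - (frag_test b (om m) y * pos_S P y) <= cf_k2 P * cf_c1 P * (om m y + y).
Proof.
move=> y0; have k0 := cf_k2_ge0 P; have c0 := c1_ge0 P.
have s0 := pos_S_ge0 P y; have sle := pos_S_le P y0; have o0 := om_ge0 m y.
have gle := frag_gain m y0.
have ple : om m y * y `^ (1 + nu) <= om m y + y.
  have nu0 := nu_le0 P; have nu1 := nu_gtN1 P.
  have n1 : 1 + nu <= 1 by rewrite -[leRHS]addr0 lerD2l.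
  have n0 : 0 <= 1 + nu by rewrite -lerBlDl sub0r ltW.
  have [y1|y1] := leP y 1.
    rewrite (@le_trans _ _ (om m y))//; last by rewrite lerDl ltW.
    rewrite ler_piMr// -[leRHS](powR_one (1 + nu)) ge0_ler_powR ?nnegrE//; exact: ltW.
  rewrite (@le_trans _ _ y)//; last by rewrite lerDr.
  have h1 : y `^ (1 + nu) <= y by rewrite -[leRHS]powRr1 ?(ltW y0)// ler_powR// ltW.
  rewrite -[leRHS]mul1r ler_pM ?powR_ge0//.
  rewrite (le_trans (om_le_p2 m y0))// powR_le1 ?beta2_le0//; exact: ltW.
rewrite /frag_test -mulNr opprB.
apply: (@le_trans _ _ (cf_c1 P * om m y * (cf_k2 P * y `^ (1 + nu)))).
  apply: (@le_trans _ _ (cf_c1 P * om m y * pos_S P y)).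
    rewrite ler_wpM2r// (le_trans _ gle)// lerBlDr lerDl//.
  by rewrite ler_wpM2l// mulr_ge0.
rewrite (_ : _ * _ = cf_k2 P * cf_c1 P * (om m y * y `^ (1 + nu))); last by ring.
by rewrite ler_wpM2l// mulr_ge0.
Qed.

Let step n m s t L : 0 <= s -> s <= t -> 0 <= L ->
  (forall r, s <= r <= t -> Int (fun y => om m y * G n r y) <= L) ->
  Int (fun y => om m y * G n t y) <= Int (fun y => om m y * G n s y) +
    (t - s) * (cf_k2 P * cf_c1 P * L + cf_k2 P * cf_c1 P * init_mass P).
Proof.
move=> s0 st L0 hL; have kc : 0 <= cf_k2 P * cf_c1 P by rewrite mulr_ge0 ?cf_k2_ge0 ?c1_ge0.
apply: (pos_sol_growth (om_meas m) (om_le m)) => // r srt.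
have r0 : 0 <= r by case/andP: srt => sr _; exact: le_trans sr.
have [i1 M1] := moment1 P n r0.
have io := integ_mulb (om_meas m) (om_le m) (pos_sol_integ P n r).
have E y : cf_k2 P * cf_c1 P * (om m y + y) * G n r y =
    cf_k2 P * cf_c1 P * (om m y * G n r y + y * G n r y) by ring.
have iE : integ (fun y => cf_k2 P * cf_c1 P * (om m y + y) * G n r y).
  by apply: integ_eq (integZ (cf_k2 P * cf_c1 P) (integD io i1)) => y; rewrite E.
rewrite /weak_rhs -[leRHS]add0r lerD//.
  rewrite mulr_ge0_le0 ?invr_ge0//; apply: (rhs_coag_le0 _ _ (om_meas m) (om_le m)) => y z /andP[y0 _] /andP[z0 _].
  rewrite /coag_test -addrA -opprD subr_le0 (@le_trans _ _ (om m (y + z)))//.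
    by rewrite ler_piMl ?om_ge0// indicE; case: (_ \in _).
  by rewrite (@le_trans _ _ (om m y))// ?om_anti ?lerDl ?om_ge0// ltW.
apply: (le_trans (rhs_frag_le (om_meas m) (om_le m) iE _)).
  by move=> y /andP[y0 _]; exact: om_frag.
rewrite (Int_eq E) IntZ; last exact: integD.
by rewrite -mulrDr ler_wpM2l// IntD// lerD// hL.
Qed.

(** The constants in [step] depend neither on n nor on m, so the Gronwall bound is uniform in both
    and survives the removal of the truncation at m. The mass supplies the linear part of the
    weight. *)
Lemma moment2 T : exists2 M2 : R, 0 <= M2 & forall n t, 0 <= t <= T ->
  integ (fun y => w2 y * G n t y) /\ Int (fun y => w2 y * G n t y) <= M2.
Proof.
have kc : 0 <= cf_k2 P * cf_c1 P by rewrite mulr_ge0 ?cf_k2_ge0 ?c1_ge0.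
have [M M0 HM] := gronwall_sup T kc.
pose I0 := Int (fun y => w2 y * pos_init P y).
have w2p y : 0 <= w2 y * pos_init P y.
  have [y0|y0] := ltP 0 y; first by rewrite mulr_ge0 ?pos_init_ge0// weight_ge0// ltW.
  by rewrite /pos_init indic_Rpos ltNge y0 mul0r mulr0.
have I00 : 0 <= I0 by exact: Int_ge0.
have im0 := init_mass_ge0 P.
pose J := M * (I0 + cf_k2 P * cf_c1 P * init_mass P).
have J0 : 0 <= J by rewrite mulr_ge0// addr_ge0// mulr_ge0.
exists (J + init_mass P); first exact: addr_ge0.
move=> n t tT; have /andP[t0 _] := tT.
have mI : measurable (`]0, n.+1%:R[ : set R) by exact: measurable_itv.
have bnd m : Int (fun y => om m y * G n t y) <= J.
  have [B HB] := pos_sol_bounded P n T (om_meas m) (om_le m).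
  apply: (HM (fun t => Int (fun y => om m y * G n t y)) B) => //.
  - by rewrite mulr_ge0.
  - rewrite (pos_sol_init P n (om_meas m) (om_le m)).
    apply: Int_le => [||y]; last first.
    + have [y0|y0] := ltP 0 y; last by rewrite /pos_init indic_Rpos ltNge y0 mul0r !mulr0.
      rewrite mulrA ler_wpM2r ?pos_init_ge0// (@le_trans _ _ (om m y))//.
        by rewrite ler_piMr ?om_ge0// indicE; case: (_ \in _).
      by rewrite (le_trans (om_le_p2 m y0))// lerDl ltW.
    + exact: pos_init_weight.
    + by apply: integ_mulb (om_meas m) (om_le m) _; apply: integ_indic => //; exact: pos_init_integ.
  - by move=> s r L s0 sr rT L0 hL; exact: step.
have [i1 M1] := moment1 P n t0.
have [||||i2 b2] := @integ_fatou R (fun m y => om m y * G n t y) (fun y => \1_Rpos y * p2 y * G n t y) J.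
- by move=> m; exact: integ_mulb (om_meas m) (om_le m) (pos_sol_integ P n t).
- by move=> m y; rewrite mulr_ge0 ?om_ge0 ?pos_sol_ge0.
- move=> y; apply: cvgMl; apply: cvgMr.
  apply/cvg_natP => e e0; exists (Num.truncn (p2 y)).+1 => m hm.
  rewrite min_l ?subrr ?normr0 ?ltW// (lt_le_trans (truncnS_gt _))// ler_nat//.
- exact: bnd.
have E y : w2 y * G n t y = \1_Rpos y * p2 y * G n t y + y * G n t y.
  rewrite indic_Rpos; have [y0|y0] := ltP 0 y; first by rewrite mul1r -mulrDl.
  by rewrite pos_sol_supp ?mulr0 ?addr0// ltNge y0.
split; first by apply: integ_eq (integD i2 i1) => y; rewrite E.
by rewrite (Int_eq E) IntD// lerD.
Qed.

End moment_of_negative_order.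

(** * Mass carried by large sizes *)

Section tails.
Variables (R : realType) (P : coag_frag R).
Local Notation beta := (cf_beta P).
Local Notation b := (breakage (cf_nu P)).
Local Notation w2 := (weight (- (2 * cf_beta P))).
Local Notation G := (pos_sol P).

Let om (n j : nat) (y : R) : R := \1_(`]0, n.+1%:R[) y * Num.max 0 (y - 4 ^+ j.+1).

Let om_ge0 n j y : 0 <= om n j y.
Proof. by rewrite /om mulr_ge0 ?indicE// le_max lexx. Qed.

Let om_in n j y : 0 < y < n.+1%:R -> om n j y = Num.max 0 (y - 4 ^+ j.+1).
Proof. by move=> yN; rewrite /om indic_itvE in_itv/= yN mul1r. Qed.

Let om_le n j y : om n j y <= Num.max 0 (y - 4 ^+ j.+1).
Proof. by rewrite /om ler_piMl ?le_max ?lexx// indicE; case: (_ \in _). Qed.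

Let l0 j : 0 <= 4 ^+ j.+1 :> R. Proof. exact: exprn_ge0. Qed.

Let max_le_id j (y : R) : 0 <= y -> Num.max 0 (y - 4 ^+ j.+1) <= y.
Proof. by move=> y0; rewrite ge_max y0 lerBlDr lerDl l0. Qed.

Let om_bound n j y : `|om n j y| <= n.+1%:R.
Proof.
rewrite ger0_norm ?om_ge0//; have [yN|yN] := boolP (0 < y < n.+1%:R).
  have /andP[y0 y1] := yN; rewrite om_in// (le_trans (max_le_id j (ltW y0)))//; exact: ltW.
by rewrite /om indic_itvE in_itv/= (negbTE yN) mul0r.
Qed.

Let om_meas n j : measurable_fun setT (om n j).
Proof.
apply: measurable_funM; first by apply: measurable_indic; exact: measurable_itv.
by apply: measurable_maxr => //; exact: measurable_funB.
Qed.

(** A positive defect forces y + z > l, hence y > l/2 for the larger size, and then y <= 2 (y -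
    l/4). This is why the levels are powers of 4; l >= 4 ensures y >= 1. *)
Let key1 (y z l : R) : 0 < y -> 0 < z -> z <= y -> 4 <= l ->
  Num.max 0 (y + z - l) - Num.max 0 (y - l) - Num.max 0 (z - l) <= z /\
  (0 < Num.max 0 (y + z - l) - Num.max 0 (y - l) - Num.max 0 (z - l) ->
    1 <= y /\ y <= 2 * Num.max 0 (y - l / 4)).
Proof.
move=> y0 z0 zy l4; split.
  case: (lerP 0 (y + z - l)) => ?; case: (lerP 0 (y - l)) => ?; case: (lerP 0 (z - l)) => ?; lra.
have h : y - l / 4 <= Num.max 0 (y - l / 4) by rewrite le_max lexx orbT.
move: h; set m := Num.max 0 (y - l / 4) => h.
case: (lerP 0 (y + z - l)) => ?; case: (lerP 0 (y - l)) => ?; case: (lerP 0 (z - l)) => ?;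
  move=> hp; split; lra.
Qed.

Let q y := y `^ (1 - beta).

Let k6 : 0 <= 6 * cf_k1 P. Proof. by rewrite mulr_ge0 ?cf_k1_ge0. Qed.

(** The defect is at most the smaller size z, which joins the factor z^(-beta) of the kernel to form
    [q z]. For the larger size y >= 1 the singular factor is at most 1, and 1 + y + z <= 3y is at
    most 6 times the excess over the lower level. *)
Let coag_half n j y z : 0 < y < n.+1%:R -> 0 < z < n.+1%:R -> z <= y ->
  coag_test n.+1%:R (om n j.+1) y z * trunc_A P n y z <= 6 * cf_k1 P * om n j y * q z.
Proof.
move=> yN zN zy; have /andP[y0 _] := yN; have /andP[z0 _] := zN.
have l4 : 4 <= 4 ^+ j.+2 :> R.
  by rewrite exprS ler_peMr// exprn_ege1//; lra.
have [h1 h2] := key1 y0 z0 zy l4.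
have lE : 4 ^+ j.+2 / 4 = 4 ^+ j.+1 :> R by rewrite exprS mulrAC mulfV ?mul1r// pnatr_eq0.
set c := _ - _ - _ in h1 h2.
have rge0 : 0 <= 6 * cf_k1 P * om n j y * q z.
  by rewrite (mulr_ge0 (mulr_ge0 k6 (om_ge0 n j y)) (powR_ge0 _ _)).
have A0 := trunc_A_ge0 P n y z.
have cle : coag_test n.+1%:R (om n j.+1) y z <= c.
  rewrite /coag_test /c !(om_in _ yN) !(om_in _ zN) lerB// lerB//.
  apply: le_trans (om_le n j.+1 (y + z)).
  by rewrite ler_piMl ?om_ge0// indicE; case: (_ \in _).
apply: (@le_trans _ _ (c * trunc_A P n y z)); first by rewrite ler_wpM2r.
have [c0|c0] := leP c 0; first by rewrite (le_trans _ rge0)// mulr_le0_ge0.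
have [y1 ym] := h2 c0.
have Ale := le_trans (trunc_A_le P n y z) (pos_A_le P y0 z0).
apply: (@le_trans _ _ (z * (cf_k1 P * ((1 + y + z) * (y `^ (- beta) * z `^ (- beta)))))).
  by apply: ler_pM => //; exact: ltW.
have qE : q z = z * z `^ (- beta).
  rewrite /q powRD; last by apply/implyP => _; rewrite gt_eqF.
  by rewrite powRr1// ltW.
have yb1 : y `^ (- beta) <= 1 by rewrite powR_le1// beta_le0.
have yb0 := powR_ge0 y (- beta).
have zb0 := powR_ge0 z (- beta).
rewrite (om_in _ yN) -lE qE.
have k0 := cf_k1_ge0 P.
move: ym; set m := Num.max 0 _ => ym.
have key (a c' k u v : R) : 0 <= k -> 0 <= v -> 0 <= u -> u <= 1 -> 1 + y + z <= 6 * a ->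
    z * (k * ((1 + y + z) * (u * v))) <= 6 * k * a * (z * v).
  move=> k0' v0 u0 u1 ha.
  rewrite (_ : z * _ = (k * v * z) * (u * (1 + y + z))); last by ring.
  rewrite (_ : 6 * k * a * (z * v) = (k * v * z) * (6 * a)); last by ring.
  rewrite ler_wpM2l ?mulr_ge0 ?(ltW z0)// (le_trans _ ha)// ler_piMl//; lra.
apply: key => //; lra.
Qed.

Let coag_le n j y z : 0 < y < n.+1%:R -> 0 < z < n.+1%:R ->
  coag_test n.+1%:R (om n j.+1) y z * trunc_A P n y z <=
  6 * cf_k1 P * om n j y * q z + q y * (6 * cf_k1 P * om n j z).
Proof.
move=> yN zN; have p0 x : 0 <= 6 * cf_k1 P * om n j x by exact: mulr_ge0 k6 (om_ge0 n j x).
have [zy|/ltW yz] := leP z y.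
  by rewrite (le_trans (coag_half j yN zN zy))// lerDl mulr_ge0 ?powR_ge0.
have -> : coag_test n.+1%:R (om n j.+1) y z * trunc_A P n y z =
    coag_test n.+1%:R (om n j.+1) z y * trunc_A P n z y.
  by rewrite trunc_A_sym /coag_test [y + z]addrC; ring.
by rewrite (le_trans (coag_half j zN yN yz))// [q y * _]mulrC lerDr mulr_ge0 ?powR_ge0.
Qed.

(** The ratio max(0, z - l) / z is nondecreasing, so on fragments z < y the test function lies below
    the line through its value at y; integrating that line uses mass conservation of breakage. *)
Let frag_ge0 n j y : 0 < y < n.+1%:R -> 0 <= frag_test b (om n j) y.
Proof.
move=> yN; have /andP[y0 _] := yN; have [bi bm] := breakage_mass P y0.
rewrite /frag_test subr_ge0 (om_in _ yN).
set m := Num.max 0 _; have m0 : 0 <= m by rewrite le_max lexx.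
have -> : m = Int (fun z => m / y * (b z y * z)).
  by rewrite IntZ// bm divfK// gt_eqF.
apply: Int_le => [||z].
- exact: (integ_breakage_test (breakage_int P) (om_meas n j) (om_bound n j) y).
- exact: integZ.
have [/andP[z0 zy]|/breakage_supp ->] := boolP (0 < z < y); last by rewrite !mul0r mulr0.
rewrite [leRHS]mulrCA ler_wpM2l ?breakage_ge0// (le_trans (om_le n j z))//.
rewrite mulrAC ler_pdivlMr// /m; have := l0 j; move: (4 ^+ j.+1) => l l0'.
case: (lerP 0 (z - l)) => ?; case: (lerP 0 (y - l)) => ?; rewrite ?mul0r//; nra.
Qed.

Let mass_above n j t := Int (fun y => om n j y * G n t y).

(** The order 1 - beta of [q] lies between -2 beta and 1, so its moment is at most M2. The factor 2
    of the symmetrised product cancels the 1/2 of coagulation, and fragmentation contributes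
    nothing, whence d = 0. *)
Let step n j s t L M2 : 0 <= M2 -> 0 <= s -> s <= t ->
  (forall r, s <= r <= t -> integ (fun y => w2 y * G n r y) /\ Int (fun y => w2 y * G n r y) <= M2) ->
  (forall r, s <= r <= t -> mass_above n j r <= L) ->
  mass_above n j.+1 t <= mass_above n j.+1 s + (t - s) * (6 * cf_k1 P * M2 * L + 0).
Proof.
move=> M20 s0 st hM hL; rewrite addr0.
apply: (pos_sol_growth (om_meas n j.+1) (om_bound n j.+1)) => // r srt.
have r0 : 0 <= r by case/andP: srt => sr _; exact: le_trans sr.
have [i2 b2] := hM r srt; have bL := hL r srt.
have io := integ_mulb (om_meas n j) (om_bound n j) (pos_sol_integ P n r).
have qw y : 0 < y -> q y <= w2 y.
  move=> y0; apply: powR_le_weight => //.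
    by have := beta_ge0 P; lra.
  by have := beta_ge0 P; lra.
have iq : integ (fun y => q y * G n r y).
  apply: integ_le i2 => [|y].
    by apply: measurable_funM; [exact: measurable_powR|exact: integ_meas (pos_sol_integ P n r)].
  have [->|/pos_sol_neq0 /andP[y0 _]] := eqVneq (G n r y) 0; first by rewrite !mulr0 normr0.
  by rewrite ger0_norm ?mulr_ge0 ?powR_ge0 ?pos_sol_ge0// ler_wpM2r ?pos_sol_ge0// qw.
have bq : Int (fun y => q y * G n r y) <= M2.
  apply: le_trans b2; apply: Int_le => // y.
  have [->|/pos_sol_neq0 /andP[y0 _]] := eqVneq (G n r y) 0; first by rewrite !mulr0.
  by rewrite ler_wpM2r ?pos_sol_ge0// qw.
have q0 : 0 <= Int (fun y => q y * G n r y) by apply: Int_ge0 => y; rewrite mulr_ge0 ?powR_ge0 ?pos_sol_ge0.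
have m0 : 0 <= mass_above n j r by apply: Int_ge0 => y; rewrite mulr_ge0 ?om_ge0 ?pos_sol_ge0.
have pE y : 6 * cf_k1 P * om n j y * G n r y = 6 * cf_k1 P * (om n j y * G n r y) by rewrite mulrA.
have ip : integ (fun y => 6 * cf_k1 P * om n j y * G n r y).
  by apply: integ_eq (integZ (6 * cf_k1 P) io) => y; rewrite pE.
have bp : Int (fun y => 6 * cf_k1 P * om n j y * G n r y) = 6 * cf_k1 P * mass_above n j r.
  by rewrite (Int_eq pE) IntZ.
have mK : meas2 (fun y z => coag_test n.+1%:R (om n j.+1) y z * trunc_A P n y z).
  by apply: meas2_mul; [exact: coag_test_meas|exact: trunc_A_meas].
have KC y z : `|coag_test n.+1%:R (om n j.+1) y z * trunc_A P n y z| <= 3 * n.+1%:R * trunc_A_max P n.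
  rewrite normrM ler_pM//; first exact: coag_test_bound (om_bound n j.+1) y z.
  exact: trunc_A_bound.
have k0 := cf_k1_ge0 P.
have key (Q a p m : R) : 0 <= p -> 0 <= a -> 0 <= m -> a <= M2 -> m <= L ->
    Q <= 2 * (p * m * a) -> 2^-1 * Q <= p * M2 * L.
  move=> p0 a0 m0' aM mL Qle.
  have h : p * m * a <= p * M2 * L.
    by rewrite -!mulrA ler_wpM2l// [m * a]mulrC ler_pM.
  lra.
rewrite /weak_rhs -[leRHS]addr0 lerD//.
  apply: (key _ _ _ _ _ q0 m0 bq bL); first by rewrite mulr_ge0.
  rewrite -bp; apply: (qform_le_prod mK KC (pos_sol_integ P n r) (pos_sol_ge0 P n r) ip iq) => y z.
  by move=> /pos_sol_neq0 yN /pos_sol_neq0 zN; exact: coag_le.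
apply: (le_trans (rhs_frag_le (h := fun=> 0) (om_meas n j.+1) (om_bound n j.+1) _ _)).
- by apply: integ_eq (@integ0 R) => y; rewrite mul0r.
- by move=> y yN; rewrite oppr_le0 mulr_ge0 ?pos_S_ge0// frag_ge0.
- by rewrite (Int_eq (g := fun=> 0)) ?Int0// => y; rewrite mul0r.
Qed.

Let max_cvg (y : R) : Num.max 0 (y - 4 ^+ k.+1) @[k --> \oo] --> (0 : R).
Proof.
apply/cvg_natP => e e0; have [i hi] := halving_decays y ltr01.
exists i => k ik; rewrite subr0 max_l ?normr0 ?(ltW e0)// subr_le0.
move: hi; rewrite ler_pdivrMr ?exprn_gt0// mul1r => /le_trans; apply.
rewrite (@le_trans _ _ (4 ^+ i))//.
  by rewrite lerXn2r ?nnegrE// ler_nat.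
by rewrite ler_weXn2l// ?(leq_trans ik)//; lra.
Qed.

Let init_small (e : R) : 0 < e -> exists k, forall n j, (k <= j)%N -> mass_above n j 0 <= e.
Proof.
move=> e0; have im := init_mass_integ P.
pose h (k : nat) y := Num.max 0 (y - 4 ^+ k.+1) * pos_init P y.
have mh k : measurable_fun setT (h k).
  apply: measurable_funM; last exact: pos_init_meas.
  by apply: measurable_maxr => //; exact: measurable_funB.
have h0 k y : 0 <= h k y by rewrite mulr_ge0 ?pos_init_ge0// le_max lexx.
have hle k y : h k y <= y * pos_init P y.
  rewrite /h; have [y0|y0] := ltP 0 y; last by rewrite /pos_init indic_Rpos ltNge y0 mul0r !mulr0.
  by rewrite ler_wpM2r ?pos_init_ge0// max_le_id// ltW.
have hi k : integ (h k) by apply: integ_le im => // y; rewrite ger0_norm.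
have [||_ c] := @Int_dct R h (fun=> 0) (fun y => y * pos_init P y) mh _ _ im.
- by move=> y; rewrite -[X in _ --> X](mul0r (pos_init P y)); apply: cvgMl; exact: max_cvg.
- by move=> k y; rewrite ger0_norm.
move: c; rewrite Int0 => /cvg_natP /(_ e e0)[k hk]; exists k => n j kj.
have := hk j kj; rewrite subr0 ger0_norm; last exact: Int_ge0.
apply: le_trans; rewrite /mass_above (pos_sol_init P n (om_meas n j) (om_bound n j)).
apply: Int_le => // [|y].
  apply: integ_mulb (om_meas n j) (om_bound n j) _; apply: integ_indic; last exact: pos_init_integ.
  exact: measurable_itv.
rewrite mulrA /h ler_wpM2r ?pos_init_ge0// (@le_trans _ _ (om n j y))//.
by rewrite ler_piMr ?om_ge0// indicE; case: (_ \in _).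
Qed.

Lemma mass_tail T (e : R) : 0 < e -> exists2 l : R, 1 <= l & forall n t, 0 <= t <= T ->
  Int (fun y => \1_(`]l, +oo[) y * (y * G n t y)) <= e.
Proof.
move=> e0; have [M2 M20 hM] := moment2 P T.
(* Admitting all levels j >= k makes the family decrease with k; admitting all n makes the
   conclusion uniform in n. *)
pose F k : set (R -> R) := [set f | exists n j, (k <= j)%N /\ f = mass_above n j].
have leG n j t : 0 <= t -> mass_above n j t <= init_mass P.
  move=> t0; have [i1 b1] := moment1 P n t0; apply: le_trans b1; apply: Int_le => // [|y].
    exact: integ_mulb (om_meas n j) (om_bound n j) (pos_sol_integ P n t).
  have [->|/pos_sol_neq0 /andP[y0 _]] := eqVneq (G n t y) 0; first by rewrite !mulr0.
  by rewrite ler_wpM2r ?pos_sol_ge0// (le_trans (om_le n j y))// max_le_id// ltW.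
have e2 : 0 < e / 2 by rewrite divr_gt0.
have [||||||k hk] := @vanishing_propagation R F T (6 * cf_k1 P * M2) (init_mass P) (fun=> 0) _ _ _ _ _ _ (e / 2) e2.
- by rewrite !mulr_ge0 ?cf_k1_ge0.
- by move=> k f [n [j [kj ->]]]; exists n, j; split => //; exact: ltnW.
- by move=> k f t [n [j [_ ->]]] /andP[t0 _]; exact: leG.
- move=> e' e'0; have [k hk] := init_small e'0; exists k => f [n [j [kj ->]]]; exact: hk.
- by move=> e' e'0; exists 0%N => k _; exact: ltW.
- move=> k f s t L [n [j [kj ->]]] s0 st tT hL.
  case: j kj => // j kj.
  apply: step => // [r|r] /andP[sr rt].
    by apply: hM; rewrite (le_trans s0 sr) (le_trans rt).
  by apply: hL; [exists n, j|rewrite sr rt].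
(* Beyond twice the level, the size is at most twice its excess over the level. *)
exists (2 * 4 ^+ k.+1).
  have : 1 <= 4 ^+ k.+1 :> R by rewrite exprn_ege1//; lra.
  lra.
move=> n t tT; have /andP[t0 _] := tT.
have [i1 _] := moment1 P n t0.
have io := integ_mulb (om_meas n k) (om_bound n k) (pos_sol_integ P n t).
have h : mass_above n k t <= e / 2 by apply: hk => //; exists n, k.
apply: (@le_trans _ _ (2 * mass_above n k t)); last by lra.
rewrite -IntZ//; apply: Int_le => [||y].
- by apply: integ_indic => //; exact: measurable_itv.
- exact: integZ.
have [->|/pos_sol_neq0 yN] := eqVneq (G n t y) 0; first by rewrite !mulr0.
have /andP[y0 _] := yN.
rewrite (om_in _ yN) !mulrA ler_wpM2r ?pos_sol_ge0// indic_itvE in_itv/= andbT.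
have [yl|yl] := ltP (2 * 4 ^+ k.+1) y; last by rewrite mul0r mulr_ge0// le_max lexx.
rewrite mul1r; have : y - 4 ^+ k.+1 <= Num.max 0 (y - 4 ^+ k.+1) by rewrite le_max lexx orbT.
lra.
Qed.

End tails.

(** * Integrals over sets of small measure, for bounded sizes *)

Section equi_integrability_on_bounded_sets.
Variables (R : realType) (P : coag_frag R).
Local Notation mu := (@lebesgue_measure R).
Local Notation beta := (cf_beta P).
Local Notation nu := (cf_nu P).
Local Notation b := (breakage (cf_nu P)).
Local Notation w2 := (weight (- (2 * cf_beta P))).
Local Notation G := (pos_sol P).

Variable l : R.
Hypothesis l_gt0 : 0 < l.

Let V (z : R) : R := \1_(`]0, l[) z * z `^ (nu - beta).

Let V_meas : measurable_fun setT V.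
Proof. by apply: measurable_funM; [exact: measurable_indic|exact: measurable_powR]. Qed.

Let V_ge0 z : 0 <= V z. Proof. by rewrite /V mulr_ge0 ?indicE ?powR_ge0. Qed.

Let nu2 : 0 < nu + 2. Proof. by have := nu_gtN1 P; lra. Qed.

(* The exponent nu - beta is integrable at 0 because nu - 2 beta is, which is
   what the moment bound on the daughter distribution says at z = l. *)
Let V_integ : integ V.
Proof.
have i0 := breakage_int P l; have [i2 _] := breakage_moment P l_gt0.
apply: (integ_le V_meas _ (integZ ((nu + 2)^-1 * l `^ (1 + nu)) (integD i0 i2))) => z.
rewrite ger0_norm// /V indic_itvE in_itv/=.
have [zl|zl] := boolP (0 < z < l); last by rewrite (breakage_supp P zl) !mulr0 addr0 mul0r mulr0.
have /andP[z0 _] := zl; rewrite mul1r /breakage zl.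
have n0 : nu + 2 != 0 by rewrite gt_eqF.
have p0 : l `^ (1 + nu) != 0 by rewrite gt_eqF// powR_gt0.
rewrite powRD; last by apply/implyP => _; rewrite gt_eqF.
rewrite [leRHS](_ : _ = z `^ nu * (1 + z `^ (- (2 * beta)))); last by field; rewrite n0 p0.
rewrite ler_wpM2l ?powR_ge0//.
have -> : z `^ (- (2 * beta)) = z `^ (- beta) * z `^ (- beta).
  by rewrite -powRD; [congr (_ `^ _); ring|apply/implyP => _; rewrite gt_eqF].
have := powR_ge0 z (- beta); move: (z `^ (- beta)) => x x0; nra.
Qed.

(** One integrable density covers both sources on a set E: the initial datum at time 0, and V for
    the fragments produced later. *)
Let W (y : R) : R := V y + w2 y * pos_init P y.

Let Wi_ge0 y : 0 <= w2 y * pos_init P y.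
Proof.
have [y0|y0] := ltP 0 y; first by rewrite mulr_ge0 ?pos_init_ge0// weight_ge0// ltW.
by rewrite /pos_init indic_Rpos ltNge y0 mul0r mulr0.
Qed.

Let W_ge0 y : 0 <= W y. Proof. by rewrite addr_ge0. Qed.

Let W_integ : integ W. Proof. exact: integD V_integ (pos_init_weight P). Qed.

(* All translates of E are small for the density W: coagulation moves E. *)
Let small (k : nat) (E : set R) : Prop := measurable E /\
  forall x, Int (fun y => \1_E (y + x) * W y) <= k.+1%:R^-1.

Let measurable_translate (E : set R) (x : R) : measurable E ->
  measurable ((fun y : R => y + x) @^-1` E).
Proof. by move=> mE; rewrite -[X in measurable X]setTI; exact: measurable_shift. Qed.

Let small_translate k E x : small k E -> small k ((fun y : R => y + x) @^-1` E).
Proof.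
move=> [mE hE]; split; first exact: measurable_translate.
by move=> x'; rewrite (Int_eq (g := fun y => \1_E (y + (x' + x)) * W y))// => y; rewrite addrA.
Qed.

Let small0 k E : small k E -> Int (fun y => \1_E y * W y) <= k.+1%:R^-1.
Proof.
move=> [_ /(_ 0)]; rewrite (Int_eq (g := fun y => \1_E y * W y))// => y.
by rewrite addr0.
Qed.

Let om (E : set R) (m : nat) (y : R) : R :=
  \1_(`]0, l[) y * (\1_E y * Num.min (y `^ (- beta)) m%:R).

Let om_ge0 E m y : 0 <= om E m y.
Proof. by rewrite /om !mulr_ge0 ?indicE// le_min powR_ge0 ler0n. Qed.

Let om_le E m y : om E m y <= \1_(`]0, l[) y * (\1_E y * y `^ (- beta)).
Proof. by rewrite /om !ler_wpM2l ?indicE// ge_min lexx. Qed.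

Let om_bound E m y : `|om E m y| <= m%:R.
Proof.
rewrite ger0_norm ?om_ge0// /om mulrA.
have h : \1_(`]0, l[) y * \1_E y <= 1 :> R.
  by rewrite !indicE; case: (_ \in _); case: (_ \in _); rewrite ?mulr1 ?mulr0 ?mul0r.
rewrite (@le_trans _ _ (Num.min (y `^ (- beta)) m%:R))//; last by rewrite ge_min lexx orbT.
by rewrite ler_piMl// le_min powR_ge0 ler0n.
Qed.

Let om_meas E m : measurable E -> measurable_fun setT (om E m).
Proof.
move=> mE; apply: measurable_funM; first exact: measurable_indic.
apply: measurable_funM; first exact: measurable_indic.
by apply: measurable_minr => //; exact: measurable_powR.
Qed.

Let F n E m (t : R) : R := Int (fun y => om E m y * G n t y).

(** Only the gain counts, and for fixed y it lives on the z in the translate E - y. Since (y +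
    z)^(-beta) <= y^(-beta), the weight adds a second factor y^(-beta) to that of the kernel. The
    new truncation level makes the minimum inactive at z > 1/(n+1), outside of which the kernel
    vanishes. *)
Let coag_le n E m y z : 0 < y < n.+1%:R -> 0 < z < n.+1%:R ->
  coag_test n.+1%:R (om E m) y z * trunc_A P n y z <=
  cf_k1 P * (1 + l) * y `^ (- (2 * beta)) *
  om ((fun x : R => x + y) @^-1` E) (Num.truncn (n.+1%:R^-1 `^ (- beta))).+1 z.
Proof.
move=> /andP[y0 yN] /andP[z0 zN].
set m' := (Num.truncn _).+1; set E' := _ @^-1` E.
have k0 := cf_k1_ge0 P; have A0 := trunc_A_ge0 P n y z.
have kl : 0 <= cf_k1 P * (1 + l) * y `^ (- (2 * beta)).
  by apply: mulr_ge0 (powR_ge0 _ _); apply: mulr_ge0 => //; rewrite addr_ge0// ltW.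
have rge0 : 0 <= cf_k1 P * (1 + l) * y `^ (- (2 * beta)) * om E' m' z by exact: mulr_ge0 kl (om_ge0 _ _ _).
have [/andP[zN1 _]|zN'] := boolP (n.+1%:R^-1 < z < n.+1%:R); last first.
  by rewrite trunc_A_suppr// mulr0.
apply: (@le_trans _ _ (om E m (y + z) * trunc_A P n y z)).
  rewrite ler_wpM2r// /coag_test.
  have h1 := om_ge0 E m y; have h2 := om_ge0 E m z; have h3 := om_ge0 E m (y + z).
  have h4 : \1_(`]0, n.+1%:R[) (y + z) * om E m (y + z) <= om E m (y + z).
    by rewrite ler_piMl// indicE; case: (_ \in _).
  move: h1 h2 h3 h4; move: (om E m y) (om E m z) (om E m (y + z)) (\1_(_) _ * _) => a1 a2 a3 a4.
  lra.
have Ale := le_trans (trunc_A_le P n y z) (pos_A_le P y0 z0).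
have zm' : Num.min (z `^ (- beta)) m'%:R = z `^ (- beta).
  rewrite min_l// ltW// (le_lt_trans _ (truncnS_gt _))//.
  by rewrite powR_anti ?beta_le0 ?invr_gt0// ltW.
have yz0 : 0 < y + z by rewrite addr_gt0.
apply: (@le_trans _ _ (\1_(`]0, l[) (y + z) * (\1_E (y + z) * (y + z) `^ (- beta)) * trunc_A P n y z)).
  by rewrite ler_wpM2r.
rewrite indic_itvE in_itv/= yz0/=; have [yzl|yzl] := ltP (y + z) l; last by rewrite !mul0r.
have zl : z < l by rewrite (lt_trans _ yzl)// ltrDr.
have -> : om E' m' z = \1_E (y + z) * z `^ (- beta).
  rewrite /om zm' indic_itvE in_itv/= z0 zl mul1r addrC !indicE.
  by rewrite (_ : (z \in E') = (z + y \in E))//; apply/idP/idP; rewrite !inE.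
rewrite mul1r; have [Eyz|Eyz] : \1_E (y + z) = 0 :> R \/ \1_E (y + z) = 1 :> R.
  by rewrite indicE; case: (_ \in _); [right|left].
- by rewrite Eyz !mul0r mulr0.
- rewrite Eyz !mul1r.
  have -> : y `^ (- (2 * beta)) = y `^ (- beta) * y `^ (- beta).
    by rewrite -powRD; [congr (_ `^ _); ring|apply/implyP => _; rewrite gt_eqF].
  have h1 : (y + z) `^ (- beta) <= y `^ (- beta) by rewrite powR_anti ?beta_le0// lerDl ltW.
  have yb := powR_ge0 y (- beta); have zb := powR_ge0 z (- beta).
  apply: (@le_trans _ _ (y `^ (- beta) * (cf_k1 P * ((1 + y + z) * (y `^ (- beta) * z `^ (- beta)))))).
    by apply: ler_pM => //; exact: powR_ge0.
  move: (y `^ (- beta)) (z `^ (- beta)) yb zb => a c a0 c0.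
  rewrite (_ : a * _ = cf_k1 P * (a * a * c) * (1 + y + z)); last by ring.
  rewrite (_ : cf_k1 P * (1 + l) * _ * c = cf_k1 P * (a * a * c) * (1 + l)); last by ring.
  by rewrite ler_wpM2l ?mulr_ge0// -addrA lerD2l ltW.
Qed.

(** The bound y^(1 + nu) on S cancels the factor y^(-(1 + nu)) of b: weighted by z^(-beta), the
    fragments have density at most k2 (nu + 2) z^(nu - beta), whatever the size y of the parent. *)
Let frag_le k E m y : small k E -> 0 < y ->
  - (frag_test b (om E m) y * pos_S P y) <= cf_k2 P * (nu + 2) * k.+1%:R^-1.
Proof.
move=> sE y0; have mE := sE.1.
have k0 := cf_k2_ge0 P; have s0 := pos_S_ge0 P y; have sle := pos_S_le P y0.
have ib := integ_breakage_test (breakage_int P) (om_meas m mE) (om_bound E m) y.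
apply: (@le_trans _ _ (pos_S P y * Int (fun z => b z y * om E m z))).
  rewrite -mulNr /frag_test opprB mulrC ler_wpM2l//.
  by rewrite lerBlDr lerDl om_ge0.
rewrite -IntZ//.
apply: (@le_trans _ _ (cf_k2 P * (nu + 2) * Int (fun z => \1_E z * W z))); last first.
  by rewrite ler_wpM2l ?(small0 sE)// mulr_ge0// ltW.
have iW := integ_indic mE W_integ.
rewrite -IntZ//; apply: Int_le => [||z]; [exact: integZ|exact: integZ|].
have c0 : 0 <= cf_k2 P * (nu + 2) by rewrite mulr_ge0// ltW.
have [zy|/breakage_supp ->] := boolP (0 < z < y); last first.
  by rewrite mul0r mulr0 mulr_ge0// mulr_ge0// indicE.
have /andP[z0 _] := zy.
apply: (@le_trans _ _ (cf_k2 P * (nu + 2) * (\1_E z * V z))); last first.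
  by rewrite !ler_wpM2l ?indicE// /W lerDl.
have yn0 : y `^ (1 + nu) != 0 by rewrite gt_eqF// powR_gt0.
apply: (@le_trans _ _ (cf_k2 P * y `^ (1 + nu) * (b z y * (\1_(`]0, l[) z * (\1_E z * z `^ (- beta)))))).
  apply: ler_pM => //; first exact: mulr_ge0 (breakage_ge0 P z y) (om_ge0 E m z).
  by apply: ler_wpM2l; [exact: breakage_ge0|exact: om_le].
rewrite /breakage zy /V powRD; last by apply/implyP => _; rewrite gt_eqF.
rewrite le_eqVlt; apply/orP; left; apply/eqP; field.
by rewrite yn0.
Qed.

(** The gain on E involves the translate of E by each partner size y and another truncation level,
    so L has to bound all sets of the class and all levels at once. Integrating the factor y^(-2
    beta) over the partners costs M2. *)
Let step n k E m s t L M2 : 0 <= M2 -> 0 <= s -> s <= t -> small k E ->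
  (forall r, s <= r <= t -> integ (fun y => w2 y * G n r y) /\ Int (fun y => w2 y * G n r y) <= M2) ->
  (forall E' m' r, small k E' -> s <= r <= t -> F n E' m' r <= L) ->
  F n E m t <= F n E m s + (t - s) *
    (cf_k1 P * (1 + l) * M2 * L + cf_k2 P * (nu + 2) * M2 * k.+1%:R^-1).
Proof.
move=> M20 s0 st sE hM hL; have mE := sE.1.
apply: (pos_sol_growth (om_meas m mE) (om_bound E m)) => // r srt.
have [i2 b2] := hM r srt; have k0 := cf_k1_ge0 P.
have Gi := pos_sol_integ P n r; have G0 := pos_sol_ge0 P n r.
set m' := (Num.truncn (n.+1%:R^-1 `^ (- beta))).+1.
have L0 : 0 <= L.
  by apply: (le_trans _ (hL E m r sE srt)); apply: Int_ge0 => y; rewrite mulr_ge0 ?om_ge0.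
have kl : 0 <= cf_k1 P * (1 + l) by rewrite mulr_ge0// addr_ge0// ltW.
have mK : meas2 (fun y z => coag_test n.+1%:R (om E m) y z * trunc_A P n y z).
  by apply: meas2_mul; [exact: (coag_test_meas _ (om_meas m mE))|exact: trunc_A_meas].
have KC y z : `|coag_test n.+1%:R (om E m) y z * trunc_A P n y z| <= 3 * m%:R * trunc_A_max P n.
  rewrite normrM ler_pM//; first exact: coag_test_bound (om_bound E m) y z.
  exact: trunc_A_bound.
have p2w y : 0 < y -> y `^ (- (2 * beta)) <= w2 y by move=> y0; rewrite lerDl ltW.
have ip : integ (fun y => y `^ (- (2 * beta)) * G n r y).
  apply: integ_le i2 => [|y].
    by apply: measurable_funM; [exact: measurable_powR|exact: integ_meas Gi].
  have [->|/pos_sol_neq0 /andP[y0 _]] := eqVneq (G n r y) 0; first by rewrite !mulr0 normr0.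
  by rewrite ger0_norm ?mulr_ge0 ?powR_ge0// ler_wpM2r// p2w.
have bp : Int (fun y => y `^ (- (2 * beta)) * G n r y) <= M2.
  apply: le_trans b2; apply: Int_le => // y.
  have [->|/pos_sol_neq0 /andP[y0 _]] := eqVneq (G n r y) 0; first by rewrite !mulr0.
  by rewrite ler_wpM2r// p2w.
have bG : Int (G n r) <= M2.
  apply: le_trans b2; apply: Int_le => // y.
  have [->|/pos_sol_neq0 /andP[y0 _]] := eqVneq (G n r y) 0; first by rewrite !mulr0.
  by rewrite ler_peMl// le1_weight// beta2_le0.
pose c := cf_k1 P * (1 + l) * L.
have c0 : 0 <= c by exact: mulr_ge0.
have hE y : c * y `^ (- (2 * beta)) * G n r y = c * (y `^ (- (2 * beta)) * G n r y) by rewrite mulrA.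
have ih : integ (fun y => c * y `^ (- (2 * beta)) * G n r y).
  by apply: integ_eq (integZ c ip) => y; rewrite hE.
have Q : qform (fun y z => coag_test n.+1%:R (om E m) y z * trunc_A P n y z) (G n r) <= c * M2.
  apply: (@le_trans _ _ (Int (fun y => c * y `^ (- (2 * beta)) * G n r y))); last first.
    by rewrite (Int_eq hE) IntZ// ler_wpM2l.
  apply: (qform_le mK KC Gi G0 ih) => y /pos_sol_neq0 yN.
  pose E' := (fun x : R => x + y) @^-1` E; have sE' : small k E' by exact: small_translate.
  have io := integ_mulb (om_meas m' sE'.1) (om_bound E' m') Gi.
  apply: (@le_trans _ _ (cf_k1 P * (1 + l) * y `^ (- (2 * beta)) * F n E' m' r)); last first.
    rewrite /c (_ : _ * L * _ = cf_k1 P * (1 + l) * y `^ (- (2 * beta)) * L); last by ring.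
    by rewrite ler_wpM2l ?hL// mulr_ge0 ?powR_ge0.
  rewrite -IntZ//; apply: Int_le => [||z]; [exact: integ_row mK KC Gi y|exact: integZ|].
  have [->|/pos_sol_neq0 zN] := eqVneq (G n r z) 0; first by rewrite !mulr0.
  by rewrite [leRHS]mulrA ler_wpM2r// coag_le.
have key (q M x y : R) : 0 <= x -> 0 <= M -> q <= x * y * M -> 0 <= y -> 2^-1 * q <= x * M * y.
  move=> x0 M0 qle y0; have h : 0 <= x * y * M by rewrite !mulr_ge0.
  lra.
rewrite /weak_rhs lerD//; first exact: key Q _.
pose d := cf_k2 P * (nu + 2) * k.+1%:R^-1.
have d0 : 0 <= d by rewrite !mulr_ge0 ?cf_k2_ge0 ?invr_ge0// ltW.
have id : integ (fun y => (fun=> d) y * G n r y) by exact: integZ.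
apply: (le_trans (rhs_frag_le (om_meas m mE) (om_bound E m) id _)).
  by move=> y /andP[y0 _]; exact: frag_le.
rewrite IntZ// (_ : cf_k2 P * (nu + 2) * M2 * k.+1%:R^-1 = d * M2); last by rewrite /d; ring.
by rewrite ler_wpM2l.
Qed.

(** Lebesgue measure is translation invariant, so absolute continuity of the integral of W makes
    every translate of a set of small measure small with the same d. The truncation at m is then
    removed by Fatou's lemma. *)
Lemma small_sets T (e : R) : 0 < e -> exists2 d : R, 0 < d & forall E : set R,
  measurable E -> (mu E <= d%:E)%E -> forall n t, 0 <= t <= T ->
  integ (fun y => \1_(`]0, l[) y * (\1_E y * (y `^ (- beta) * G n t y))) /\
  Int (fun y => \1_(`]0, l[) y * (\1_E y * (y `^ (- beta) * G n t y))) <= e.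
Proof.
move=> e0; have [M2 M20 hM] := moment2 P T.
pose FF k : set (R -> R) := [set f | exists n E m, small k E /\ f = F n E m].
have pw y : 0 < y -> y `^ (- beta) <= w2 y.
  by move=> y0; apply: powR_le_weight => //; have := beta_ge0 P; lra.
have FM n E m t : measurable E -> 0 <= t <= T -> F n E m t <= M2.
  move=> mE tT; have [i2 b2] := hM n t tT; apply: le_trans b2; apply: Int_le => // [|y].
    exact: integ_mulb (om_meas m mE) (om_bound E m) (pos_sol_integ P n t).
  have [->|/pos_sol_neq0 /andP[y0 _]] := eqVneq (G n t y) 0; first by rewrite !mulr0.
  rewrite ler_wpM2r ?pos_sol_ge0// (le_trans (om_le E m y))// (le_trans _ (pw y y0))// mulrA.
  rewrite ler_piMl ?powR_ge0// !indicE; case: (_ \in _); case: (_ \in _); by rewrite ?mulr1 ?mulr0 ?mul0r.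
have kinv k : k.+2%:R^-1 <= k.+1%:R^-1 :> R by rewrite lef_pV2 ?posrE// ler_nat.
have smallS k E : small k.+1 E -> small k E.
  by move=> [mE hE]; split => // x; exact: le_trans (hE x) (kinv k).
have [||||||k hk] := @vanishing_propagation R FF T (cf_k1 P * (1 + l) * M2) M2
    (fun k => cf_k2 P * (nu + 2) * M2 * k.+1%:R^-1) _ _ _ _ _ _ e e0.
- by rewrite !mulr_ge0 ?cf_k1_ge0// addr_ge0// ltW.
- by move=> k f [n [E [m [sE ->]]]]; exists n, E, m; split => //; exact: smallS.
- by move=> k f t [n [E [m [[mE _] ->]]]]; exact: FM.
- move=> e' e'0; exists (Num.truncn e'^-1) => f [n [E [m [sE ->]]]].
  have mE := sE.1.
  apply: (@le_trans _ _ (Num.truncn e'^-1).+1%:R^-1); last first.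
    by rewrite -[leRHS]invrK lef_pV2 ?posrE ?invr_gt0// ltW// truncnS_gt.
  apply: le_trans (small0 sE); rewrite /F (pos_sol_init P n (om_meas m mE) (om_bound E m)).
  have mN : measurable (`]0, n.+1%:R[ : set R) by exact: measurable_itv.
  apply: Int_le => [||y].
  + exact: integ_mulb (om_meas m mE) (om_bound E m) (integ_indic mN (pos_init_integ P)).
  + exact: integ_indic mE W_integ.
  have [y0|y0] := ltP 0 y; last first.
    rewrite [X in _ * (_ * X)](_ : _ = 0) ?mulr0; first by rewrite mulr_ge0// indicE.
    by rewrite /pos_init indic_Rpos ltNge y0 mul0r.
  apply: (@le_trans _ _ (om E m y * pos_init P y)).
    by rewrite ler_wpM2l// ler_piMl ?pos_init_ge0// indicE; case: (_ \in _).
  apply: (@le_trans _ _ (\1_E y * (w2 y * pos_init P y))); last first.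
    by rewrite ler_wpM2l ?indicE// /W lerDr.
  rewrite [leRHS]mulrA ler_wpM2r ?pos_init_ge0// (le_trans (om_le E m y))//.
  apply: (@le_trans _ _ (\1_E y * y `^ (- beta))).
    by rewrite ler_piMl ?mulr_ge0 ?indicE ?powR_ge0//; case: (_ \in _).
  by rewrite ler_wpM2l ?indicE// pw.
- move=> e' e'0; pose c := cf_k2 P * (nu + 2) * M2.
  have c0 : 0 <= c by rewrite !mulr_ge0 ?cf_k2_ge0// ltW.
  exists (Num.truncn (c / e')) => k hk.
  have h : c / e' < k.+1%:R by rewrite (lt_le_trans (truncnS_gt _))// ler_nat ltnS.
  by rewrite -/c ler_pdivrMr// mulrC -ler_pdivrMr// ltW.
- move=> k f s t L [n [E [m [sE ->]]]] s0 st tT hL.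
  apply: step => // [|r /andP[sr rt]|E' m' r sE' srt].
  + exact: smallS.
  + by apply: hM; rewrite (le_trans s0 sr) (le_trans rt).
  + by apply: hL => //; exists n, E', m'.
have k1 : 0 < k.+1%:R^-1 :> R by rewrite invr_gt0.
have [d d0 hd] := Int_abs_cont W_integ k1.
exists d => // E mE Ed n t tT.
have sE : small k E.
  split => // x; have mEx := measurable_translate x mE.
  have := hd _ mEx; have -> : mu ((fun y : R => y + x) @^-1` E) = mu E.
    exact: lebesgue_measure_shift.
  move=> /(_ Ed); rewrite (Int_eq (g := fun y => \1_E (y + x) * W y))// => y.
  by rewrite ger0_norm.
apply: (@integ_fatou R (fun m y => om E m y * G n t y)) => [m|m y|y|m].
- exact: integ_mulb (om_meas m mE) (om_bound E m) (pos_sol_integ P n t).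
- by rewrite mulr_ge0 ?om_ge0 ?pos_sol_ge0.
- rewrite !mulrA; apply: cvgMl; rewrite -mulrA; rewrite /om; apply: cvgMr; apply: cvgMr.
  apply/cvg_natP => e' e'0; exists (Num.truncn (y `^ (- beta))).+1 => m hm.
  rewrite min_l ?subrr ?normr0 ?(ltW e'0)// ltW// (lt_le_trans (truncnS_gt _))// ler_nat//.
- by apply: (hk (F n E m)) => //; exists n, E, m.
Qed.

End equi_integrability_on_bounded_sets.

(** * Compactness properties of the weighted solutions *)

Section weighted_solution.
Variables (R : realType) (P : coag_frag R).
Local Notation mu := (@lebesgue_measure R).
Local Notation beta := (cf_beta P).
Local Notation nu := (cf_nu P).
Local Notation b := (breakage (cf_nu P)).
Local Notation w1 := (weight (- cf_beta P)).
Local Notation w2 := (weight (- (2 * cf_beta P))).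
Local Notation G := (pos_sol P).
Local Notation D n r om :=
  (weak_rhs (trunc_A P n) b (trunc_S P n) (pos_sol P n r) n.+1%:R om).

(** 1 + y + z <= (1 + y)(1 + z) separates the variables, and (1 + x) x^(-beta) is at most twice the
    weight. The order -2 beta is used for the uniform bounds, the order -beta for the limit. *)
Lemma pos_A_le_weight a y z : a <= - beta -> 0 < y -> 0 < z ->
  pos_A P y z <= 4 * cf_k1 P * (weight a y * weight a z).
Proof.
move=> ab y0 z0; apply: (le_trans (pos_A_le P y0 z0)).
have b0 := beta_ge0 P; have b1 := beta_lt1 P.
have h (x : R) : 0 < x -> 0 <= (1 + x) * x `^ (- beta) <= 2 * weight a x.
  move=> x0; rewrite mulr_ge0 ?powR_ge0 ?addr_ge0 ?(ltW x0)//=.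
  have e1 : x `^ (- beta) <= weight a x by apply: powR_le_weight => //; lra.
  have e2 : x * x `^ (- beta) <= weight a x.
    rewrite -{1}(powRr1 (ltW x0)) -powRD; last by apply/implyP => _; rewrite gt_eqF.
    by apply: powR_le_weight => //; lra.
  by rewrite mulrDl mul1r mulr_natl mulr2n lerD.
have /andP[y1 y2] := h y y0; have /andP[z1 z2] := h z z0.
have k0 := cf_k1_ge0 P.
rewrite (_ : 4 * cf_k1 P * _ = cf_k1 P * ((2 * weight a y) * (2 * weight a z))); last by ring.
rewrite ler_wpM2l//; apply: (le_trans _ (ler_pM y1 z1 y2 z2)).
rewrite (_ : _ * _ * (_ * _) = (1 + y) * (1 + z) * (y `^ (- beta) * z `^ (- beta))); last by ring.
rewrite ler_wpM2r ?mulr_ge0 ?powR_ge0//.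
by have : 0 <= y * z by [rewrite mulr_ge0 ?ltW]; lra.
Qed.

Lemma pos_S_le_weight a y : a <= 0 -> 0 < y -> pos_S P y <= cf_k2 P * weight a y.
Proof.
move=> a0 y0; apply: (le_trans (pos_S_le P y0)); rewrite ler_wpM2l ?cf_k2_ge0//.
have n1 := nu_gtN1 P; have n0 := nu_le0 P.
by apply: powR_le_weight => //; lra.
Qed.

(** Uniform in n and linear in the bound C of the test function: it gives the Lipschitz estimate in
    time and later the domination for the passage to the limit under the time integral. *)
Lemma rhs_bound T : exists2 L : R, 0 <= L & forall (om : R -> R) C n r,
  measurable_fun setT om -> (forall y, `|om y| <= C) -> 0 <= r <= T -> `|D n r om| <= C * L.
Proof.
have [M2 M20 hM] := moment2 P T.
have k10 := cf_k1_ge0 P; have k20 := cf_k2_ge0 P; have c0 := c1_ge0 P.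
exists (2^-1 * (3 * (4 * cf_k1 P) * (M2 * M2)) + (1 + cf_c1 P) * cf_k2 P * M2).
  by rewrite !addr_ge0 ?mulr_ge0 ?invr_ge0 ?addr_ge0.
move=> om C n r mom omC rT; have C0 := le_trans (normr_ge0 _) (omC 0).
have [i2 b2] := hM n r rT.
have Gi := pos_sol_integ P n r; have G0 := pos_sol_ge0 P n r.
have J0 : 0 <= Int (fun y => w2 y * G n r y).
  apply: Int_ge0 => y; have [->|/pos_sol_neq0 /andP[y0 _]] := eqVneq (G n r y) 0; first by rewrite mulr0.
  by rewrite mulr_ge0// weight_ge0// ltW.
set K := fun y z => coag_test n.+1%:R om y z * trunc_A P n y z.
have mK : meas2 K by apply: meas2_mul; [exact: coag_test_meas|exact: trunc_A_meas].
have KC y z : `|K y z| <= 3 * C * trunc_A_max P n.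
  rewrite normrM ler_pM//; first exact: coag_test_bound.
  exact: trunc_A_bound.
pose a := 3 * C * (4 * cf_k1 P).
have a0 : 0 <= a by rewrite !mulr_ge0.
have Ka y z : G n r y != 0 -> G n r z != 0 -> `|K y z| <= a * (w2 y * w2 z).
  move=> /pos_sol_neq0 /andP[y0 _] /pos_sol_neq0 /andP[z0 _].
  rewrite normrM /a -mulrA ler_pM//; first exact: coag_test_bound.
  rewrite ger0_norm ?trunc_A_ge0// (le_trans (trunc_A_le _ _ _ _))//.
  by apply: pos_A_le_weight => //; have := beta_ge0 P; lra.
(* Half of [a], because [qform_le_prod] adds two symmetric products. *)
have pE y : 2^-1 * a * w2 y * G n r y = 2^-1 * a * (w2 y * G n r y) by rewrite -[LHS]mulrA.
have ip : integ (fun y => 2^-1 * a * w2 y * G n r y).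
  by apply: integ_eq (integZ (2^-1 * a) i2) => y; rewrite pE.
have Q (K' : R -> R -> R) : meas2 K' -> (forall y z, `|K' y z| <= 3 * C * trunc_A_max P n) ->
    (forall y z, G n r y != 0 -> G n r z != 0 -> K' y z <= a * (w2 y * w2 z)) ->
    qform K' (G n r) <= a * (M2 * M2).
  move=> mK' KC' Ka'; have := qform_le_prod mK' KC' Gi G0 ip i2.
  rewrite (Int_eq pE) IntZ// => h.
  apply: (le_trans (h _)) => [y z fy fz|].
    by rewrite [leRHS](_ : _ = a * (w2 y * w2 z)) ?Ka'//; field.
  rewrite [leLHS](_ : _ = a * (Int (fun y => w2 y * G n r y) * Int (fun y => w2 y * G n r y))); last by field.
  by rewrite ler_wpM2l// ler_pM.
have Qabs : `|qform K (G n r)| <= a * (M2 * M2).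
  rewrite ler_norml; apply/andP; split; last first.
    by apply: Q => // y z fy fz; rewrite (le_trans (ler_norm _))// Ka.
  rewrite lerNl -(qformN mK KC Gi); apply: Q => [|y z|y z fy fz].
  - exact: meas2_opp.
  - by rewrite normrN.
  - by rewrite (le_trans (ler_norm _))// normrN Ka.
have Fabs : `|Int (fun y => frag_test b om y * trunc_S P n y * G n r y)| <= C * (1 + cf_c1 P) * cf_k2 P * M2.
  have ms : measurable_fun setT (fun y => frag_test b om y * trunc_S P n y).
    by apply: measurable_funM; [exact: (frag_test_meas (breakage_meas P) mom)|exact: trunc_S_meas].
  have fC y : `|frag_test b om y| <= C * (1 + cf_c1 P).
    exact: (frag_test_bound (breakage_ge0 P) (breakage_int P) (breakage_int_le P) mom omC).
  have fsC y : `|frag_test b om y * trunc_S P n y| <=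
      C * (1 + cf_c1 P) * (cf_k2 P * n.+1%:R `^ (1 + nu)).
    by rewrite normrM ler_pM//; exact: trunc_S_bound.
  have i := integ_mulb ms fsC Gi.
  apply: (le_trans (Int_abs i)).
  have cc : 0 <= C * (1 + cf_c1 P) * cf_k2 P by rewrite !mulr_ge0// addr_ge0.
  apply: (@le_trans _ _ (C * (1 + cf_c1 P) * cf_k2 P * Int (fun y => w2 y * G n r y))); last first.
    by rewrite ler_wpM2l.
  rewrite -IntZ//; apply: Int_le => [||y]; [exact: integ_abs|exact: integZ|].
  have [->|/pos_sol_neq0 /andP[y0 _]] := eqVneq (G n r y) 0; first by rewrite !mulr0 normr0.
  rewrite normrM [`|frag_test b om y * _|]normrM (ger0_norm (G0 y)) [leRHS]mulrA ler_wpM2r// -[leRHS]mulrA ler_pM//.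
  by rewrite ger0_norm ?trunc_S_ge0// (le_trans (trunc_S_le _ _ _))// pos_S_le_weight// beta2_le0.
rewrite /weak_rhs (le_trans (ler_normB _ _))// normrM ger0_norm ?invr_ge0//.
rewrite -/K mulrDr lerD//; last by rewrite (le_trans Fabs)// !mulrA.
rewrite (_ : C * _ = 2^-1 * (a * (M2 * M2))); last by rewrite /a; ring.
by rewrite ler_wpM2l ?invr_ge0.
Qed.

(** The growth estimate is one-sided; it is applied to [om] and to its opposite. *)
Lemma pos_sol_lipschitz T : exists2 L : R, 0 <= L & forall (om : R -> R) C n s t,
  measurable_fun setT om -> (forall y, `|om y| <= C) -> 0 <= s <= T -> 0 <= t <= T ->
  `|Int (fun y => om y * G n t y) - Int (fun y => om y * G n s y)| <= `|t - s| * (C * L).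
Proof.
have [L L0 hL] := rhs_bound T; exists L => // om C n s t mom omC.
wlog st : s t / s <= t.
  move=> h sT tT; have [st|/ltW ts] := leP s t; first exact: h.
  by rewrite distrC [`|t - s|]distrC; exact: h.
move=> /andP[s0 sT] /andP[t0 tT].
have up (o : R -> R) : measurable_fun setT o -> (forall y, `|o y| <= C) ->
    Int (fun y => o y * G n t y) - Int (fun y => o y * G n s y) <= (t - s) * (C * L).
  move=> mo oC; rewrite lerBlDl; apply: (pos_sol_growth mo oC) => // r /andP[sr rt].
  by rewrite (le_trans (ler_norm _))// hL// (le_trans s0 sr) (le_trans rt).
rewrite [`|t - s|]ger0_norm ?subr_ge0// ler_norml up// andbT lerNl opprB.
have NI r : Int (fun y => - om y * G n r y) = - Int (fun y => om y * G n r y).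
  have i := integ_mulb mom omC (pos_sol_integ P n r).
  by rewrite -IntN//; apply: Int_eq => y; rewrite mulNr.
have mN : measurable_fun setT (fun y => - om y) by exact: measurableT_comp.
have NC y : `|- om y| <= C by rewrite normrN.
have := up _ mN NC; rewrite !NI.
by move: (Int _) (Int _) => x1 x2; lra.
Qed.

Definition wsol n t y : R := w1 y * G n t y.

Lemma wsol_ge0 n t y : 0 <= wsol n t y.
Proof.
have [y0|y0] := ltP 0 y; first by rewrite mulr_ge0 ?pos_sol_ge0// weight_ge0// ltW.
by rewrite /wsol pos_sol_supp ?mulr0// ltNge y0.
Qed.

Lemma weight_half y : 0 < y -> w1 y <= 2 * w2 y.
Proof.
move=> y0; have b0 := beta_ge0 P.
have e1 : y `^ (- beta) <= w2 y by apply: powR_le_weight => //; lra.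
have e2 : y <= w2 y by rewrite lerDr powR_ge0.
by rewrite /weight -/(weight (- (2 * beta)) y) mulr_natl mulr2n lerD.
Qed.

Lemma wsol_meas n t : measurable_fun setT (wsol n t).
Proof. by apply: measurable_funM; [exact: measurable_weight|exact: integ_meas (pos_sol_integ P n t)]. Qed.

Lemma wsol_bound T : exists2 B : R, 0 <= B & forall n t, 0 <= t <= T ->
  integ (wsol n t) /\ Int (wsol n t) <= B.
Proof.
have [M2 M20 hM] := moment2 P T; exists (2 * M2); first by rewrite mulr_ge0.
move=> n t tT; have [i2 b2] := hM n t tT.
have le y : wsol n t y <= 2 * (w2 y * G n t y).
  rewrite /wsol; have [->|/pos_sol_neq0 /andP[y0 _]] := eqVneq (G n t y) 0; first by rewrite !mulr0.
  by rewrite mulrA ler_wpM2r ?pos_sol_ge0// weight_half.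
have i : integ (wsol n t).
  by apply: integ_le (integZ 2 i2) => [|y]; [exact: wsol_meas|rewrite ger0_norm ?wsol_ge0].
by split => //; rewrite (le_trans (Int_le i (integZ 2 i2) le))// IntZ// ler_wpM2l.
Qed.

Lemma wsol_integ n t : 0 <= t -> integ (wsol n t).
Proof. by move=> t0; have [B _ hB] := wsol_bound t; have [] := hB n t; rewrite ?t0 ?lexx. Qed.

(** Sizes below l + 1 are handled by [small_sets] and sizes from l + 1 on by [mass_tail], where the
    weight is at most 2y. *)
Lemma wsol_equi_integrable T :
  equi_integrable [set f | exists n t, 0 <= t <= T /\ f = wsol n t].
Proof.
move=> E mE Edec Eempty e e0.
have e4 : 0 < e / 4 by rewrite divr_gt0.
have [l l1 tail] := mass_tail P T e4.
have l0 : 0 < l + 1 by lra.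
(* On (0, l + 1) the weight is at most C times y^(-beta). *)
pose C := 1 + (l + 1) * (l + 1) `^ beta.
have C0 : 0 < C by rewrite ltr_wpDr// mulr_ge0 ?powR_ge0// ltW.
have eC : 0 < e / 2 / C by rewrite !divr_gt0.
have [d d0 small] := small_sets P l0 T eC.
pose J : set R := `]0, (l + 1)[%classic.
have mI : measurable J by exact: measurable_itv.
have mJ : measurable (`]l, +oo[ : set R) by exact: measurable_itv.
have JE y : \1_J y = (0 < y < l + 1)%R%:R :> R by rewrite indic_itvE in_itv.
(* Intersecting with a bounded interval gives finite measure, without which decreasing sets with
   empty intersection need not have vanishing measure. *)
have [N hN] : exists N, (mu (E N `&` J) <= d%:E)%E.
  have mEI k : measurable (E k `&` J) by exact: measurableI.
  have fin : (mu (E 0%N `&` J) < +oo)%E.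
    apply: (@le_lt_trans _ _ (mu J)); last first.
      by rewrite lebesgue_measure_itv/= lte_fin l0 sube0 ltry.
    by apply: le_measure; [exact: mem_set (mEI 0%N)|exact: mem_set mI|exact: subIsetr].
  have dec : nonincreasing_seq (fun k => E k `&` J).
    by apply/nonincreasing_seqP => k; apply/subsetPset; apply: setSI; exact: Edec.
  have cap0 : \bigcap_k (E k `&` J) = set0.
    apply/seteqP; split => // x h; have [k nk] := Eempty x.
    by apply: nk; have [] := h k I.
  have := @nonincreasing_cvg_mu _ _ _ mu (fun k => E k `&` J) fin mEI.
  rewrite cap0 measure0 => /(_ measurable0 dec) c.
  have d0' : (0 < d%:E)%E by rewrite lte_fin.
  by have [k _ hk] := c _ (open_ereal_lt' d0'); exists k; apply: ltW; exact: hk (leqnn k).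
exists N => _ [n [t [tT ->]]].
have /andP[t0 _] := tT.
have mEN : measurable (E N `&` J) by exact: measurableI.
have [is_ bs] := small _ mEN hN n t tT.
have [i1 _] := moment1 P n t0.
have bt := tail n t tT.
have it : integ (fun y => \1_(`]l, +oo[) y * (y * G n t y)) by exact: integ_indic.
pose f1 y := \1_J y * (\1_(E N `&` J) y * (y `^ (- beta) * G n t y)).
pose f2 y := \1_(`]l, +oo[) y * (y * G n t y).
have key : Int (fun x => \1_(E N) x * wsol n t x) <= Int (fun y => C * f1 y + 2 * f2 y).
  apply: Int_le => [||y].
  - exact: integ_indic (wsol_integ n t0).
  - by apply: integD; exact: integZ.
  rewrite /f1 /f2 /wsol; have [->|/pos_sol_neq0 /andP[y0 _]] := eqVneq (G n t y) 0.
    by rewrite !mulr0 addr0.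
  have G0 := pos_sol_ge0 P n t y.
  have pb := powR_ge0 y (- beta).
  have [Ey|Ey] := boolP (y \in E N); last first.
    rewrite indicE (negbTE Ey) mul0r.
    by apply: addr_ge0; rewrite !mulr_ge0 ?indicE ?(ltW y0) ?(ltW C0).
  rewrite [\1_(E N) y]indicE [\1_(_ `&` _) y]indicE in_setI Ey mul1r /=.
  rewrite -[((y \in J) : nat)%:R]indicE JE indic_itvE in_itv/= y0 andbT/=.
  have [yl|yl] := ltP y (l + 1).
    rewrite !mul1r -[leLHS]addr0 lerD//; last by rewrite !mulr_ge0// ltW.
    rewrite mulrA ler_wpM2r// /weight /C mulrDl mul1r lerD2l.
    have yE : y = y * y `^ beta * y `^ (- beta).
      rewrite -mulrA -powRD ?subrr ?powRr0 ?mulr1//.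
      by apply/implyP => _; rewrite gt_eqF.
    rewrite {1}yE ler_wpM2r// ler_pM ?powR_ge0 ?(ltW y0) ?(ltW yl)//.
    by rewrite ge0_ler_powR ?nnegrE ?beta_ge0// ltW.
  rewrite !mul0r mulr0 add0r (lt_le_trans _ yl) ?ltrDl// mul1r mulrA ler_wpM2r//.
  have y1 : 1 <= y by lra.
  have : y `^ (- beta) <= 1 by rewrite powR_le1 ?beta_le0.
  by rewrite /weight; lra.
apply: (le_trans key); rewrite IntD; [|exact: integZ..].
rewrite !IntZ//.
have bs' : C * Int f1 <= e / 2 by rewrite mulrC -ler_pdivlMr.
have bt' : Int f2 <= e / 4 by [].
by move: bs' bt'; move: (Int f1) (Int f2) => x1 x2; lra.
Qed.

Let slab (k : nat) : set R := [set y | 0 < y <= k.+1%:R^-1 \/ k.+1%:R <= y].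

Let slab_meas k : measurable (slab k).
Proof.
have -> : slab k = `]0, k.+1%:R^-1] `|` `[k.+1%:R, +oo[.
  by apply/seteqP; split => y /=; rewrite !in_itv/= andbT.
by apply: measurableU; exact: measurable_itv.
Qed.

(** The product of [om] and the weight is an unbounded test function. It is cut to (1/N, N), where
    the Lipschitz estimate applies; the rest lives on the slabs, which decrease to a set of
    nonpositive sizes cut off as well, so equi-integrability makes it small for all n and t. *)
Lemma wsol_equicontinuous (om : R -> R) (C T : R) : measurable_fun setT om ->
  (forall y, `|om y| <= C) -> forall e : R, 0 < e -> exists2 d : R, 0 < d &
    forall n s t, 0 <= s <= T -> 0 <= t <= T -> `|t - s| <= d ->
    `|Int (fun y => om y * wsol n t y) - Int (fun y => om y * wsol n s y)| <= e.
Proof.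
move=> mom omC e e0; have C0 := le_trans (normr_ge0 _) (omC 0).
have C1 : 0 < C + 1 by lra.
have e4 : 0 < e / 4 / (C + 1) by rewrite !divr_gt0.
have slab_dec k : slab k.+1 `<=` slab k.
  have h1 : k.+2%:R^-1 <= k.+1%:R^-1 :> R by rewrite lef_pV2 ?posrE// ler_nat.
  have h2 : k.+1%:R <= k.+2%:R :> R by rewrite ler_nat.
  move=> y /= [/andP[y0 y1]|y1]; [left; rewrite y0; exact: le_trans h1|right].
  exact: le_trans y1.
have slab_empty (y : R) : exists k, ~ slab k y.
  have [y0|y0] := ltP 0 y; last first.
    by exists 0%N => /= -[/andP[h _]|h]; [move: h; rewrite ltNge y0|have := le_trans h y0; rewrite lern0].
  exists (maxn (Num.truncn y) (Num.truncn y^-1)) => /=.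
  set k := maxn _ _.
  have h1 : y < k.+1%:R by rewrite (lt_le_trans (truncnS_gt _))// ler_nat ltnS leq_maxl.
  have h2 : y^-1 < k.+1%:R by rewrite (lt_le_trans (truncnS_gt _))// ler_nat ltnS leq_maxr.
  move=> [/andP[_ h]|h]; last by move: h1; rewrite ltNge h.
  have : k.+1%:R <= y^-1 by rewrite -[leLHS]invrK lef_pV2 ?posrE ?invr_gt0.
  by rewrite leNgt h2.
have [k hk] := @wsol_equi_integrable T _ slab_meas slab_dec slab_empty _ e4.
pose N : R := k.+1%:R.
have N0 : 0 < N by [].
pose I : set R := `]N^-1, N[%classic.
have mI : measurable I by exact: measurable_itv.
pose h y := \1_I y * (om y * w1 y).
have mh : measurable_fun setT h.
  apply: measurable_funM; first exact: measurable_indic.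
  by apply: measurable_funM => //; exact: measurable_weight.
pose C' := C * (N^-1 `^ (- beta) + N).
have hC y : `|h y| <= C'.
  have C'0 : 0 <= C' by rewrite mulr_ge0// addr_ge0 ?powR_ge0// ltW.
  rewrite /h indic_itvE in_itv/=; have [/andP[y0 yN]|_] := boolP (N^-1 < y < N); last by rewrite mul0r normr0.
  have iN : 0 < N^-1 by rewrite invr_gt0.
  have y00 := lt_trans iN y0.
  rewrite mul1r normrM ler_pM// ger0_norm ?weight_ge0 ?(ltW y00)//.
  by rewrite /weight lerD ?(ltW yN)// powR_anti ?beta_le0// ltW.
have [L L0 hL] := pos_sol_lipschitz T.
have CL0 : 0 <= C' * L by rewrite mulr_ge0// (le_trans (normr_ge0 _) (hC 0)).
have CL : 0 < 2 * (C' * L + 1) by move: (C' * L) CL0 => c; lra.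
exists (e / (2 * (C' * L + 1))); first by rewrite divr_gt0.
move=> n s t sT tT std.
have main r : 0 <= r <= T ->
    `|Int (fun y => om y * wsol n r y) - Int (fun y => h y * G n r y)| <= e / 4.
  move=> rT; have /andP[r0 _] := rT.
  have i1 := integ_mulb mom omC (wsol_integ n r0).
  have i2 := integ_mulb mh hC (pos_sol_integ P n r).
  have i3 := integ_indic (slab_meas k) (wsol_integ n r0).
  have e3 := IntB i1 i2; rewrite -e3; apply: (le_trans (Int_abs (integB i1 i2))).
  apply: (@le_trans _ _ (Int (fun y => C * (\1_(slab k) y * wsol n r y)))).
    apply: Int_le => [||y]; [exact/integ_abs/integB|exact: integZ|].
    rewrite /h /wsol; have [->|/pos_sol_neq0 /andP[y0 _]] := eqVneq (G n r y) 0.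
      by rewrite !mulr0 subrr normr0.
    have wG : 0 <= w1 y * G n r y by rewrite mulr_ge0 ?pos_sol_ge0// weight_ge0// ltW.
    rewrite mulrA -mulrBl -{1}[om y * w1 y]mul1r -mulrBl indic_itvE in_itv/=.
    have [/andP[yN1 yN2]|yN] := boolP (N^-1 < y < N).
      by rewrite subrr !mul0r normr0 mulr_ge0// mulr_ge0// indicE.
    have -> : \1_(slab k) y = 1 :> R.
      rewrite indicE mem_set//=; move: yN; rewrite negb_and -!leNgt => /orP[yN|yN]; [left|by right].
      by rewrite y0.
    by rewrite subr0 !mul1r -mulrA normrM [`|w1 y * _|]ger0_norm// ler_wpM2r.
  rewrite IntZ//; have := hk (wsol n r) (ex_intro _ n (ex_intro _ r (conj rT erefl))).
  rewrite ler_pdivlMr//; apply: le_trans; rewrite [leRHS]mulrC ler_wpM2r//; last by lra.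
  by apply: Int_ge0 => y; rewrite mulr_ge0 ?wsol_ge0// indicE.
have ms := main s sT; have mt := main t tT.
have lip := hL h C' n s t mh hC sT tT.
have lip2 : `|t - s| * (C' * L) <= e / 2.
  rewrite (@le_trans _ _ (e / (2 * (C' * L + 1)) * (C' * L + 1)))//.
    by apply: ler_pM => //; rewrite lerDl.
  rewrite le_eqVlt; apply/orP; left; apply/eqP; field.
  by apply/eqP => h'; move: CL; rewrite h'; lra.
have key (a c x y : R) : `|a - x| <= e / 4 -> `|c - y| <= e / 4 -> `|x - y| <= e / 2 -> `|a - c| <= e.
  by rewrite !ler_norml; lra.
exact: key mt ms (le_trans lip lip2).
Qed.

End weighted_solution.

(** * Passage to the limit *)

Section change_of_weight.
Variables (R : realType) (P : coag_frag R).
Local Notation w1 := (weight (- cf_beta P)).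
Local Notation G := (pos_sol P).

Lemma qform_weight n t (K : R -> R -> R) C : meas2 K -> (forall y z, `|K y z| <= C) ->
  qform K (G n t) = qform (fun y z => K y z / (w1 y * w1 z)) (wsol P n t).
Proof.
move=> mK KC; apply: Int_eq => y.
rewrite /wsol; have [->|/pos_sol_neq0 /andP[y0 _]] := eqVneq (G n t y) 0; first by rewrite !mulr0.
have wy : w1 y != 0 by rewrite gt_eqF// weight_gt0.
have E z : K y z / (w1 y * w1 z) * (w1 z * G n t z) = (w1 y)^-1 * (K y z * G n t z).
  have [->|/pos_sol_neq0 /andP[z0 _]] := eqVneq (G n t z) 0; first by rewrite !mulr0.
  have wz : w1 z != 0 by rewrite gt_eqF// weight_gt0.
  by field; rewrite wy wz.
rewrite (Int_eq E) IntZ; last exact: integ_row mK KC (pos_sol_integ P n t) y.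
by rewrite mulrACA mulVf// mul1r.
Qed.

Lemma Int_weight n t (h : R -> R) :
  Int (fun y => h y * G n t y) = Int (fun y => h y / w1 y * wsol P n t y).
Proof.
apply: Int_eq => y; rewrite /wsol.
have [->|/pos_sol_neq0 /andP[y0 _]] := eqVneq (G n t y) 0; first by rewrite !mulr0.
by rewrite mulrA divfK// gt_eqF// weight_gt0.
Qed.

Lemma measurable_inv_weight : measurable_fun [set: R] (fun y => \1_Rpos y * (w1 y)^-1).
Proof.
have -> : (fun y => \1_Rpos y * (w1 y)^-1) = (fun y => \1_Rpos y * w1 y `^ (-1)).
  apply/funext => y; rewrite indic_Rpos; have [y0|] := ltP 0 y; last by rewrite !mul0r.
  by rewrite powR_inv1// weight_ge0// ltW.
apply: measurable_funM; first by apply: measurable_indic; exact: measurable_itv.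
by have := measurableT_comp (@measurable_powR R (-1)) (measurable_weight (- cf_beta P)).
Qed.

(* V is the limit of the weighted solutions, so that the limit solution is V
   divided by the weight. *)
Record weak_limit_of (phi : nat -> nat) (V : R -> R -> R) : Prop := WeakLimitOf {
  wl_homo : {homo phi : i j / (i < j)%N};
  wl_integ : forall t, 0 <= t -> integ (V t);
  wl_ge0 : forall t y, 0 <= V t y;
  wl_supp : forall t y, y <= 0 -> V t y = 0;
  wl_unif : forall (om : R -> R) (C T e : R), measurable_fun setT om ->
    (forall y, `|om y| <= C) -> 0 < e -> exists N, forall k, (N <= k)%N ->
    forall t, 0 <= t <= T ->
    `|Int (fun y => om y * wsol P (phi k) t y) - Int (fun y => om y * V t y)| <= e }.

Lemma weak_limit_exists : exists phi V, weak_limit_of phi V.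
Proof.
pose B T : R := sval (cid2 (wsol_bound P T)).
have BP T : forall n t, 0 <= t <= T -> integ (wsol P n t) /\ Int (wsol P n t) <= B T.
  by rewrite /B; case: cid2.
have mRpos : measurable (Rpos : set R) by exact: measurable_itv.
have [phi [U [homo_phi Ui U0 Ucvg]]] := @weak_arzela_ascoli R (wsol P) B
  (fun n t => @wsol_integ R P n t) (@wsol_ge0 R P) (fun T n t tT => (BP T n t tT).2)
  (@wsol_equi_integrable R P) (@wsol_equicontinuous R P).
(* The limit is set to zero at nonpositive sizes; the weighted solutions vanish there, so the
   convergence is unaffected. *)
exists phi, (fun t y => \1_Rpos y * U t y); split => //.
- by move=> t t0; apply: integ_indic => //; exact: Ui.
- by move=> t y; rewrite mulr_ge0// indicE.
- by move=> t y y0; rewrite indic_Rpos ltNge y0 mul0r.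
move=> om C T e mom omC e0.
have mo : measurable_fun setT (fun y => om y * \1_Rpos y).
  by apply: measurable_funM => //; exact: measurable_indic.
have oC y : `|om y * \1_Rpos y| <= C.
  by rewrite indicE; case: (_ \in _); rewrite ?mulr1// mulr0 normr0 (le_trans _ (omC 0)).
have [N hN] := Ucvg _ C T e mo oC e0; exists N => k Nk t tT.
have E1 y : om y * wsol P (phi k) t y = om y * \1_Rpos y * wsol P (phi k) t y.
  rewrite /wsol; have [->|/pos_sol_neq0 /andP[y0 _]] := eqVneq (G (phi k) t y) 0; first by rewrite !mulr0.
  by rewrite indic_Rpos y0 mulr1.
have E2 y : om y * (\1_Rpos y * U t y) = om y * \1_Rpos y * U t y by rewrite mulrA.
by rewrite (Int_eq E1) (Int_eq E2); exact: hN.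
Qed.

End change_of_weight.

(** * Continuity tested along sequences *)

Section sequential_continuity.
Variable R : realType.

Lemma continuous_seq (f : R -> R) (x : R) :
  (forall u : nat -> R, u n @[n --> \oo] --> x -> f (u n) @[n --> \oo] --> f x) ->
  {for x, continuous f}.
Proof.
move=> h; apply/cvgrPdist_le => e e0; apply: contrapT => nh.
have H n : exists y : R, `|y - x| <= n.+1%:R^-1 /\ e < `|f x - f y|.
  apply: contrapT => /forallNP ny; apply: nh; apply/nbhs_ballP.
  exists n.+1%:R^-1 => /=; first by rewrite invr_gt0.
  move=> y; rewrite /ball/= distrC => /ltW yx.
  by rewrite leNgt; apply/negP => fe; exact: (ny y).
have /choice[u hu] := H.
have ux : u n @[n --> \oo] --> x.
  apply/cvg_natP => d d0; exists (Num.truncn d^-1) => n hn.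
  apply: (le_trans (hu n).1); rewrite -[leRHS]invrK lef_pV2 ?posrE ?invr_gt0//.
  by rewrite ltW// (lt_le_trans (truncnS_gt _))// ler_nat ltnS.
have /cvg_natP /(_ e e0)[N hN] := h u ux.
by have := hN N (leqnn N); rewrite distrC leNgt (hu N).2.
Qed.

End sequential_continuity.

(** * The equation satisfied by the limit *)

Section limit.
Variables (R : realType) (P : coag_frag R).
Local Notation mu := (@lebesgue_measure R).
Local Notation b := (breakage (cf_nu P)).
Local Notation w1 := (weight (- cf_beta P)).
Local Notation G := (pos_sol P).
Local Notation D n r om :=
  (weak_rhs (trunc_A P n) b (trunc_S P n) (pos_sol P n r) n.+1%:R om).

Variables (phi : nat -> nat) (V : R -> R -> R).
Hypothesis VP : weak_limit_of P phi V.

Let phi_homo := wl_homo VP.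
Let V_integ := wl_integ VP.
Let V_ge0 := wl_ge0 VP.
Let V_supp := wl_supp VP.
Let V_unif := wl_unif VP.

Lemma phi_ge k : (k <= phi k)%N.
Proof. by elim: k => // k IH; rewrite (leq_ltn_trans IH)// phi_homo. Qed.

Lemma V_weak t (om : R -> R) C : 0 <= t -> measurable_fun setT om -> (forall y, `|om y| <= C) ->
  Int (fun y => om y * wsol P (phi k) t y) @[k --> \oo] --> Int (fun y => om y * V t y).
Proof.
move=> t0 mom omC; apply/cvg_natP => e e0.
have [N hN] := V_unif t mom omC e0; exists N => k Nk; apply: hN => //.
by rewrite t0 lexx.
Qed.

Lemma V_le t (om : R -> R) C M : 0 <= t -> measurable_fun setT om -> (forall y, `|om y| <= C) ->
  (forall n, Int (fun y => om y * wsol P n t y) <= M) -> Int (fun y => om y * V t y) <= M.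
Proof.
move=> t0 mom omC hM; apply/ler_addgt0Pr => e e0.
have /cvg_natP /(_ e e0)[N hN] := V_weak t0 mom omC.
have := hN N (leqnn N); have := hM (phi N); rewrite ler_norml.
by move: (Int _) (Int _) => x1 x2; lra.
Qed.

Lemma V_bound T : exists2 B : R, 0 <= B & forall t, 0 <= t <= T -> Int (V t) <= B.
Proof.
have [B B0 hB] := wsol_bound P T; exists B => // t tT; have /andP[t0 _] := tT.
have h : Int (fun y => 1 * V t y) <= B.
  apply: (@V_le t (fun=> 1) 1) => // [y|n]; first by rewrite normr1.
  by rewrite (Int_eq (g := wsol P n t)) ?(hB n t tT).2// => y; rewrite mul1r.
by rewrite (Int_eq (g := fun y => 1 * V t y))// => y; rewrite mul1r.
Qed.

Lemma V_equi_integrable T : equi_integrable [set f | exists t, 0 <= t <= T /\ f = V t].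
Proof.
move=> E mE Edec Eempty e e0.
have [N hN] := @wsol_equi_integrable R P T E mE Edec Eempty e e0.
exists N => _ [t [tT ->]]; have /andP[t0 _] := tT.
apply: (@V_le t (\1_(E N)) 1) => // [y|n].
- exact: indic_le1.
- by apply: hN; exists n, t.
Qed.

Lemma V_equicontinuous (om : R -> R) (C T : R) : measurable_fun setT om ->
  (forall y, `|om y| <= C) -> forall e : R, 0 < e -> exists2 d : R, 0 < d &
    forall s t, 0 <= s <= T -> 0 <= t <= T -> `|t - s| <= d ->
    `|Int (fun y => om y * V t y) - Int (fun y => om y * V s y)| <= e.
Proof.
move=> mom omC e e0; have e3 : 0 < e / 3 by rewrite divr_gt0.
have [d d0 hd] := wsol_equicontinuous P T mom omC e3; exists d => // s t sT tT st.
have [N hN] := V_unif T mom omC e3.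
have := hd (phi N) s t sT tT st; have := hN N (leqnn N) s sT; have := hN N (leqnn N) t tT.
move: (Int _) (Int _) (Int _) (Int _) => x1 x2 x3 x4; rewrite !ler_norml; lra.
Qed.

(** V is controlled at nonnegative times only. Clipping the time turns the linear and quadratic
    forms of V into continuous functions on the whole line, hence integrable on segments. *)
Let pos (t : R) : R := Num.max 0 t.

Let pos_ge0 t : 0 <= pos t. Proof. by rewrite /pos le_max lexx. Qed.

Let pos_id t : 0 <= t -> pos t = t. Proof. by move=> t0; rewrite /pos max_r. Qed.

Let pos_dist s t : `|pos s - pos t| <= `|s - t|.
Proof.
rewrite /pos; have := ler_norm (s - t); have := ler_norm (- (s - t)); rewrite normrN.
by case: (lerP 0 s) => ?; case: (lerP 0 t) => ?; rewrite ler_norml; lra.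
Qed.

Let cvg_bounded (u : nat -> R) x : u n @[n --> \oo] --> x ->
  exists T, 0 <= T /\ (forall n, 0 <= pos (u n) <= T) /\ 0 <= pos x <= T.
Proof.
move=> ux; have [M [_ hM]] := cvg_seq_bounded (cvgP _ ux).
pose T := Num.max `|M + 1| `|x|.
have hT (y : R) : `|y| <= T -> 0 <= pos y <= T.
  move=> yT; rewrite pos_ge0/= /pos ge_max (le_trans (normr_ge0 y) yT)/=.
  exact: le_trans (ler_norm _) yT.
exists T; split; first by rewrite le_max normr_ge0.
split => [n|]; apply: hT; last by rewrite le_max lexx orbT.
by rewrite le_max (le_trans (hM (M + 1) _ n I) (ler_norm _))// ltrDl.
Qed.

Section along_a_sequence.
Variables (u : nat -> R) (x : R).
Hypothesis ux : u n @[n --> \oo] --> x.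

Let V_seq_weak (om : R -> R) C : measurable_fun setT om -> (forall y, `|om y| <= C) ->
  Int (fun y => om y * V (pos (u k)) y) @[k --> \oo] --> Int (fun y => om y * V (pos x) y).
Proof.
move=> mom omC; have [T [_ [uT xT]]] := cvg_bounded ux.
apply/cvg_natP => e e0; have [d d0 hd] := V_equicontinuous T mom omC e0.
have /cvg_natP /(_ d d0)[N hN] := ux; exists N => n Nn.
by apply: hd => //; apply: le_trans (hN n Nn); exact: pos_dist.
Qed.

Let V_seq_equi : equi_integrable (range (fun k => V (pos (u k)))).
Proof.
have [T [_ [uT xT]]] := cvg_bounded ux.
by apply: (equi_integrable_sub _ (V_equi_integrable T)) => _ [k _ <-]; exists (pos (u k)).
Qed.

Let V_seq_bound : exists B, forall k, Int (V (pos (u k))) <= B.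
Proof.
have [T [_ [uT xT]]] := cvg_bounded ux; have [B _ hB] := V_bound T.
by exists B => k; exact: hB.
Qed.

Lemma linear_seq (h : R -> R) C : measurable_fun setT h -> (forall y, `|h y| <= C) ->
  Int (fun y => h y * V (pos (u k)) y) @[k --> \oo] --> Int (fun y => h y * V (pos x) y).
Proof. exact: V_seq_weak. Qed.

Lemma quadratic_seq K C : meas2 K -> (forall y z, `|K y z| <= C) ->
  qform K (V (pos (u k))) @[k --> \oo] --> qform K (V (pos x)).
Proof.
move=> mK KC; have [B hB] := V_seq_bound.
apply: (@quadratic_cvg R (fun k => V (pos (u k))) (V (pos x)) B _ _ hB V_seq_equi V_seq_weak (fun=> K) K C) => //.
- by move=> k; exact: V_integ.
- by move=> y z; exact: cvg_cst.
Qed.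

End along_a_sequence.

Lemma linear_form_continuous (h : R -> R) C : measurable_fun setT h -> (forall y, `|h y| <= C) ->
  continuous (fun s => Int (fun y => h y * V (pos s) y)).
Proof. by move=> mh hC s; apply: continuous_seq => u us; exact: linear_seq hC. Qed.

Lemma quadratic_form_continuous K C : meas2 K -> (forall y z, `|K y z| <= C) ->
  continuous (fun s => qform K (V (pos s))).
Proof. by move=> mK KC s; apply: continuous_seq => u us; exact: quadratic_seq KC. Qed.

Let time_integ (f : R -> R) t : continuous (fun s => f (pos s)) ->
  integ (fun s => \1_(`[0, t]) s * f s).
Proof.
move=> c; have mI : measurable (`[0, t] : set R) by exact: measurable_itv.
have : mu.-integrable `[0, t] (EFin \o (fun s => f (pos s))).
  apply: continuous_compact_integrable; first exact: segment_compact.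
  exact: continuous_subspaceT.
move=> /(proj1 (integ_set _ mI)); apply: integ_eq => s.
rewrite indic_itvE in_itv/=; have [/andP[s0 _]|_] := boolP (0 <= s <= t); last by rewrite !mul0r.
by rewrite pos_id.
Qed.

(** Division by the weights moves them from the limit solution to the kernel: integrals of the
    solution against unbounded coefficients become forms in V with bounded ones. *)
Definition coag_kernel (om : R -> R) (y z : R) : R :=
  omega_tilde om y z * pos_A P y z / (w1 y * w1 z).

Definition frag_kernel (om : R -> R) (y : R) : R := frag_test b om y * pos_S P y / w1 y.

Lemma over_weight2_le (x c y z : R) : 0 <= c -> (~~ ((0 < y) && (0 < z)) -> x = 0) ->
  (0 < y -> 0 < z -> `|x| <= c * (w1 y * w1 z)) -> `|x / (w1 y * w1 z)| <= c.
Proof.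
move=> c0 x0 xle; have [/andP[y0 z0]|/x0 ->] := boolP ((0 < y) && (0 < z)); last first.
  by rewrite mul0r normr0.
have w0 : 0 < w1 y * w1 z by rewrite mulr_gt0 ?weight_gt0.
by rewrite normrM normfV (gtr0_norm w0) ler_pdivrMr// xle.
Qed.

Lemma over_weight_le (x c y : R) : 0 <= c -> (y <= 0 -> x = 0) ->
  (0 < y -> `|x| <= c * w1 y) -> `|x / w1 y| <= c.
Proof.
move=> c0 x0 xle; have [y0|/x0 ->] := ltP 0 y; last by rewrite mul0r normr0.
have w0 : 0 < w1 y by rewrite weight_gt0.
by rewrite normrM normfV (gtr0_norm w0) ler_pdivrMr// xle.
Qed.

Lemma pos_A_supp y z : ~~ ((0 < y) && (0 < z)) -> pos_A P y z = 0.
Proof.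
by rewrite /pos_A !indic_Rpos; case: (0 < y); case: (0 < z) => // _; rewrite ?mul0r ?mulr0.
Qed.

Lemma pos_S_supp y : y <= 0 -> pos_S P y = 0.
Proof. by move=> y0; rewrite /pos_S indic_Rpos ltNge y0 mul0r. Qed.

Let A_weight y z : 0 < y -> 0 < z -> `|pos_A P y z| <= 4 * cf_k1 P * (w1 y * w1 z).
Proof. by move=> y0 z0; rewrite ger0_norm ?pos_A_ge0// pos_A_le_weight. Qed.

Let S_weight y : 0 < y -> `|pos_S P y| <= cf_k2 P * w1 y.
Proof. by move=> y0; rewrite ger0_norm ?pos_S_ge0// pos_S_le_weight// beta_le0. Qed.

(* The inverse weight is measurable on Rpos only, where the kernels live. *)
Lemma meas2_over_weight (K : R -> R -> R) : meas2 K ->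
  (forall y z, ~~ ((0 < y) && (0 < z)) -> K y z = 0) -> meas2 (fun y z => K y z / (w1 y * w1 z)).
Proof.
move=> mK K0; have E : (fun y z => K y z / (w1 y * w1 z)) =
    (fun y z => K y z * (\1_Rpos y * (w1 y)^-1) * (\1_Rpos z * (w1 z)^-1)).
  apply/funext => y; apply/funext => z; rewrite !indic_Rpos.
  have [/andP[y0 z0]|/K0 ->] := boolP ((0 < y) && (0 < z)); last by rewrite !mul0r.
  by rewrite y0 z0 !mul1r invfM mulrA.
have mw := measurable_inv_weight P.
by rewrite E; apply: meas2_mul; [apply: meas2_mul => //; exact: meas2_fst|exact: meas2_snd].
Qed.

Lemma measurable_over_weight (h : R -> R) : measurable_fun setT h ->
  (forall y, y <= 0 -> h y = 0) -> measurable_fun setT (fun y => h y / w1 y).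
Proof.
move=> mh h0; have E : (fun y => h y / w1 y) = (fun y => h y * (\1_Rpos y * (w1 y)^-1)).
  apply/funext => y; rewrite indic_Rpos; have [y0|/h0 ->] := ltP 0 y; last by rewrite !mul0r.
  by rewrite mul1r.
by rewrite E; apply: measurable_funM => //; exact: measurable_inv_weight.
Qed.

Section bounded_test.
Variables (om : R -> R) (C : R).
Hypothesis mom : measurable_fun setT om.
Hypothesis omC : forall y, `|om y| <= C.

Let C0 : 0 <= C := le_trans (normr_ge0 (om 0)) (omC 0).

Let tilde_le y z : `|omega_tilde om y z| <= 3 * C.
Proof.
rewrite /omega_tilde (_ : 3 * C = C + C + C); last by ring.
by rewrite (le_trans (ler_normB _ _))// lerD// (le_trans (ler_normB _ _))// lerD.
Qed.

Let tilde_meas : meas2 (omega_tilde om).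
Proof.
exact: (meas2_add (meas2_add (meas2_sum mom) (meas2_opp (meas2_fst mom)))
  (meas2_opp (meas2_snd mom))).
Qed.

Lemma coag_kernel_le y z : `|coag_kernel om y z| <= 12 * C * cf_k1 P.
Proof.
have k0 := cf_k1_ge0 P.
apply: over_weight2_le; first by rewrite !mulr_ge0.
  by move=> /pos_A_supp ->; rewrite mulr0.
move=> y0 z0; rewrite normrM (_ : 12 * C * _ * _ = (3 * C) * (4 * cf_k1 P * (w1 y * w1 z))); last by ring.
by rewrite ler_pM// A_weight.
Qed.

Lemma coag_kernel_meas : meas2 (coag_kernel om).
Proof.
apply: meas2_over_weight; first by apply: meas2_mul => //; exact: pos_A_meas.
by move=> y z /pos_A_supp ->; rewrite mulr0.
Qed.

Let frag_le y : `|frag_test b om y| <= C * (1 + cf_c1 P).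
Proof. exact: (frag_test_bound (breakage_ge0 P) (breakage_int P) (breakage_int_le P) mom omC). Qed.

Lemma frag_kernel_le y : `|frag_kernel om y| <= C * (1 + cf_c1 P) * cf_k2 P.
Proof.
have k0 := cf_k2_ge0 P; have c0 := c1_ge0 P.
apply: over_weight_le; first by rewrite !mulr_ge0// addr_ge0.
  by move=> /pos_S_supp ->; rewrite mulr0.
by move=> y0; rewrite normrM -mulrA ler_pM// S_weight.
Qed.

Lemma frag_kernel_meas : measurable_fun setT (frag_kernel om).
Proof.
apply: measurable_over_weight.
  by apply: measurable_funM; [exact: (frag_test_meas (breakage_meas P) mom)|exact: pos_S_meas].
by move=> y /pos_S_supp ->; rewrite mulr0.
Qed.

Definition limit_rhs s : R :=
  2^-1 * qform (coag_kernel om) (V s) - Int (fun y => frag_kernel om y * V s y).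

Lemma limit_rhs_coag_integ t : integ (fun s => \1_(`[0, t]) s * qform (coag_kernel om) (V s)).
Proof.
apply: (@time_integ (fun s => qform (coag_kernel om) (V s))).
exact: quadratic_form_continuous coag_kernel_meas coag_kernel_le.
Qed.

Lemma limit_rhs_frag_integ t :
  integ (fun s => \1_(`[0, t]) s * Int (fun y => frag_kernel om y * V s y)).
Proof.
apply: (@time_integ (fun s => Int (fun y => frag_kernel om y * V s y))).
exact: linear_form_continuous frag_kernel_meas frag_kernel_le.
Qed.

Let trunc_eventually (y : R) : 0 < y ->
  \forall k \near \oo, (phi k).+1%:R^-1 < y < (phi k).+1%:R.
Proof.
move=> y0; exists (maxn (Num.truncn y) (Num.truncn y^-1)) => // k /= hk.
have pk := leq_trans hk (phi_ge k).
have h1 : y < (phi k).+1%:R.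
  by rewrite (lt_le_trans (truncnS_gt _))// ler_nat ltnS (leq_trans _ pk)// leq_maxl.
have h2 : y^-1 < (phi k).+1%:R.
  by rewrite (lt_le_trans (truncnS_gt _))// ler_nat ltnS (leq_trans _ pk)// leq_maxr.
by rewrite h1 andbT -[ltRHS]invrK ltf_pV2 ?posrE ?invr_gt0.
Qed.

(** At fixed positive sizes the sequence is eventually constant: for k large, y, z and y + z all lie
    strictly between 1/n and n for n = [(phi k).+1], and no truncation acts. *)
Let trunc_coag_cvg y z :
  coag_test (phi k).+1%:R om y z * trunc_A P (phi k) y z / (w1 y * w1 z) @[k --> \oo] -->
  coag_kernel om y z.
Proof.
have [/andP[y0 z0]|yz] := boolP ((0 < y) && (0 < z)); last first.
  have -> : (fun k => coag_test (phi k).+1%:R om y z * trunc_A P (phi k) y z / (w1 y * w1 z)) = fun=> 0.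
    by apply/funext => k; rewrite trunc_AE pos_A_supp// !(mul0r, mulr0).
  by rewrite /coag_kernel pos_A_supp// mulr0 mul0r; exact: cvg_cst.
have yz0 : 0 < y + z by rewrite addr_gt0.
apply: cvg_near_cst; near=> k; apply/eqP.
have /andP[y1 y2] : (phi k).+1%:R^-1 < y < (phi k).+1%:R by near: k; exact: trunc_eventually.
have /andP[z1 z2] : (phi k).+1%:R^-1 < z < (phi k).+1%:R by near: k; exact: trunc_eventually.
have /andP[_ yz2] : (phi k).+1%:R^-1 < y + z < (phi k).+1%:R by near: k; exact: trunc_eventually.
rewrite /coag_kernel /coag_test /omega_tilde trunc_AE !indic_itvE !in_itv/= y1 y2 z1 z2 yz0 yz2 /=.
by rewrite !mulr1 mul1r subrK mulr1.
Unshelve. all: by end_near. Qed.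

Let trunc_frag_cvg y :
  frag_test b om y * trunc_S P (phi k) y / w1 y @[k --> \oo] --> frag_kernel om y.
Proof.
have [y0|y0] := ltP 0 y; last first.
  have -> : (fun k => frag_test b om y * trunc_S P (phi k) y / w1 y) = fun=> 0.
    by apply/funext => k; rewrite trunc_SE pos_S_supp// !(mul0r, mulr0).
  by rewrite /frag_kernel pos_S_supp// mulr0 mul0r; exact: cvg_cst.
apply: cvg_near_cst; near=> k; apply/eqP.
have /andP[y1 y2] : (phi k).+1%:R^-1 < y < (phi k).+1%:R by near: k; exact: trunc_eventually.
by rewrite /frag_kernel trunc_SE indic_itvE in_itv/= y0 y2 mulr1.
Unshelve. all: by end_near. Qed.

(** After division by the weights the truncated kernels are bounded independently of n and converge
    pointwise, so the weak continuity results apply with varying kernels. *)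
Let rhs_cvg s : 0 <= s -> D (phi k) s om @[k --> \oo] --> limit_rhs s.
Proof.
move=> s0; have [B B0 hB] := wsol_bound P s.
have k10 := cf_k1_ge0 P; have k20 := cf_k2_ge0 P; have c0 := c1_ge0 P.
have s1 : 0 <= s <= s by rewrite s0 lexx.
have vi k : integ (wsol P (phi k) s) by exact: wsol_integ.
have vB k : Int (wsol P (phi k) s) <= B by have [] := hB (phi k) s s1.
have vE : equi_integrable (range (fun k => wsol P (phi k) s)).
  by apply: (equi_integrable_sub _ (@wsol_equi_integrable R P s)) => _ [k _ <-]; exists (phi k), s.
have mK k : meas2 (fun y z => coag_test (phi k).+1%:R om y z * trunc_A P (phi k) y z).
  by apply: meas2_mul; [exact: coag_test_meas|exact: trunc_A_meas].
have KC k y z : `|coag_test (phi k).+1%:R om y z * trunc_A P (phi k) y z| <= 3 * C * trunc_A_max P (phi k).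
  rewrite normrM ler_pM//; first exact: coag_test_bound.
  exact: trunc_A_bound.
have c1 : qform (fun y z => coag_test (phi k).+1%:R om y z * trunc_A P (phi k) y z) (G (phi k) s)
    @[k --> \oo] --> qform (coag_kernel om) (V s).
  rewrite (_ : (fun k => _) = (fun k => qform (fun y z => coag_test (phi k).+1%:R om y z *
    trunc_A P (phi k) y z / (w1 y * w1 z)) (wsol P (phi k) s))); last first.
    by apply/funext => k; exact: qform_weight (mK k) (KC k).
  apply: (@quadratic_cvg R (fun k => wsol P (phi k) s) (V s) B vi _ vB vE
    (fun om C => @V_weak s om C s0) _ _ (12 * C * cf_k1 P)).
  - by move=> k y; exact: wsol_ge0.
  - move=> k; apply: meas2_over_weight => // y z yz.
    by rewrite trunc_AE pos_A_supp// !(mul0r, mulr0).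
  - move=> k y z; apply: over_weight2_le; first by rewrite !mulr_ge0.
      by move=> yz; rewrite trunc_AE pos_A_supp// !(mul0r, mulr0).
    move=> y0 z0; rewrite normrM (_ : 12 * C * _ * _ = (3 * C) * (4 * cf_k1 P * (w1 y * w1 z))); last by ring.
    rewrite ler_pM//; first exact: coag_test_bound.
    by rewrite ger0_norm ?trunc_A_ge0// (le_trans (trunc_A_le _ _ _ _))// pos_A_le_weight.
  - exact: trunc_coag_cvg.
have c2 : Int (fun y => frag_test b om y * trunc_S P (phi k) y * G (phi k) s y) @[k --> \oo] -->
    Int (fun y => frag_kernel om y * V s y).
  rewrite (_ : (fun k => _) = (fun k => Int (fun y => frag_test b om y * trunc_S P (phi k) y / w1 y *
    wsol P (phi k) s y))); last by apply/funext => k; exact: Int_weight.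
  apply: (@linear_cvg R (fun k => wsol P (phi k) s) (V s) B vi _ vB vE
    (fun om C => @V_weak s om C s0) _ _ (C * (1 + cf_c1 P) * cf_k2 P)).
  - by move=> k y; exact: wsol_ge0.
  - move=> k; apply: measurable_over_weight.
      by apply: measurable_funM; [exact: (frag_test_meas (breakage_meas P) mom)|exact: trunc_S_meas].
    by move=> y y0; rewrite trunc_SE pos_S_supp// !(mul0r, mulr0).
  - move=> k y; apply: over_weight_le; first by rewrite !mulr_ge0// addr_ge0.
      by move=> y0; rewrite trunc_SE pos_S_supp// !(mul0r, mulr0).
    move=> y0; rewrite normrM -mulrA ler_pM//.
    rewrite ger0_norm ?trunc_S_ge0// (le_trans (trunc_S_le _ _ _))//.
    by rewrite pos_S_le_weight// beta_le0.
  - exact: trunc_frag_cvg.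
by apply: cvgB => //; apply: cvgMr.
Qed.

(** The values at time t pass to the limit weakly, the test function divided by the weight being
    bounded. The initial values and the time integral pass by dominated convergence, the latter with
    the constant of [rhs_bound]. *)
Lemma limit_equation t : 0 <= t ->
  Int (fun y => om y * (V t y / w1 y)) - Int (fun y => om y * pos_init P y) =
  \int[mu]_(s in `[0, t]) limit_rhs s.
Proof.
move=> t0; have mI : measurable (`[0, t] : set R) by exact: measurable_itv.
have mRpos : measurable (Rpos : set R) by exact: measurable_itv.
have oE y : om y * (V t y / w1 y) = \1_Rpos y * om y / w1 y * V t y.
  have [y0|y0] := ltP 0 y; last by rewrite V_supp// mul0r !mulr0.
  by rewrite indic_Rpos y0 mul1r mulrA mulrAC.
have mow : measurable_fun setT (fun y => \1_Rpos y * om y / w1 y).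
  apply: measurable_over_weight => [|y y0]; last by rewrite indic_Rpos ltNge y0 mul0r.
  by apply: measurable_funM => //; exact: measurable_indic.
have owC y : `|\1_Rpos y * om y / w1 y| <= C.
  apply: over_weight_le => // y0; first by rewrite indic_Rpos ltNge y0 mul0r.
  by rewrite indic_Rpos y0 mul1r (le_trans (omC y))// ler_peMr// le1_weight// beta_le0.
have cl : Int (fun y => om y * G (phi k) t y) @[k --> \oo] --> Int (fun y => om y * (V t y / w1 y)).
  rewrite (Int_eq oE) (_ : (fun k => _) = (fun k => Int (fun y => \1_Rpos y * om y / w1 y * wsol P (phi k) t y))).
    exact: V_weak owC.
  apply/funext => k; rewrite Int_weight; apply: Int_eq => y.
  rewrite /wsol; have [->|/pos_sol_neq0 /andP[y0 _]] := eqVneq (G (phi k) t y) 0; first by rewrite !mulr0.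
  by rewrite indic_Rpos y0 mul1r.
have ci : Int (fun y => om y * G (phi k) 0 y) @[k --> \oo] --> Int (fun y => om y * pos_init P y).
  rewrite (_ : (fun k => _) = (fun k => Int (fun y => om y * (\1_(`]0, (phi k).+1%:R[) y * pos_init P y)))); last first.
    by apply/funext => k; exact: pos_sol_init omC.
  have [||||_ //] := @Int_dct R (fun k y => om y * (\1_(`]0, (phi k).+1%:R[) y * pos_init P y))
    (fun y => om y * pos_init P y) (fun y => C * `|pos_init P y|).
  - move=> k; apply: measurable_funM => //; apply: measurable_funM; last exact: pos_init_meas.
    by apply: measurable_indic; exact: measurable_itv.
  - move=> y; apply: cvgMr; have [y0|y0] := ltP 0 y; last first.
      have p0 : pos_init P y = 0 by rewrite /pos_init indic_Rpos ltNge y0 mul0r.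
      rewrite p0 (_ : (fun k => _) = fun=> 0); first exact: cvg_cst.
      by apply/funext => k; rewrite mulr0.
    apply: cvg_near_cst; near=> k; apply/eqP.
    have /andP[y1 y2] : (phi k).+1%:R^-1 < y < (phi k).+1%:R by near: k; exact: trunc_eventually.
    by rewrite indic_itvE in_itv/= y0 y2 mul1r.
  - move=> k y; rewrite !normrM ler_pM// ?mulr_ge0//.
    by rewrite ler_piMl// indic_le1.
  - exact/integZ/integ_abs/pos_init_integ.
have cD : Int (fun y => om y * G (phi k) t y) - Int (fun y => om y * G (phi k) 0 y) @[k --> \oo] -->
    \int[mu]_(s in `[0, t]) limit_rhs s.
  rewrite (_ : (fun k => _) = (fun k => Int (fun s => \1_(`[0, t]) s * D (phi k) s om))); last first.
    apply/funext => k; have [h _] := pos_sol_weak P (phi k) mom omC (lexx 0) t0.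
    by rewrite h Int_set.
  rewrite Int_set.
  have [L L0 hL] := rhs_bound P t.
  have [||||_ //] := @Int_dct R (fun k s => \1_(`[0, t]) s * D (phi k) s om)
    (fun s => \1_(`[0, t]) s * limit_rhs s) (fun s => \1_(`[0, t]) s * (C * L)).
  - move=> k; apply: integ_meas; apply: (proj1 (integ_set _ mI)).
    exact: rhs_integrable mom omC t0.
  - move=> s; rewrite indic_itvE in_itv/=; have [/andP[s0 _]|_] := boolP (0 <= s <= t).
      rewrite mul1r (_ : (fun k => _) = fun k => D (phi k) s om); first exact: rhs_cvg.
      by apply/funext => k; rewrite mul1r.
    rewrite mul0r (_ : (fun k => _) = fun=> 0); first exact: cvg_cst.
    by apply/funext => k; rewrite mul0r.
  - move=> k s; rewrite indic_itvE in_itv/=; have [st|_] := boolP (0 <= s <= t).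
      by rewrite !mul1r; exact: hL.
    by rewrite !mul0r normr0.
  - by apply: (@time_integ (fun=> C * L)); exact: cst_continuous.
have cB : Int (fun y => om y * G (phi k) t y) - Int (fun y => om y * G (phi k) 0 y) @[k --> \oo] -->
    Int (fun y => om y * (V t y / w1 y)) - Int (fun y => om y * pos_init P y) by apply: cvgB.
by rewrite -(cvg_lim (@Rhausdorff R) cB) -(cvg_lim (@Rhausdorff R) cD).
Unshelve. all: by end_near. Qed.

Lemma limit_equation_split t : 0 <= t ->
  Int (fun y => om y * (V t y / w1 y)) - Int (fun y => om y * pos_init P y) =
  2^-1 * (\int[mu]_(s in `[0, t]) qform (coag_kernel om) (V s)) -
  \int[mu]_(s in `[0, t]) Int (fun y => frag_kernel om y * V s y).
Proof.
move=> t0; rewrite limit_equation// !Int_set.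
have i1 := limit_rhs_coag_integ t; have i2 := limit_rhs_frag_integ t.
rewrite -IntZ// -IntB//; last exact: integZ.
by apply: Int_eq => s; rewrite /limit_rhs mulrBr mulrCA.
Qed.

End bounded_test.

End limit.

(** * Conservation of mass in the limit *)

Section mass_conservation_of_the_limit.
Variables (R : realType) (P : coag_frag R).
Local Notation mu := (@lebesgue_measure R).
Local Notation beta := (cf_beta P).
Local Notation b := (breakage (cf_nu P)).
Local Notation w1 := (weight (- cf_beta P)).
Local Notation G := (pos_sol P).

Variables (phi : nat -> nat) (V : R -> R -> R).
Hypothesis VP : weak_limit_of P phi V.

Let V_integ := wl_integ VP.
Let V_ge0 := wl_ge0 VP.
Let V_supp := wl_supp VP.

Let mRpos : measurable (Rpos : set R). Proof. exact: measurable_itv. Qed.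

Let om (l : nat) (y : R) : R := \1_Rpos y * Num.min y l%:R.

Let om_pos l y : 0 < y -> om l y = Num.min y l%:R.
Proof. by move=> y0; rewrite /om indic_Rpos y0 mul1r. Qed.

Let om_neg l y : y <= 0 -> om l y = 0.
Proof. by move=> y0; rewrite /om indic_Rpos ltNge y0 mul0r. Qed.

Let om_ge0 l y : 0 <= om l y.
Proof.
have [y0|y0] := ltP 0 y; last by rewrite om_neg.
by rewrite om_pos// le_min (ltW y0) ler0n.
Qed.

Let om_le l y : 0 < y -> om l y <= y.
Proof. by move=> y0; rewrite om_pos// ge_min lexx. Qed.

Let om_bound l y : `|om l y| <= l%:R.
Proof.
rewrite ger0_norm//; have [y0|y0] := ltP 0 y; last by rewrite om_neg.
by rewrite om_pos// ge_min lexx orbT.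
Qed.

Let om_meas l : measurable_fun setT (om l).
Proof.
apply: measurable_funM; first exact: measurable_indic.
by apply: measurable_minr.
Qed.

Let om_cvg y : 0 < y -> om l y @[l --> \oo] --> y.
Proof.
move=> y0; apply/cvg_natP => e e0; exists (Num.truncn y).+1 => l hl.
rewrite om_pos// min_l ?subrr ?normr0 ?(ltW e0)// ltW// (lt_le_trans (truncnS_gt _))// ler_nat//.
Qed.

Let Vw_ge0 t y : 0 <= V t y / w1 y.
Proof.
have [y0|y0] := ltP 0 y; last by rewrite V_supp ?mul0r.
by rewrite divr_ge0// weight_ge0// ltW.
Qed.

Let omVE l t y : om l y / w1 y * V t y = om l y * (V t y / w1 y).
Proof. by rewrite mulrA mulrAC. Qed.

Let om_weight_meas l : measurable_fun setT (fun y => om l y / w1 y).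
Proof. by apply: measurable_over_weight => // y; exact: om_neg. Qed.

Let om_weight_le l y : `|om l y / w1 y| <= 1.
Proof.
apply: over_weight_le => // [|y0]; first exact: om_neg.
by rewrite mul1r ger0_norm// (le_trans (om_le l y0))// lerDr powR_ge0.
Qed.

(** The size is not an admissible test for weak convergence against bounded functions of V with a
    limit in l taken first, so min(y, l) is tested and Fatou's lemma is applied in l. *)
Lemma limit_mass_le t : 0 <= t ->
  integ (fun y => y * (V t y / w1 y)) /\ Int (fun y => y * (V t y / w1 y)) <= init_mass P.
Proof.
move=> t0; apply: (@integ_fatou R (fun l y => om l y * (V t y / w1 y))) => [l|l y|y|l].
- by apply: integ_eq (integ_mulb (om_weight_meas l) (om_weight_le l) (V_integ t0)) => y; rewrite omVE.
- by rewrite mulr_ge0.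
- have [y0|y0] := ltP 0 y; first by apply: cvgMl; exact: om_cvg.
  rewrite V_supp// mul0r mulr0 (_ : (fun l => _) = fun=> 0); first exact: cvg_cst.
  by apply/funext => l; rewrite mulr0.
- rewrite (Int_eq (g := fun y => om l y / w1 y * V t y)); last by move=> y; rewrite omVE.
  apply: (V_le VP t0 (om_weight_meas l) (om_weight_le l)) => n.
  have [i1 M1] := moment1 P n t0.
  apply: le_trans M1; rewrite -(Int_weight P n t (om l)).
  apply: Int_le => // [|y]; first exact: integ_mulb (om_meas l) (om_bound l) (pos_sol_integ P n t).
  have [->|/pos_sol_neq0 /andP[y0 _]] := eqVneq (G n t y) 0; first by rewrite !mulr0.
  by rewrite ler_wpM2r ?pos_sol_ge0// om_le.
Qed.

(** The ratio min(z, l) / z is nonincreasing: on fragments z < y the test function lies above the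
    line through its value at y, whose integral is that value. *)
Let frag_le0 l y : 0 < y -> frag_test b (om l) y <= 0.
Proof.
move=> y0; have [bi bm] := breakage_mass P y0.
rewrite /frag_test subr_le0.
have -> : om l y = Int (fun z => om l y / y * (b z y * z)).
  by rewrite IntZ// bm divfK// gt_eqF.
apply: Int_le => [||z].
- exact: integZ.
- exact: (integ_breakage_test (breakage_int P) (om_meas l) (om_bound l) y).
have [/andP[z0 zy]|/breakage_supp ->] := boolP (0 < z < y); last by rewrite !mul0r mulr0.
rewrite mulrCA ler_wpM2l ?breakage_ge0// mulrAC ler_pdivrMr// !om_pos//.
have l0 : 0 <= l%:R :> R by [].
move: (l%:R : R) l0 => L L0.
case: (lerP y L) => ?; case: (lerP z L) => ?; nra.
Qed.

Let tilde_abs l y z : 0 < y -> 0 < z -> z <= y -> `|omega_tilde (om l) y z| <= z.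
Proof.
move=> y0 z0 zy; rewrite /omega_tilde !om_pos ?addr_gt0//.
have l0 : 0 <= l%:R :> R by [].
move: (l%:R : R) l0 => L L0; rewrite ler_norml.
case: (lerP (y + z) L) => ?; case: (lerP y L) => ?; case: (lerP z L) => ?; lra.
Qed.

(** The defect of min(., l) is at most the smaller size z, which compensates the growth of the
    kernel: z z^(-beta) is below the weight at z, and each of the three terms of (1 + y + z)
    y^(-beta) is below the weight at y. The bound is therefore uniform in l. *)
Let kernel_half l y z : 0 < y -> 0 < z -> z <= y ->
  `|omega_tilde (om l) y z * pos_A P y z| <= 3 * cf_k1 P * (w1 y * w1 z).
Proof.
move=> y0 z0 zy; have b0 := beta_ge0 P; have b1 := beta_lt1 P.
have k0 := cf_k1_ge0 P.
have yb := powR_ge0 y (- beta); have zb := powR_ge0 z (- beta).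
have h (x : R) : 0 < x -> x * x `^ (- beta) <= w1 x.
  move=> x0; rewrite -{1}(powRr1 (ltW x0)) -powRD; last by apply/implyP => _; rewrite gt_eqF.
  by apply: powR_le_weight => //; lra.
have hy := h y y0; have hz := h z z0.
have hy1 : y `^ (- beta) <= w1 y by rewrite lerDl ltW.
rewrite normrM [`|pos_A P y z|]ger0_norm ?pos_A_ge0//.
apply: (@le_trans _ _ (z * (cf_k1 P * ((1 + y + z) * (y `^ (- beta) * z `^ (- beta)))))).
  by apply: ler_pM => //; [exact: pos_A_ge0|exact: tilde_abs|exact: pos_A_le].
rewrite (_ : z * _ = cf_k1 P * ((1 + y + z) * y `^ (- beta) * (z * z `^ (- beta)))); last by ring.
rewrite (_ : 3 * cf_k1 P * _ = cf_k1 P * (3 * w1 y * w1 z)); last by ring.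
rewrite ler_wpM2l//; apply: ler_pM => //.
- by rewrite mulr_ge0// !addr_ge0// ltW.
- by rewrite mulr_ge0// ltW.
move: hy hy1 yb; move: (y `^ (- beta)) (w1 y) => u w hy hy1 u0.
have : z * u <= y * u by rewrite ler_wpM2r.
lra.
Qed.

Let kernel_le l y z : `|coag_kernel P (om l) y z| <= 3 * cf_k1 P.
Proof.
apply: over_weight2_le; first by rewrite mulr_ge0// cf_k1_ge0.
  by move=> /pos_A_supp ->; rewrite mulr0.
move=> y0 z0; have [zy|/ltW yz] := leP z y; first exact: kernel_half.
rewrite [w1 y * _]mulrC pos_A_sym.
rewrite (_ : omega_tilde (om l) y z = omega_tilde (om l) z y); first exact: kernel_half.
by rewrite /omega_tilde [z + y]addrC addrAC.
Qed.

Let kernel_cvg y z : coag_kernel P (om l) y z @[l --> \oo] --> (0 : R).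
Proof.
have [/andP[y0 z0]|yz] := boolP ((0 < y) && (0 < z)); last first.
  rewrite (_ : (fun l => _) = fun=> 0); first exact: cvg_cst.
  by apply/funext => l; rewrite /coag_kernel pos_A_supp// mulr0 mul0r.
have yz0 : 0 < y + z by rewrite addr_gt0.
rewrite (_ : 0 = (y + z - y - z) * (pos_A P y z / (w1 y * w1 z))); last first.
  by rewrite [y + z]addrC addrK subrr mul0r.
rewrite (_ : (fun l => _) = (fun l => omega_tilde (om l) y z * (pos_A P y z / (w1 y * w1 z)))); last first.
  by apply/funext => l; rewrite mulrA.
apply: cvgMl; rewrite /omega_tilde.
by apply: cvgB; [apply: cvgB|]; exact: om_cvg.
Qed.

(** min(., l) becomes additive at each fixed pair as l grows, so the kernels tend to 0 pointwise
    with a uniform bound; [quadratic_cvg] is used with the constant sequence V s. *)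
Let coag_vanish t : 0 <= t ->
  \int[mu]_(s in `[0, t]) qform (coag_kernel P (om l)) (V s) @[l --> \oo] --> (0 : R).
Proof.
move=> t0; have k0 := cf_k1_ge0 P.
have [B B0 hB] := V_bound VP t.
have c s : 0 <= s <= t -> qform (coag_kernel P (om l)) (V s) @[l --> \oo] --> (0 : R).
  move=> st; have /andP[s0 _] := st.
  have q0 : qform (fun _ _ => 0) (V s) = 0.
    rewrite /qform (Int_eq (g := fun=> 0)) ?Int0// => y.
    by rewrite (Int_eq (g := fun=> 0)) ?Int0 ?mul0r// => z; rewrite mul0r.
  rewrite -q0; apply: (@quadratic_cvg R (fun=> V s) (V s) B _ _ _ _ _ _ _ (3 * cf_k1 P)).
  - by move=> _; exact: V_integ.
  - by [].
  - by move=> _; exact: hB.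
  - by apply: (equi_integrable_sub _ (V_equi_integrable VP t)) => _ [_ _ <-]; exists s.
  - by move=> o C _ _; exact: cvg_cst.
  - by move=> l; exact: coag_kernel_meas.
  - by move=> l; exact: kernel_le.
  - exact: kernel_cvg.
rewrite (_ : (fun l => _) = (fun l => Int (fun s => \1_(`[0, t]) s * qform (coag_kernel P (om l)) (V s)))); last first.
  by apply/funext => l; rewrite Int_set.
rewrite -[X in _ --> X](Int0 R).
have mI : measurable (`[0, t] : set R) by exact: measurable_itv.
have [||||_ //] := @Int_dct R (fun l s => \1_(`[0, t]) s * qform (coag_kernel P (om l)) (V s))
  (fun=> 0) (fun s => \1_(`[0, t]) s * (3 * cf_k1 P * B * B)).
- by move=> l; exact: integ_meas (limit_rhs_coag_integ VP (om_meas l) (om_bound l) t).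
- move=> s; rewrite indic_itvE in_itv/=; have [st|_] := boolP (0 <= s <= t).
    rewrite (_ : (fun l => _) = fun l => qform (coag_kernel P (om l)) (V s)); first exact: c.
    by apply/funext => l; rewrite mul1r.
  rewrite (_ : (fun l => _) = fun=> 0); first exact: cvg_cst.
  by apply/funext => l; rewrite mul0r.
- move=> l s; rewrite indic_itvE in_itv/=; have [st|_] := boolP (0 <= s <= t); last by rewrite !mul0r normr0.
  rewrite !mul1r; have /andP[s0 _] := st.
  apply: (le_trans (qform_bound (coag_kernel_meas P (om_meas l)) (kernel_le l) (V_integ s0))).
  have E : Int (fun z => `|V s z|) = Int (V s) by apply: Int_eq => z; rewrite ger0_norm.
  have I0 : 0 <= Int (V s) by exact: Int_ge0.
  by rewrite E; apply: ler_pM => //; rewrite ?mulr_ge0// ?ler_wpM2l ?mulr_ge0 ?hB.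
- apply/(integ_set _ mI); apply: measurable_bounded_integrable => //.
    by have : (mu `[0%R, t] < +oo)%E by rewrite lebesgue_measure_itv/=; case: ifP => _; rewrite ?ltry.
  by exists `|3 * cf_k1 P * B * B|; split => // x xM z _ /=; exact: ltW.
Qed.

(** The lower bound tests the limit equation with min(y, l): the fragmentation term has a favourable
    sign and the coagulation term vanishes as l grows, while the initial contribution tends to the
    full initial mass. *)
Lemma limit_mass t : 0 <= t -> Int (fun y => y * (V t y / w1 y)) = init_mass P.
Proof.
move=> t0; have [iy le] := limit_mass_le t0.
apply/eqP; rewrite eq_le le /=.
have lower l : Int (fun y => om l y * pos_init P y) +
    2^-1 * \int[mu]_(s in `[0, t]) qform (coag_kernel P (om l)) (V s) <= Int (fun y => y * (V t y / w1 y)).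
  have h := limit_equation_split VP (om_meas l) (om_bound l) t0.
  have f0 : \int[mu]_(s in `[0, t]) Int (fun y => frag_kernel P (om l) y * V s y) <= 0.
    have fi := limit_rhs_frag_integ VP (om_meas l) (om_bound l) t.
    rewrite Int_set -oppr_ge0 -(IntN fi).
    apply: Int_ge0 => s; rewrite indic_itvE in_itv/=; have [/andP[s0 _]|_] := boolP (0 <= s <= t); last by rewrite mul0r oppr0.
    have i := integ_mulb (frag_kernel_meas P (om_meas l)) (frag_kernel_le P (om_meas l) (om_bound l)) (V_integ s0).
    rewrite mul1r -IntN//; apply: Int_ge0 => y; rewrite -mulNr mulr_ge0// oppr_ge0.
    have [y0|y0] := ltP 0 y; last by rewrite /frag_kernel pos_S_supp// mulr0 mul0r.
    rewrite /frag_kernel -mulrA mulr_le0_ge0 ?frag_le0//.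
    by rewrite divr_ge0 ?pos_S_ge0// weight_ge0// ltW.
  have up : Int (fun y => om l y * (V t y / w1 y)) <= Int (fun y => y * (V t y / w1 y)).
    apply: Int_le => // [|y].
      by apply: integ_eq (integ_mulb (om_weight_meas l) (om_weight_le l) (V_integ t0)) => y; rewrite omVE.
    have [y0|y0] := ltP 0 y; last by rewrite V_supp// mul0r !mulr0.
    by rewrite ler_wpM2r// om_le.
  move: h f0 up; move: (Int _) (Int _) (Int _) (\int[_]_(_ in _) _) (\int[_]_(_ in _) _) => x1 x2 x3 x4 x5; lra.
have ci : Int (fun y => om l y * pos_init P y) @[l --> \oo] --> init_mass P.
  have [||||_ //] := @Int_dct R (fun l y => om l y * pos_init P y) (fun y => y * pos_init P y)
    (fun y => `|y * pos_init P y|).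
  - by move=> l; apply: measurable_funM => //; exact: pos_init_meas.
  - move=> y; have [y0|y0] := ltP 0 y; first by apply: cvgMl; exact: om_cvg.
    have p0 : pos_init P y = 0 by rewrite /pos_init indic_Rpos ltNge y0 mul0r.
    rewrite p0 mulr0 (_ : (fun l => _) = fun=> 0); first exact: cvg_cst.
    by apply/funext => l; rewrite mulr0.
  - move=> l y; rewrite [leLHS]normrM [leRHS]normrM ler_wpM2r//.
    have [y0|y0] := ltP 0 y; last by rewrite om_neg// normr0.
    by rewrite !ger0_norm ?om_le// ltW.
  - exact/integ_abs/init_mass_integ.
have cs : Int (fun y => om l y * pos_init P y) +
    2^-1 * \int[mu]_(s in `[0, t]) qform (coag_kernel P (om l)) (V s) @[l --> \oo] --> init_mass P.
  rewrite -[X in _ --> X]addr0; apply: cvgD => //.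
  by rewrite -[X in _ --> X](mulr0 2^-1); apply: cvgMr; exact: coag_vanish.
rewrite -(cvg_lim (@Rhausdorff R) cs); apply: limr_le; first exact: cvgP cs.
by apply: nearW => l; exact: lower.
Qed.

End mass_conservation_of_the_limit.

(** * Essentially bounded test functions and null sets of the plane *)

Section null_sets_of_the_plane.
Variable R : realType.
Local Notation mu := (@lebesgue_measure R).

Let sum_meas : measurable_fun [set: R * R] (fun p : R * R => p.1 + p.2).
Proof. by apply: measurable_funD; [exact: measurable_fst|exact: measurable_snd]. Qed.

(** Each section of this set is a translate of N. It is needed because a test function known up to a
    null set is evaluated at y + z. *)
Lemma null_sum (N : set R) : measurable N -> mu N = 0%E ->
  (mu \x mu)%E ((fun p : R * R => p.1 + p.2) @^-1` N) = 0%E.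
Proof.
move=> mN N0; rewrite /= /product_measure1 /=; apply: integral0_eq => y _ /=.
have -> : xsection ((fun p : R * R => p.1 + p.2) @^-1` N) y = (fun z : R => z + y) @^-1` N.
  by apply/seteqP; split => z; rewrite /xsection/= inE/= addrC.
by rewrite -N0; exact: lebesgue_measure_shift.
Qed.

Lemma null_fst (N : set R) : measurable N -> mu N = 0%E ->
  (mu \x mu)%E (N `*` [set: R]) = 0%E.
Proof.
move=> mN N0; have := product_measure1E mu mu mN (@measurableT _ R).
by rewrite [X in (X * _)%E]N0 mul0e.
Qed.

Lemma null_snd (N : set R) : measurable N -> mu N = 0%E ->
  (mu \x mu)%E ([set: R] `*` N) = 0%E.
Proof.
move=> mN N0; have := product_measure1E mu mu (@measurableT _ R) mN.
by rewrite [X in (_ * X)%E]N0 mule0.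
Qed.

(** The exceptional set is the union of two strips over N and of the set where y + z lies in N, all
    three null in the plane. *)
Lemma ae_eq_integ2 (K K' : R -> R -> R) (N : set R) : measurable N -> mu N = 0%E ->
  meas2 K -> integ2 K' ->
  (forall y z, ~ N y -> ~ N z -> ~ N (y + z) -> K y z = K' y z) ->
  integ2 K /\ Int (fun y => Int (K y)) = Int (fun y => Int (K' y)).
Proof.
move=> mN N0 mK iK' KK'; have mK' := integ2_meas iK'.
have ae (Q : R * R -> Prop) : (forall p, K p.1 p.2 = K' p.1 p.2 -> Q p) ->
    {ae (mu \x mu)%E, forall p : R * R, Q p}.
  move=> QK.
  have m1 : measurable (N `*` [set: R]) by exact: measurableX.
  have m2 : measurable ([set: R] `*` N) by exact: measurableX.
  have m3 : measurable ((fun p : R * R => p.1 + p.2) @^-1` N).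
    by rewrite -[X in measurable X]setTI; exact: sum_meas.
  have n1 : (mu \x mu)%E.-negligible (N `*` [set: R]).
    by exists (N `*` [set: R]); split => //; exact: null_fst.
  have n2 : (mu \x mu)%E.-negligible ([set: R] `*` N).
    by exists ([set: R] `*` N); split => //; exact: null_snd.
  have n3 : (mu \x mu)%E.-negligible ((fun p : R * R => p.1 + p.2) @^-1` N).
    by exists ((fun p : R * R => p.1 + p.2) @^-1` N); split => //; exact: null_sum.
  apply: negligibleS (negligibleU (negligibleU n1 n2) n3) => -[y z] /= nK.
  apply: contrapT => /not_orP[/not_orP[h1 h2] h3].
  by apply: nK; apply: QK; apply: KK' => // h; [apply: h1|apply: h2].
have mE : measurable_fun [set: R * R] (fun p : R * R => (K p.1 p.2)%:E) by exact/measurable_EFinP.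
have mE' : measurable_fun [set: R * R] (fun p : R * R => (K' p.1 p.2)%:E) by exact/measurable_EFinP.
have iK : integ2 K.
  have /integrableP[_ foo] := iK'; apply/integrableP; split => //.
  rewrite (@ae_eq_integral _ _ _ (mu \x mu)%E setT (fun p => `|(K' p.1 p.2)%:E|%E))//.
  - exact: measurableT_comp.
  - exact: measurableT_comp.
  - by apply: ae => p /= pE _; rewrite pE.
split; first exact: iK.
have [_ e1] := integ2_Int iK; have [_ e2] := integ2_Int iK'.
apply: EFin_inj; rewrite e1 e2.
by apply: ae_eq_integral => //; apply: ae => p /= pE _; rewrite pE.
Qed.

(** The estimates use test functions bounded everywhere. [om] is such a representative of w, equal
    to it on the half-line outside the null set N. *)
Lemma Linfty_bounded (w : R -> R) : in_Linfty w -> exists (om : R -> R) (C : R) (N : set R),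
  [/\ measurable_fun setT om, forall y, `|om y| <= C,
      measurable N /\ mu N = 0%E, measurable_fun setT (w \_ Rpos) &
      forall y, ~ N y -> (w \_ Rpos) y = om y].
Proof.
rewrite /in_Linfty => /andP[]; rewrite !inE/= => mw fw.
have mw' : measurable_fun setT (w \_ Rpos) by [].
have [C hC] : exists C : R, {ae mu, forall y, `|(w \_ Rpos) y| <= C}.
  (* The norm at exponent infinity is given by the essential supremum once the whole space is known
     to have positive measure. *)
  move: fw; rewrite /finite_norm unlock /=.
  have m1 : (mu `[0%R, 1%R] <= mu [set: R])%E.
    by apply: le_measure => //; rewrite inE; [exact: measurable_itv|exact: measurableT].
  have -> : (0 < mu [set: R])%E.
    by apply: lt_le_trans m1; rewrite lebesgue_measure_itv/= lte_fin ltr01 sube0 lte_fin.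
  by move=> /ess_sup_inf.ess_supr_bounded.
have [N [mN N0 hN]] := hC.
pose om y := if `|(w \_ Rpos) y| <= C then (w \_ Rpos) y else 0.
exists om, `|C|, N; split => //.
- apply: measurable_fun_ifT => //.
  by apply: measurable_fun_ler => //; exact: measurableT_comp.
- move=> y; rewrite /om; case: ifP => [h|_]; last by rewrite normr0.
  exact: le_trans h (ler_norm _).
- move=> y Ny; rewrite /om; case: ifP => // h.
  by exfalso; apply: Ny; apply: hN => /=; rewrite h.
Qed.

End null_sets_of_the_plane.

(** * The weak formulation for the limit *)

Section weak_formulation_of_the_limit.
Variables (R : realType) (P : coag_frag R).
Local Notation mu := (@lebesgue_measure R).
Local Notation b := (breakage (cf_nu P)).
Local Notation w1 := (weight (- cf_beta P)).

Variables (phi : nat -> nat) (V : R -> R -> R).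
Hypothesis VP : weak_limit_of P phi V.

Let V_integ := wl_integ VP.
Let V_ge0 := wl_ge0 VP.
Let V_supp := wl_supp VP.

Let mRpos : measurable (Rpos : set R). Proof. exact: measurable_itv. Qed.

Definition limit_sol (t y : R) : R := V t y / w1 y.

Local Notation g := limit_sol.

Lemma limit_sol_ge0 t y : 0 <= g t y.
Proof.
have [y0|y0] := ltP 0 y; last by rewrite /limit_sol V_supp ?mul0r.
by rewrite divr_ge0// weight_ge0// ltW.
Qed.

Let g_supp t y : y <= 0 -> g t y = 0.
Proof. by move=> y0; rewrite /limit_sol V_supp// mul0r. Qed.

Let g_meas t : 0 <= t -> measurable_fun setT (g t).
Proof.
by move=> t0; apply: measurable_over_weight; [exact: integ_meas (V_integ t0)|exact: V_supp].
Qed.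

Let indicM (f h : R -> R) y : (0 < y -> f y = h y) -> (y <= 0 -> h y = 0) -> \1_Rpos y * f y = h y.
Proof.
move=> fh h0; rewrite indic_Rpos; have [y0|y0] := ltP 0 y; first by rewrite mul1r fh.
by rewrite mul0r h0.
Qed.

Lemma mass_conserving_limit : mass_conserving (cf_gin P) g.
Proof.
move=> t t0; rewrite !Int_set.
transitivity (init_mass P).
  rewrite -(limit_mass VP t0); apply: Int_eq => y.
  apply: (@indicM (fun y => y * g t y) (fun y => y * (V t y / w1 y))) => // y0.
  by rewrite V_supp// mul0r mulr0.
apply: ae_eq_Int.
- by apply: measurable_funM => //; exact: pos_init_meas.
- rewrite (_ : (fun y => _) = (fun y => y * (\1_Rpos y * cf_gin P y))); last first.
    by apply/funext => y; rewrite mulrCA.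
  by apply: measurable_funM => //; exact: init_meas.
- by apply: ae_imp (pos_init_ae P) => y <-; rewrite mulrCA.
Qed.

Section essentially_bounded_test.
Variables (w om : R -> R) (C : R) (N : set R).
Hypothesis mom : measurable_fun setT om.
Hypothesis omC : forall y, `|om y| <= C.
Hypothesis N_null : measurable N /\ mu N = 0%E.
Hypothesis mw : measurable_fun setT (w \_ Rpos).
Hypothesis wom : forall y, ~ N y -> (w \_ Rpos) y = om y.

Let wp : R -> R := w \_ Rpos.

Let wp_pos y : 0 < y -> wp y = w y.
Proof. by move=> y0; rewrite /wp patchE /Rpos mem_setE in_itv/= y0. Qed.

Let ae_N (Q : R -> Prop) : (forall y, ~ N y -> Q y) -> {ae mu, forall y, Q y}.
Proof.
have [mN N0] := N_null; move=> h; exists N; split => //.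
by move=> y /= nQ; apply: contrapT => nN; apply: nQ; exact: h.
Qed.

Let coag (s y z : R) := omega_tilde w y z * cf_A P y z * g s y * g s z.
Let frag (s y : R) := eta_frag b w y * cf_S P y * g s y.

(** K carries the given test function and K' its bounded representative, with the weights moved to
    V. They may differ on a planar null set, so integrability and value are transferred from K' to
    K. *)
Let K s y z := omega_tilde wp y z * pos_A P y z * (g s y * g s z).
Let K' s y z := coag_kernel P om y z * (V s y * V s z).

Let K'E s y z : K' s y z = omega_tilde om y z * pos_A P y z * (g s y * g s z).
Proof. by rewrite /K' /coag_kernel /limit_sol invfM; ring. Qed.

Let mK s : 0 <= s -> meas2 (K s).
Proof.
move=> s0; apply: meas2_mul.
  apply: meas2_mul; last exact: pos_A_meas.
  exact: (meas2_add (meas2_add (meas2_sum mw) (meas2_opp (meas2_fst mw)))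
    (meas2_opp (meas2_snd mw))).
by apply: meas2_mul; [apply: meas2_fst|apply: meas2_snd]; exact: g_meas.
Qed.

Let iK' s : 0 <= s -> integ2 (K' s).
Proof.
move=> s0; have iV := V_integ s0; have mV := integ_meas iV.
apply: (@integ2_bound _ _ (fun y => 12 * C * cf_k1 P * V s y) (V s)) => //.
- apply: meas2_mul; first exact: coag_kernel_meas.
  by apply: meas2_mul; [exact: meas2_fst|exact: meas2_snd].
- exact: integZ.
- move=> y z; have VV : 0 <= V s y * V s z by exact: mulr_ge0.
  by rewrite normrM (ger0_norm VV) -mulrA ler_wpM2r// (coag_kernel_le P omC).
Qed.

Let KK' s : 0 <= s -> integ2 (K s) /\ Int (fun y => Int (K s y)) = Int (fun y => Int (K' s y)).
Proof.
move=> s0; have [mN N0] := N_null.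
apply: (ae_eq_integ2 mN N0 (mK s0) (iK' s0)) => y z Ny Nz Nyz.
by rewrite K'E /K /omega_tilde /wp !wom.
Qed.

Let coagK s y z : 0 < y -> 0 < z -> coag s y z = K s y z.
Proof.
move=> y0 z0; rewrite /coag /K /omega_tilde !wp_pos ?addr_gt0//.
by rewrite /pos_A !indic_Rpos y0 z0 !mul1r mulrA.
Qed.

Let K_supp s y z : ~~ ((0 < y) && (0 < z)) -> K s y z = 0.
Proof. by move=> yz; rewrite /K pos_A_supp// mulr0 mul0r. Qed.

Lemma limit_coag_integrable s : 0 <= s -> (mu \x mu)%E.-integrable (Rpos `*` Rpos)
  (fun p : R * R => (coag s p.1 p.2)%:E).
Proof.
move=> s0; have [iK _] := KK' s0.
have mD : measurable (Rpos `*` Rpos : set (R * R)) by exact: measurableX.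
have H := integrable_mkcond (mu := (mu \x mu)%E) (fun p : R * R => (coag s p.1 p.2)%:E) mD.
rewrite H (_ : _ \_ _ = (fun p : R * R => (K s p.1 p.2)%:E)); first exact: iK.
apply/funext => -[y z]; rewrite patchE in_setX /Rpos !mem_setE !in_itv/= !andbT.
by case: ifPn => [/andP[y0 z0]|yz]; [rewrite coagK|rewrite K_supp].
Qed.

Lemma limit_coagE s : 0 <= s ->
  \int[mu]_(y in Rpos) \int[mu]_(z in Rpos) coag s y z = qform (coag_kernel P om) (V s).
Proof.
move=> s0; have [_ E] := KK' s0; have iV := V_integ s0.
rewrite Int_set (Int_eq (g := fun y => Int (K s y))).
  rewrite E; apply: Int_eq => y.
  have i := integ_row (coag_kernel_meas P mom) (coag_kernel_le P omC) iV y.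
  rewrite mulrC -(IntZ (V s y) i); apply: Int_eq => z.
  by rewrite /K'; ring.
move=> y; apply: (@indicM (fun y => \int[mu]_(z in Rpos) coag s y z) (fun y => Int (K s y))) => y0.
  rewrite Int_set; apply: Int_eq => z; apply: (@indicM (coag s y) (K s y)) => z0.
    exact: coagK.
  by rewrite K_supp// negb_and -!leNgt z0 orbT.
rewrite (Int_eq (g := fun=> 0)) ?Int0// => z.
by rewrite K_supp// negb_and -!leNgt y0.
Qed.

(** The representative [om] replaces w under the integral, where null sets do not matter, but not in
    front of it. This makes the comparison with the integrand of the statement a pointwise
    equality. *)
Let F s y := (wp y - Int (fun z => b z y * om z)) * pos_S P y * g s y.

Let fragF s y : \1_Rpos y * frag s y = F s y.
Proof.
apply: (@indicM (frag s) (F s)) => y0; last by rewrite /F g_supp// mulr0.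
rewrite /frag /F /eta_frag wp_pos// /pos_S indic_Rpos y0 mul1r.
congr ((_ - _) * _ * _); rewrite Int_set.
transitivity (Int (fun z => b z y * wp z)).
  apply: Int_eq => z; rewrite indic_itvE in_itv/=.
  have [/andP[z0 zy]|zy] := boolP (0 < z < y); first by rewrite mul1r wp_pos.
  by rewrite mul0r breakage_supp// mul0r.
apply: ae_eq_Int.
- by apply: measurable_funM => //; apply: meas2_r; exact: breakage_meas.
- by apply: measurable_funM => //; apply: meas2_r; exact: breakage_meas.
- by apply: ae_N => z Nz; rewrite /wp wom.
Qed.

Let F_ae s : {ae mu, forall y, frag_kernel P om y * V s y = F s y}.
Proof.
apply: ae_N => y Ny; rewrite /F /wp wom// /frag_kernel /frag_test /limit_sol.
by rewrite -!mulrA [(w1 y)^-1 * _]mulrC.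
Qed.

Let F_meas s : 0 <= s -> measurable_fun setT (F s).
Proof.
move=> s0; apply: measurable_funM; last exact: g_meas.
apply: measurable_funM; last exact: pos_S_meas.
apply: measurable_funB => //; apply: meas_Int.
by apply: meas2_mul; [apply: meas2_swap; exact: breakage_meas|exact: meas2_snd].
Qed.

Let fk_integ s : 0 <= s -> integ (fun y => frag_kernel P om y * V s y).
Proof.
by move=> s0; apply: integ_mulb (frag_kernel_meas P mom) (frag_kernel_le P mom omC) (V_integ s0).
Qed.

Lemma limit_frag_integrable s : 0 <= s -> mu.-integrable Rpos (fun y => (frag s y)%:E).
Proof.
move=> s0; apply/(integ_set (frag s) mRpos).
apply: integ_eq (ae_eq_integ (F_meas s0) (F_ae s) (fk_integ s0)) => y.
by rewrite fragF.
Qed.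

Lemma limit_fragE s : 0 <= s ->
  \int[mu]_(y in Rpos) frag s y = Int (fun y => frag_kernel P om y * V s y).
Proof.
move=> s0; rewrite Int_set (Int_eq (fragF s)); apply: esym; apply: ae_eq_Int (F_ae s).
- exact: integ_meas (fk_integ s0).
- exact: F_meas.
Qed.

Lemma limit_testE t : 0 <= t ->
  \int[mu]_(y in Rpos) ((g t y - cf_gin P y) * w y) =
  Int (fun y => om y * (V t y / w1 y)) - Int (fun y => om y * pos_init P y).
Proof.
move=> t0; have iV := V_integ t0.
have E y : om y * (V t y / w1 y) = \1_Rpos y * om y / w1 y * V t y.
  have [y0|y0] := ltP 0 y; last by rewrite V_supp// mul0r !mulr0.
  by rewrite indic_Rpos y0 mul1r mulrA mulrAC.
have mow : measurable_fun setT (fun y => \1_Rpos y * om y / w1 y).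
  apply: measurable_over_weight => [|y y0]; last by rewrite indic_Rpos ltNge y0 mul0r.
  by apply: measurable_funM => //; exact: measurable_indic.
have C0 : 0 <= C := le_trans (normr_ge0 (om 0)) (omC 0).
have owC y : `|\1_Rpos y * om y / w1 y| <= C.
  apply: over_weight_le => // y0; first by rewrite indic_Rpos ltNge y0 mul0r.
  by rewrite indic_Rpos y0 mul1r (le_trans (omC y))// ler_peMr// le1_weight// beta_le0.
have i1 : integ (fun y => om y * (V t y / w1 y)).
  by apply: integ_eq (integ_mulb mow owC iV) => y; rewrite E.
have i2 := integ_mulb mom omC (pos_init_integ P).
have e := IntB i1 i2; rewrite -e Int_set; apply: ae_eq_Int.
- rewrite (_ : (fun y => _) = (fun y => (g t y - \1_Rpos y * cf_gin P y) * wp y)); last first.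
    apply/funext => y; apply: (@indicM (fun y => (g t y - cf_gin P y) * w y)
      (fun y => (g t y - \1_Rpos y * cf_gin P y) * wp y)) => y0.
      by rewrite wp_pos// indic_Rpos y0 mul1r.
    by rewrite indic_Rpos ltNge y0 mul0r subr0 g_supp// mul0r.
  apply: measurable_funM => //; apply: measurable_funB; [exact: g_meas|exact: init_meas].
- exact: integ_meas (integB i1 i2).
- apply: ae_imp (ae_and (pos_init_ae P) (ae_N (Q := fun y => wp y = om y) wom)) => y [<- <-].
  apply: (@indicM (fun y => (g t y - cf_gin P y) * w y)
    (fun y => wp y * (V t y / w1 y) - wp y * (\1_Rpos y * cf_gin P y))) => y0.
    by rewrite wp_pos// indic_Rpos y0 mul1r -mulrBr mulrC.
  by rewrite indic_Rpos ltNge y0 mul0r mulr0 subr0 V_supp// mul0r mulr0.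
Qed.

End essentially_bounded_test.

Lemma weak_formulation_limit :
  weak_formulation (cf_A P) (cf_S P) (breakage (cf_nu P)) (cf_gin P) g.
Proof.
move=> T t w T0 tI wL coag frag.
have /andP[t0 tT] : 0 <= t <= T by move: tI; rewrite in_itv.
have [om [C [N [mom omC N0 mw wom]]]] := Linfty_bounded wL.
have mI : measurable (`[0, t] : set R) by exact: measurable_itv.
have coagE s : 0 <= s <= t -> \int[mu]_(y in Rpos) \int[mu]_(z in Rpos) coag s y z =
    qform (coag_kernel P om) (V s).
  by move=> /andP[s0 _]; exact: limit_coagE mom omC N0 mw wom s s0.
have fragE s : 0 <= s <= t -> \int[mu]_(y in Rpos) frag s y = Int (fun y => frag_kernel P om y * V s y).
  by move=> /andP[s0 _]; exact: limit_fragE mom omC N0 mw wom s s0.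
split.
- move=> s; rewrite in_itv/= => /andP[s0 _].
  exact: limit_coag_integrable mom omC N0 mw wom s s0.
- move=> s; rewrite in_itv/= => /andP[s0 _].
  exact: limit_frag_integrable mom omC N0 mw wom s s0.
- have := proj2 (integ_set _ mI) (limit_rhs_coag_integ VP mom omC t).
  by apply: eq_integrable => // s; rewrite inE/= in_itv/= => st; rewrite coagE.
- have := proj2 (integ_set _ mI) (limit_rhs_frag_integ VP mom omC t).
  by apply: eq_integrable => // s; rewrite inE/= in_itv/= => st; rewrite fragE.
- have e1 : \int[mu]_(s in `[0, t]) \int[mu]_(y in Rpos) \int[mu]_(z in Rpos) coag s y z =
      \int[mu]_(s in `[0, t]) qform (coag_kernel P om) (V s).
    by apply: eq_Rintegral => s; rewrite inE/= in_itv/=; exact: coagE.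
  have e2 : \int[mu]_(s in `[0, t]) \int[mu]_(y in Rpos) frag s y =
      \int[mu]_(s in `[0, t]) Int (fun y => frag_kernel P om y * V s y).
    by apply: eq_Rintegral => s; rewrite inE/= in_itv/=; exact: fragE.
  rewrite e1 e2; apply: etrans (limit_equation_split VP mom omC t0).
  exact: limit_testE mom omC N0 mw wom t t0.
Qed.

End weak_formulation_of_the_limit.

(** * Convergence in the weighted space *)

Section weak_convergence.
Variables (R : realType) (P : coag_frag R).
Local Notation mu := (@lebesgue_measure R).
Local Notation beta := (cf_beta P).
Local Notation w1 := (weight (- cf_beta P)).

Variables (phi : nat -> nat) (V : R -> R -> R).
Hypothesis VP : weak_limit_of P phi V.

Let mRpos : measurable (Rpos : set R). Proof. exact: measurable_itv. Qed.

Let segment_continuous (f : R -> R) (T : R) :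
  (forall e : R, 0 < e -> exists2 d : R, 0 < d & forall s t, 0 <= s <= T -> 0 <= t <= T ->
    `|t - s| <= d -> `|f t - f s| <= e) -> {within `[0, T], continuous f}.
Proof.
move=> h; apply/subspace_continuousP => x /=; rewrite in_itv/= => xT.
apply/cvgrPdist_le => e e0; have [d d0 hd] := h e e0.
apply/nbhs_ballP; exists d => //= y; rewrite /ball/= => xy; rewrite in_itv/= => yT.
by apply: hd => //; exact: ltW.
Qed.

Section sol.
Variable n : nat.
Local Notation u := (cf_gn P n.+1).

Let sol_wsol t : 0 <= t -> {ae mu, forall y, wsol P n t y = \1_Rpos y * (w1 y * u t y)}.
Proof.
move=> t0; have [_ _ _ u0] := cf_gn_sol P (ltn0Sn n).
apply: ae_imp (pos_sol_ae P n t0) => y; rewrite /wsol => <-.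
rewrite indic_Rpos indic_itvE in_itv/=.
have [y0|] := ltP 0 y; last by rewrite !mul0r mulr0.
have [yn|yn] := ltP y n.+1%:R; first by rewrite !mul1r.
by rewrite (u0 t y t0 yn) !mulr0.
Qed.

Let sol_meas t : 0 <= t -> measurable_fun setT (fun y => \1_Rpos y * (w1 y * u t y)).
Proof.
move=> t0; have [[v uv _] _ _ u0] := cf_gn_sol P (ltn0Sn n).
rewrite (_ : (fun y => _) = (fun y => w1 y * (\1_(`]0, n.+1%:R[) y * u t y))).
  by apply: measurable_funM; [exact: measurable_weight|exact: integ_meas (C1_integ_sol uv t0)].
apply/funext => y; rewrite indic_Rpos indic_itvE in_itv/=.
have [y0|] := ltP 0 y; last by rewrite !mul0r mulr0.
have [yn|yn] := ltP y n.+1%:R; first by rewrite !mul1r.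
by rewrite (u0 t y t0 yn) !mulr0.
Qed.

Lemma sol_in_L1w t : 0 <= t -> in_L1w (- beta) (u t).
Proof.
move=> t0; apply/(integ_set (fun y => w1 y * u t y) mRpos).
exact: ae_eq_integ (sol_meas t0) (sol_wsol t0) (wsol_integ P n t0).
Qed.

(** At each time the given solution agrees with its nonnegative representative almost everywhere,
    and w with [om]; the pairing of the statement is therefore one already controlled for [wsol]. *)
Lemma sol_test t (w om : R -> R) C (N : set R) : 0 <= t -> measurable_fun setT om ->
  (forall y, `|om y| <= C) -> measurable N /\ mu N = 0%E -> measurable_fun setT (w \_ Rpos) ->
  (forall y, ~ N y -> (w \_ Rpos) y = om y) ->
  integ (fun y => \1_Rpos y * (w1 y * u t y * w y)) /\
  \int[mu]_(y in Rpos) (w1 y * u t y * w y) = Int (fun y => om y * wsol P n t y).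
Proof.
move=> t0 mom omC [mN N0] mw wom; rewrite Int_set.
have E y : \1_Rpos y * (w1 y * u t y * w y) = (w \_ Rpos) y * (\1_Rpos y * (w1 y * u t y)).
  rewrite patchE /Rpos mem_setE in_itv/= andbT indic_Rpos.
  by have [y0|y0] := ltP 0 y; rewrite ?mul0r// !mul1r mulrC.
rewrite (Int_eq E).
have mE : measurable_fun setT (fun y => (w \_ Rpos) y * (\1_Rpos y * (w1 y * u t y))).
  by apply: measurable_funM => //; exact: sol_meas.
have iom := integ_mulb mom omC (wsol_integ P n t0).
have aN : {ae mu, forall y, (w \_ Rpos) y = om y}.
  by exists N; split => // y /= ny; apply: contrapT => Ny; apply: ny; exact: wom.
have aE : {ae mu, forall y, om y * wsol P n t y = (w \_ Rpos) y * (\1_Rpos y * (w1 y * u t y))}.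
  by apply: ae_imp (ae_and aN (sol_wsol t0)) => y [-> <-].
split; last by apply: esym; exact: ae_eq_Int (integ_meas iom) mE aE.
by apply: integ_eq (ae_eq_integ mE aE iom) => y; rewrite E.
Qed.

Lemma sol_weakly_continuous T : weakly_continuous T (- beta) u.
Proof.
split=> [t|w /Linfty_bounded[om [C [N [mom omC N0 mw wom]]]]].
  by rewrite in_itv/= => /andP[t0 _]; exact: sol_in_L1w.
apply: segment_continuous => e e0.
have [d d0 hd] := wsol_equicontinuous P T mom omC e0; exists d => // s t sT tT st.
have /andP[s0 _] := sT; have /andP[t0 _] := tT.
by rewrite (sol_test t0 mom omC N0 mw wom).2 (sol_test s0 mom omC N0 mw wom).2; exact: hd.
Qed.

End sol.

Local Notation g := (limit_sol P V).

Let V_integ := wl_integ VP.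
Let V_supp := wl_supp VP.

Let gV t y : \1_Rpos y * (w1 y * g t y) = V t y.
Proof.
rewrite indic_Rpos; have [y0|y0] := ltP 0 y; last by rewrite V_supp// mul0r.
by rewrite mul1r mulrC divfK// gt_eqF// weight_gt0.
Qed.

Lemma limit_test t (w om : R -> R) C (N : set R) : 0 <= t -> measurable_fun setT om ->
  (forall y, `|om y| <= C) -> measurable N /\ mu N = 0%E -> measurable_fun setT (w \_ Rpos) ->
  (forall y, ~ N y -> (w \_ Rpos) y = om y) ->
  integ (fun y => \1_Rpos y * (w1 y * g t y * w y)) /\
  \int[mu]_(y in Rpos) (w1 y * g t y * w y) = Int (fun y => om y * V t y).
Proof.
move=> t0 mom omC [mN N0] mw wom; rewrite Int_set.
have E y : \1_Rpos y * (w1 y * g t y * w y) = (w \_ Rpos) y * V t y.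
  rewrite -[V t y]gV patchE /Rpos mem_setE in_itv/= andbT indic_Rpos.
  by have [y0|y0] := ltP 0 y; rewrite ?mul0r// !mul1r mulrC.
rewrite (Int_eq E).
have mE : measurable_fun setT (fun y => (w \_ Rpos) y * V t y).
  by apply: measurable_funM => //; exact: integ_meas (V_integ t0).
have iom := integ_mulb mom omC (V_integ t0).
have aE : {ae mu, forall y, om y * V t y = (w \_ Rpos) y * V t y}.
  by exists N; split => // y /= ny; apply: contrapT => Ny; apply: ny; rewrite wom.
split; last by apply: esym; exact: ae_eq_Int (integ_meas iom) mE aE.
by apply: integ_eq (ae_eq_integ mE aE iom) => y; rewrite E.
Qed.

Lemma limit_in_L1w t : 0 <= t -> in_L1w (- beta) (g t).
Proof.
move=> t0; apply/(integ_set (fun y => w1 y * g t y) mRpos).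
by apply: integ_eq (V_integ t0) => y; rewrite gV.
Qed.

Lemma limit_weakly_continuous T : weakly_continuous T (- beta) g.
Proof.
split=> [t|w /Linfty_bounded[om [C [N [mom omC N0 mw wom]]]]].
  by rewrite in_itv/= => /andP[t0 _]; exact: limit_in_L1w.
apply: segment_continuous => e e0.
have [d d0 hd] := V_equicontinuous VP T mom omC e0; exists d => // s t sT tT st.
have /andP[s0 _] := sT; have /andP[t0 _] := tT.
by rewrite (limit_test t0 mom omC N0 mw wom).2 (limit_test s0 mom omC N0 mw wom).2; exact: hd.
Qed.

Let cvg_sup0 (u : nat -> \bar R) : (forall k, (0 <= u k)%E) ->
  (forall e : R, 0 < e -> exists N, forall k, (N <= k)%N -> (u k <= e%:E)%E) ->
  u k @[k --> \oo] --> 0%E.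
Proof.
move=> u0 ule; apply/fine_cvgP; split.
  have [N hN] := ule 1 ltr01; exists N => // k /= Nk.
  by rewrite ge0_fin_numE// (le_lt_trans (hN k Nk))// ltry.
apply/cvgrPdist_le => e e0; have [N hN] := ule e e0; exists N => // k /= Nk.
have fk : u k \is a fin_num by rewrite ge0_fin_numE// (le_lt_trans (hN k Nk))// ltry.
by rewrite sub0r normrN ger0_norm ?fine_ge0// -lee_fin fineK// hN.
Qed.

Lemma weakly_converges_limit T : 0 < T ->
  weakly_converges T (- beta) (fun k => cf_gn P (phi k).+1) g.
Proof.
move=> T0; split => [k||w wL]; [exact: sol_weakly_continuous|exact: limit_weakly_continuous|].
have [om [C [N [mom omC N0 mw wom]]]] := Linfty_bounded wL.
apply: cvg_sup0 => [k|e e0].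
  (* The supremum is nonnegative because it includes the time 0. *)
  apply: (@le_trans _ _
    `|\int[mu]_(y in Rpos) (w1 y * (cf_gn P (phi k).+1 0 y - g 0 y) * w y)|%:E); first by rewrite lee_fin.
  by apply: ereal_sup_ubound; exists 0 => //=; rewrite in_itv/= lexx ltW.
have [M hM] := wl_unif VP T mom omC e0; exists M => k Mk.
apply: ge_ereal_sup => x [t /= tI <-].
have tT : 0 <= t <= T by move: tI; rewrite in_itv.
have /andP[t0 _] := tT; rewrite lee_fin.
have [i1 e1] := sol_test (phi k) t0 mom omC N0 mw wom.
have [i2 e2] := limit_test t0 mom omC N0 mw wom.
have eB : \int[mu]_(y in Rpos) (w1 y * (cf_gn P (phi k).+1 t y - g t y) * w y) =
    Int (fun y => om y * wsol P (phi k) t y) - Int (fun y => om y * V t y).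
  rewrite -e1 -e2 !Int_set -(IntB i1 i2); apply: Int_eq => y.
  by move: (limit_sol _ _ _ _) (cf_gn _ _ _ _) => x1 x2; ring.
by rewrite eB; exact: hM.
Qed.

End weak_convergence.

Theorem theorem2p2 (R : realType) (k1 k2 beta nu : R)
    (A : R -> R -> R) (S gin : R -> R) (zeta : R) (gn : nat -> R -> R -> R)
    (k1_ge0 : 0 <= k1) (k2_ge0 : 0 <= k2)
    (beta_range : 0 <= beta < 2^-1) (nu_range : -1 < nu <= 0)
    (A_meas : measurable_fun (Rpos `*` Rpos) (fun p : R * R => A p.1 p.2))
    (A_ge0 : forall y z : R, 0 < y -> 0 < z -> 0 <= A y z)
    (A_sym : forall y z : R, 0 < y -> 0 < z -> A y z = A z y)
    (S_meas : measurable_fun (Rpos) S)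
    (S_ge0 : forall y : R, 0 < y -> 0 <= S y)
    (A_bound : forall y z : R, 0 < y -> 0 < z ->
       A y z <= k1 * ((1 + y + z) / (y * z) `^ beta))
    (b_bound : exists c1 : R, 2 < c1 /\ forall z : R, 0 < z ->
       (\int[lebesgue_measure]_(y in `]0%R, z[)
          (y `^ (- (2 * beta)) * breakage nu y z)%:E
        <= (c1 * z `^ (- (2 * beta)))%:E)%E)
    (S_bound : forall y : R, 0 < y -> S y <= k2 * y `^ (1 + nu))
    (gamma_cond : exists gamma : R,
       1 < gamma < 2 /\ 0 < gamma * (nu - beta) + 1)
    (gin_ge0 : \forall y \ae (@lebesgue_measure R), 0 < y -> 0 <= gin y)
    (gin_L1 : in_L1w (- (2 * beta)) gin)
    (zeta01 : zeta = 0 \/ zeta = 1)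
    (gn_sol : forall n, (1 <= n)%N ->
       truncated_solution A S (breakage nu) gin zeta n (gn n)) :
  exists (phi : nat -> nat) (g : R -> R -> R),
    [/\ (forall k, (1 <= phi k)%N) /\ {homo phi : i j / (i < j)%N},
        forall t y : R, 0 <= t -> 0 < y -> 0 <= g t y,
        forall T : R, 0 < T ->
          weakly_converges T (- beta) (fun k => gn (phi k)) g,
        mass_conserving gin g &
        weak_formulation A S (breakage nu) gin g].
Proof.
have [c1 [c1_gt2 b_le]] := b_bound.
pose P := CoagFrag k1_ge0 k2_ge0 beta_range nu_range A_meas A_ge0 A_sym S_meas S_ge0 A_bound
  c1_gt2 b_le S_bound gin_ge0 gin_L1 zeta01 gn_sol.
have [phi [V VP]] := weak_limit_exists P.
(* Internal index n stands for the truncation parameter n + 1; the shift also makes every parameter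
   at least 1. *)
exists (fun k => (phi k).+1), (limit_sol P V); split.
- by split => // i j ij; rewrite ltnS; exact: (wl_homo VP).
- by move=> t y _ _; exact: (limit_sol_ge0 VP).
- by move=> T T0; exact: (weakly_converges_limit VP T0).
- exact: (mass_conserving_limit VP).
- exact: (weak_formulation_limit VP).
Qed.
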